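(* Let $(B,M_0)$ be a principally polarized abelian variety, $B=\mathbb{C}^g/\Lambda$, $M_0=L(H,\chi_0)$ of characteristic $0$ with respect to a symplectic basis $\lambda_1,\dots,\lambda_g,\mu_1,\dots,\mu_g$ of $\Lambda$. Let $D=(d_1,\dots,d_g)$ be a type (positive integers with $d_i\mid d_{i+1}$), let $\Lambda'=\langle \lambda_1,\dots,\lambda_g,d_1\mu_1,\dots,d_g\mu_g\rangle$, $A=\mathbb{C}^g/\Lambda'$, let $p:A\to B$ be the natural projection, and let $L=p^*M_0$, a line bundle of type $D$ and characteristic $0$ on $A$. Let $$K_1=\Big\{\tfrac{n_1}{d_1}\lambda_1+\dots+\tfrac{n_g}{d_g}\lambda_g \;\Big|\; n_i\in\mathbb{Z},\ 1\le i\le g\Big\}\Big/\Lambda_1,\qquad Z_2=\big(\tfrac12\Lambda_1\big)/\Lambda_1,$$ where $\Lambda_1=\langle\lambda_1,\dots,\lambda_g\rangle$. Then $L$ is $2$-normal if and only if for each $w\in K_1/2K_1$ the matrix $$\left(\vartheta^0_{u+z-\frac{w}{2}}(0)\right)_{u\in K_1,\ z\in Z_2}$$ has rank $2^g$, where $\vartheta^0_c$ denotes the canonical theta functions of $M_0^2$.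
   Context: All varieties are over $\mathbb{C}$. $L(H,\chi)$ denotes the line bundle with Appell–Humbert data $(H,\chi)$; $H$ is a Hermitian form on $\mathbb{C}^g$, linear in the first variable, and $E=\operatorname{Im}H$; here $H$ is positive definite and $E|_{\Lambda\times\Lambda}$ is unimodular. A symplectic basis satisfies $E(\lambda_i,\mu_j)=\delta_{ij}$, $E(\lambda_i,\lambda_j)=E(\mu_i,\mu_j)=0$. Let $V_1,V_2$ be the real spans of $\lambda_1,\dots,\lambda_g$ and of $\mu_1,\dots,\mu_g$, so $\mathbb{C}^g=V_1\oplus V_2$; write $x=x_1+x_2$ with $x_i\in V_i$, and $\Lambda_i=\Lambda\cap V_i$. $M_0$ is of characteristic $0$ means that its semicharacter is $\chi_0(x)=\exp(\pi\imath E(x_1,x_2))$. $Z_2$ is the group of $2$-torsion points of $B$ lying in the image of $V_1$. A line bundle $L$ is $2$-normal if the multiplication map $H^0(L)\otimes H^0(L)\to H^0(L^2)$ is surjective. Canonical theta functions of $M_0^2$ (whose Hermitian form is $2H$): let $\mathcal{B}$ be the $\mathbb{C}$-bilinear extension to $\mathbb{C}^g$ of the symmetric form $H|_{V_2\times V_2}$. Put $$\vartheta^0(v)=\exp(\pi \mathcal{B}(v,v))\sum_{\lambda\in\Lambda_1}\exp\big(2\pi(H-\mathcal{B})(v,\lambda)-\pi(H-\mathcal{B})(\lambda,\lambda)\big),$$ and for $c\in V_1$ put $\vartheta^0_c(v)=\exp\big(-2\pi H(v,c)-\pi H(c,c)\big)\,\vartheta^0(v+c)$. The value $\vartheta^0_c(0)$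 depends only on $c$ modulo $\Lambda_1$. In the matrix, $u,z,w$ are replaced by representatives in $V_1$ (and $\frac w2$ is half of the chosen representative of $w$); the rank does not depend on these choices. *)

(* Defs.v *)
From HB Require Import structures.
From mathcomp Require Import all_boot all_order all_algebra.
From mathcomp Require Import finmap.
From mathcomp Require Import all_classical all_reals all_analysis.
From mathcomp Require Import complex.
From mathcomp Require summability.

Set Implicit Arguments.
Unset Strict Implicit.
Unset Printing Implicit Defensive.

Import Order.TTheory GRing.Theory Num.Theory.
Import numFieldNormedType.Exports.

Local Open Scope classical_set_scope.
Local Open Scope ring_scope.
Local Open Scope complex_scope.

Section ComplexExponential.
Variable R : realType.

Definition cexp (z : R[i]) : R[i] :=
  (expR (complex.Re z) * cos (complex.Im z))
    +i* (expR (complex.Re z) * sin (complex.Im z)).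

Definition piC : R[i] := (pi : R)%:C.

End ComplexExponential.

Section Lattices.
Variables (R : realType) (g : nat).
Local Notation C := R[i].
Local Notation V := 'rV[C]_g.

Definition zspan (I : finType) (b : I -> V) : set V :=
  range (fun n : I -> int => \sum_i (n i)%:~R *: b i).

Definition rspan (I : finType) (b : I -> V) : set V :=
  range (fun t : I -> R => \sum_i (t i)%:C *: b i).

Definition sumset (X Y : set V) : set V := [set x + y | x in X & y in Y].

Definition is_lattice (L : set V) : Prop :=
  exists2 b : 'I_(g + g) -> V,
    forall t : 'I_(g + g) -> R,
      \sum_i (t i)%:C *: b i = 0 -> forall i, t i = 0
    & L = zspan b.

(* [s] lists exactly one representative of each class of [X] modulo [N]. *)
Definition representatives (X N : set V) (s : seq V) : Prop :=
  [/\ uniq s,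
      forall r, r \in s -> X r,
      forall x, X x -> exists2 r, r \in s & N (x - r)
    & forall r r', r \in s -> r' \in s -> N (r - r') -> r = r'].

(* E = Im H. *)
Definition imform (H : V -> V -> C) (x y : V) : R := complex.Im (H x y).

Definition integral_on (L : set V) (H : V -> V -> C) : Prop :=
  forall x y, L x -> L y -> imform H x y \is a Num.int.

(* x |-> E(x, -) is a bijection from L onto Hom(L, Z). *)
Definition unimodular_on (L : set V) (H : V -> V -> C) : Prop :=
  forall f : V -> int,
    (forall x y, L x -> L y -> f (x + y) = f x + f y) ->
    exists! x, L x /\ forall y, L y -> imform H x y = (f y)%:~R.

(* Linear independence of the basis follows from the values of E. *)
Definition symplectic_basis (L : set V) (H : V -> V -> C)
    (lam mu : 'I_g -> V) : Prop :=
  [/\ L = sumset (zspan lam) (zspan mu),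
      forall i j, imform H (lam i) (mu j) = (i == j)%:R,
      forall i j, imform H (lam i) (lam j) = 0
    & forall i j, imform H (mu i) (mu j) = 0].

Definition is_type (d : 'I_g -> nat) : Prop :=
  (forall i, (0 < d i)%N) /\
  (forall i j : 'I_g, j = i.+1 :> nat -> (d i %| d j)%N).

End Lattices.

(* Stated over an abstract field: the concrete type [R[i]] carries the topology
   of [R[i]^o] only through its [numFieldType] structure. *)
Definition holomorphic (K : numFieldType) (g : nat) (f : 'rV[K]_g -> K) : Prop :=
  forall v : 'rV[K]_g, differentiable (f : 'rV[K]_g -> K^o) v.

Section LineBundles.
Variables (R : realType) (g : nat).
Local Notation C := R[i].
Local Notation V := 'rV[C]_g.

(* Appell-Humbert data of the line bundle L(H, chi) on C^g / Lambda; only the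
   values of chi on Lambda are relevant. *)
Record line_bundle := LineBundle {
  lb_lattice : set V;
  lb_form : V -> V -> C;
  lb_char : V -> C }.

(* Pull-back along the projection C^g / L' -> C^g / Lambda, for a lattice L'
   contained in Lambda: the projection is covered by the identity of C^g. *)
Definition pullback (L' : set V) (M : line_bundle) : line_bundle :=
  LineBundle L' (lb_form M) (lb_char M).

Definition tensor_square (M : line_bundle) : line_bundle :=
  LineBundle (lb_lattice M) (fun x y => 2 * lb_form M x y)
    (fun x => lb_char M x ^+ 2).

(* L(H, chi) is the quotient of C^g x C by the action of Lambda given by the
   canonical factor of automorphy; its global sections are the holomorphic
   functions on C^g (canonical theta functions) transforming by this factor. *)
Definition automorphy (M : line_bundle) (l v : V) : C :=
  lb_char M l * cexp (piC R * lb_form M v l + piC R / 2 * lb_form M l l).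

Definition H0 (M : line_bundle) : set (V -> C) :=
  [set f | holomorphic f /\
    forall l v, lb_lattice M l -> f (v + l) = automorphy M l v * f v].

(* The image of H^0(L) (x) H^0(L) consists of the finite sums of products. *)
Definition two_normal (M : line_bundle) : Prop :=
  forall f, H0 (tensor_square M) f ->
  exists (n : nat) (s t : 'I_n -> V -> C),
    (forall k, H0 M (s k) /\ H0 M (t k)) /\
    forall v, f v = \sum_k s k v * t k v.

Definition characteristic0 (M : line_bundle) (lam mu : 'I_g -> V) : Prop :=
  forall x1 x2, rspan lam x1 -> rspan mu x2 -> lb_lattice M (x1 + x2) ->
    lb_char M (x1 + x2) =
      cexp (piC R * 'i * (imform (lb_form M) x1 x2)%:C).

End LineBundles.

Section ThetaFunctions.
Variables (R : realType) (g : nat).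
Local Notation C := R[i].
Local Notation V := 'rV[C]_g.

(* [B] is C-bilinear by its type. *)
Definition bilinear_extension (H : V -> V -> C) (mu : 'I_g -> V)
    (B : {biscalar V}) : Prop :=
  forall x y, rspan mu x -> rspan mu y -> B x y = H x y.

(* The unconditional sum over Lambda_1 is indexed by the coordinates of its
   elements in the basis [lam]. *)
Definition theta0 (H B : V -> V -> C) (lam : 'I_g -> V) (v : V) : C :=
  cexp (piC R * B v v) *
  (summability.sum (fun n : {ffun 'I_g -> int} =>
     let l := \sum_i (n i)%:~R *: lam i in
     cexp (2 * piC R * (H v l - B v l) - piC R * (H l l - B l l)) : C^o) : C).

Definition theta0c (H B : V -> V -> C) (lam : 'I_g -> V) (c v : V) : C :=
  cexp (- (2 * piC R * H v c) - piC R * H c c) * theta0 H B lam (v + c).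

(* Preimages in V_1 of the groups K_1, 2 K_1 and Z_2. *)
Definition K1 (lam : 'I_g -> V) (d : 'I_g -> nat) : set V :=
  range (fun n : 'I_g -> int => \sum_i ((n i)%:~R / (d i)%:R) *: lam i).

Definition twiceK1 (lam : 'I_g -> V) (d : 'I_g -> nat) : set V :=
  sumset [set 2 *: x | x in K1 lam d] (zspan lam).

Definition Z2 (lam : 'I_g -> V) : set V := [set 2^-1 *: x | x in zspan lam].

Definition theta_matrix (H B : V -> V -> C) (lam : 'I_g -> V)
    (U Z : seq V) (w : V) : 'M[C]_(size U, size Z) :=
  \matrix_(i, j) theta0c H B lam (U`_i + Z`_j - 2^-1 *: w) 0.

End ThetaFunctions.

(* Main.v *)
(* Write S = H - B. The factor exp(- k pi B(v, v) / 2) turns the sections of L^k into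
   functions which are periodic for the d_i mu_i and quasi-periodic for the
   lam_i. Such an F expands into the characters exp(- pi S(v, r)), r in K_1
   (lifted to V_1); its normalized Fourier coefficients b_r(F) depend only on r modulo
   k Lambda_1, and they determine F. The classical theta series theta^k_u
   have b_r = 1 if r is congruent to u modulo k Lambda_1 and 0 otherwise. By the parallelogram
   law for Gaussians,
     b_r (theta^1_u theta^1_u') = N(2 u - r) if r = u + u' modulo Lambda_1, and 0 otherwise,
   where N(c) is the value at 0 of the canonical theta function with index c / 2.
   Hence, on the coefficients with index in a class w + Lambda_1, indexed by r = w - 2 z,
   the products of sections of L span the row space of the matrix for w, whose
   entries are N(2 u - w + 2 z). The 2^g columns are indexed by Z_2, so L is 2-normal
   iff this row space is everything, first for every class of K_1, and then, since
   (u, r) -> (u + kappa, r + 2 kappa) preserves 2 u - r, for representatives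
   modulo 2 K_1.
   Fourier coefficients are limits of means over finite grids; Goursat's theorem makes
   them independent of the base point of the torus of integration. *)

Require Import Defs.
From HB Require Import structures.
From mathcomp Require Import all_boot all_order all_algebra.
From mathcomp Require Import all_classical all_reals all_analysis.
From mathcomp Require Import complex.
From mathcomp Require Import ring lra zify.
From mathcomp Require finmap summability.
Set Implicit Arguments.
Unset Strict Implicit.
Unset Printing Implicit Defensive.
Import Order.TTheory GRing.Theory Num.Theory.
Import numFieldNormedType.Exports.
Local Open Scope classical_set_scope.
Local Open Scope ring_scope.
Local Open Scope complex_scope.

(** * Complex modulus and exponential *)

(** Fourier coefficients have to be compared after translation by [Lam l], which for nonzero [l] is
    not a real combination of the periods. A mean over a real torus therefore helps only if complex
    translations leave it fixed; this is why characters are extended holomorphically, with inverses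
    instead of complex conjugates. Finite means suit this well: a grid mean is invariant under the
    step of its grid, hence almost constant, and Goursat's argument works on dyadic Riemann sums as
    they stand. Uniqueness requires no convergent Fourier series: powers of a product of squared
    cosines act as an approximate identity. All estimates on theta series reduce to the coercivity
    of Re S on V_1, which comes from the positivity of H on V_2 through C^g = V_2 + i V_2. In the
    rank criterion, necessity is a duality argument (a relation between columns is a functional that
    vanishes on all products), and sufficiency is an explicit construction with one linear system
    per class of K_1. *)

Section ComplexModulus.
Variable R : realType.
Local Notation C := R[i].
Implicit Types (z w : C) (x y : R).

(* The norm of [R[i]] takes its values in [R[i]]. *)
Definition cabs z : R := complex.Re `|z|.

Lemma cabsE z : (cabs z)%:C = `|z|.
Proof. by rewrite /cabs RRe_real // normr_real. Qed.

Lemma cabs_ge0 z : 0 <= cabs z.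
Proof. by rewrite -lecR cabsE normr_ge0. Qed.

Lemma cabs_eq0 z : (cabs z == 0) = (z == 0).
Proof. by rewrite -(inj_eq (@complexI R)) cabsE normr_eq0. Qed.

Lemma cabs0 : cabs 0 = 0. Proof. by apply/eqP; rewrite cabs_eq0. Qed.

Lemma cabsN z : cabs (- z) = cabs z.
Proof. by rewrite /cabs normrN. Qed.

Lemma cabsB z w : cabs (z - w) = cabs (w - z).
Proof. by rewrite /cabs distrC. Qed.

Lemma cabsM z w : cabs (z * w) = cabs z * cabs w.
Proof. by apply: (@complexI R); rewrite rmorphM /= !cabsE normrM. Qed.

Lemma cabs1 : cabs 1 = 1.
Proof. by apply: (@complexI R); rewrite cabsE normr1. Qed.

Lemma cabsX z n : cabs (z ^+ n) = cabs z ^+ n.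
Proof. by elim: n => [|n IH]; rewrite ?expr0 ?cabs1// !exprS cabsM IH. Qed.

Lemma cabsV z : cabs z^-1 = (cabs z)^-1.
Proof. by apply: (@complexI R); rewrite fmorphV /= !cabsE normfV. Qed.

Lemma cabs_real x : cabs x%:C = `|x|.
Proof. by rewrite /cabs normc_def /= expr0n /= addr0 sqrtr_sqr. Qed.

Lemma cabs_nat n : cabs n%:R = n%:R.
Proof. by rewrite -(rmorph_nat (real_complex R)) cabs_real normr_nat. Qed.

Lemma ler_cabsD z w : cabs (z + w) <= cabs z + cabs w.
Proof. by rewrite -lecR rmorphD /= !cabsE ler_normD. Qed.

Lemma ler_cabsB z w : cabs (z - w) <= cabs z + cabs w.
Proof. by rewrite -(cabsN w); exact: ler_cabsD. Qed.

Lemma ler_cabs_trans z w t : cabs (z - t) <= cabs (z - w) + cabs (w - t).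
Proof. have -> : z - t = (z - w) + (w - t) by ring.
exact: ler_cabsD.
Qed.

Lemma ler_cabs_sum (I : Type) (r : seq I) (P : pred I) (F : I -> C) :
  cabs (\sum_(i <- r | P i) F i) <= \sum_(i <- r | P i) cabs (F i).
Proof.
elim/big_ind2: _ => [|z a w b za wb|//]; first by rewrite cabs0.
by apply: le_trans (ler_cabsD _ _) _; exact: lerD.
Qed.

Lemma ler_Re_cabs z : `|complex.Re z| <= cabs z.
Proof. by rewrite -lecR cabsE; exact: normc_ge_Re. Qed.

Lemma ler_Im_cabs z : `|complex.Im z| <= cabs z.
Proof.
have := ler_Re_cabs (z * 'i); rewrite ReiNIm normrN cabsM.
by rewrite {2}/cabs normc_def /= expr0n expr1n /= add0r sqrtr1 mulr1.
Qed.

Lemma cabs_i : cabs 'i = 1.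
Proof. by rewrite /cabs normc_def /= expr0n expr1n /= add0r sqrtr1. Qed.

Lemma cabs_le_ReIm z : cabs z <= `|complex.Re z| + `|complex.Im z|.
Proof.
rewrite {1}(complexE z); apply: le_trans (ler_cabsD _ _) _.
by rewrite cabsM cabs_i mul1r !cabs_real.
Qed.

Lemma le_cabs z e : (cabs z <= e) = (`|z| <= e%:C).
Proof. by rewrite -lecR cabsE. Qed.

Lemma lt_cabs z e : (cabs z < e) = (`|z| < e%:C).
Proof. by rewrite -ltcR cabsE. Qed.

End ComplexModulus.

Section ComplexExp.
Variable R : realType.
Local Notation C := R[i].
Implicit Types (z w : C) (x y : R).

Lemma cexpD z w : cexp (z + w) = cexp z * cexp w.
Proof.
case: z w => [a b] [c d]; rewrite /cexp /= expRD cosD sinD.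
by apply/eqP; rewrite eq_complex /=; apply/andP; split; apply/eqP; ring.
Qed.

Lemma cexp0 : cexp (0 : C) = 1.
Proof. by rewrite /cexp /= expR0 cos0 sin0 mulr1 mulr0. Qed.

Lemma cexpNK z : cexp (- z) * cexp z = 1.
Proof. by rewrite -cexpD addNr cexp0. Qed.

Lemma cexp_neq0 z : cexp z != 0.
Proof.
by apply/eqP => z0; have := cexpNK z; rewrite z0 mulr0 => /esym/eqP; rewrite oner_eq0.
Qed.

Lemma cexpN z : cexp (- z) = (cexp z)^-1.
Proof. by rewrite -[RHS]mul1r -(cexpNK z) mulfK // cexp_neq0. Qed.

Lemma cexpMn z n : cexp (z *+ n) = cexp z ^+ n.
Proof. by elim: n => [|n IH]; rewrite ?mulr0n ?cexp0 // mulrS exprS cexpD IH. Qed.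

Lemma cabs_cexp z : cabs (cexp z) = expR (complex.Re z).
Proof.
rewrite /cabs normc_def /cexp /= !exprMn -mulrDr cos2Dsin2 mulr1 sqrtr_sqr.
by rewrite ger0_norm // expR_ge0.
Qed.

Lemma cexp_2piMint (n : int) : cexp (2 * piC R * 'i * n%:~R) = 1.
Proof.
have H1 : cexp (2 * piC R * 'i) = 1.
  rewrite /cexp /piC.
  have -> : 2 * (pi : R)%:C * 'i = Complex 0 (pi *+ 2).
    by rewrite -(rmorph_nat (real_complex R)); simpc; rewrite mulr_natl.
  by rewrite /= expR0 cos2pi sin2pi mul1r mulr0.
case: n => n; first by rewrite -pmulrn mulr_natr cexpMn H1 expr1n.
by rewrite NegzE rmorphN /= mulrN cexpN -pmulrn mulr_natr cexpMn H1 expr1n invr1.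
Qed.

Lemma sin_le_abs x : `|sin x| <= `|x|.
Proof.
wlog x0 : x / 0 < x.
  move=> H; case: (ltgtP x 0) => [x0|x0|->]; last by rewrite sin0.
  - by rewrite -normrN -sinN -(normrN x); apply: H; rewrite oppr_gt0.
  - exact: H.
have h1 (t : R) : t \in `]0, x[ -> is_derive t 1 sin (cos t) by move=> _; exact: is_derive_sin.
have h2 : {within `[0, x], continuous (@sin R)}.
  by apply: continuous_subspaceT => t; exact: continuous_sin.
have [c _] := MVT x0 h1 h2.
rewrite sin0 !subr0 => ->.
by rewrite normrM ler_piMl // ?normr_ge0 // cos_max.
Qed.

Lemma cos1_le x : `|cos x - 1| <= 2 * `|sin (x / 2)| ^+ 2.
Proof.
have -> : cos x - 1 = - (2 * sin (x / 2) ^+ 2).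
  have {1}-> : x = x / 2 + x / 2 by lra.
  by rewrite cosD -!expr2 -[cos _ ^+ 2](addrK (sin (x / 2) ^+ 2)) cos2Dsin2; ring.
by rewrite normrN normrM normrX ger0_norm.
Qed.

Lemma cos1_le_sq x : `|cos x - 1| <= x ^+ 2.
Proof.
apply: le_trans (cos1_le _) _; have := sin_le_abs (x / 2).
rewrite normrM [`|2^-1|]ger0_norm // -(real_normK (num_real x)) => h.
have := normr_ge0 (sin (x / 2)); have := normr_ge0 x; nra.
Qed.

Lemma cos1_le_abs x : `|cos x - 1| <= `|x|.
Proof.
apply: le_trans (cos1_le _) _; have := sin_le_abs (x / 2).
rewrite normrM [`|2^-1|]ger0_norm // => h.
have := normr_ge0 (sin (x / 2)); have := sin_max (x / 2); have := normr_ge0 x; nra.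
Qed.

Lemma sin1_le_sq x : `|sin x - x| <= x ^+ 2.
Proof.
wlog x0 : x / 0 < x.
  move=> H; case: (ltgtP x 0) => [x0|x0|->]; last by rewrite sin0 subrr normr0 expr0n.
  - have -> : sin x - x = - (sin (- x) - - x) by rewrite sinN; ring.
    by rewrite normrN -sqrrN; apply: H; rewrite oppr_gt0.
  - exact: H.
have h1 (t : R) : t \in `]0, x[ -> is_derive t 1 (@sin R \- id) (cos t - 1) by move=> _; exact: is_deriveB.
have h2 : {within `[0, x], continuous (@sin R \- id)}.
  by apply: continuous_subspaceT => t; apply: continuousB; [exact: continuous_sin|exact: cvg_id].
have [c /[!in_itv]/= /andP[c0 cx]] := MVT x0 h1 h2.
rewrite /= sin0 !subr0 => ->.
rewrite normrM (gtr0_norm x0) expr2 ler_pM2r //.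
by apply: le_trans (cos1_le_abs _) _; rewrite gtr0_norm // ltW.
Qed.

(** Only 1 + x <= e^x is used, at x and at -x; the second-order bound that follows rests on the same
    inequality. *)
Lemma expR1_le x : `|expR x - 1| <= `|x| * expR `|x|.
Proof.
have h1 := expR_ge1Dx x; have := expR_ge1Dx (- x); rewrite expRN => h2.
have e0 := expR_gt0 x.
have h3 : 1 <= expR `|x| by rewrite -expR0 ler_expR.
have h4 : expR x <= expR `|x| by rewrite ler_expR ler_norm.
have h5 : expR x - 1 <= x * expR x.
  have := ler_wpM2r (ltW e0) h2; rewrite mulVf ?gt_eqF //; lra.
have [x0|x0] := lerP 0 x.
- rewrite ger0_norm; last by lra.
  by rewrite ger0_norm.
- have h6 : x * expR x <= 0 by nra.
  rewrite [in leLHS]ler0_norm; last lra.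
  rewrite (ltr0_norm x0) in h3 *; nra.
Qed.

Lemma expR2_le x : `|expR x - 1 - x| <= x ^+ 2 * expR `|x|.
Proof.
have h1 := expR_ge1Dx x; have := expR_ge1Dx (- x); rewrite expRN => h2.
have e0 := expR_gt0 x.
have h5 : expR x - 1 <= x * expR x.
  have := ler_wpM2r (ltW e0) h2; rewrite mulVf ?gt_eqF //; lra.
rewrite ger0_norm; last by lra.
have := expR1_le x => h; have := ler_norm (expR x - 1); have := normr_ge0 (expR x - 1).
have : x * (expR x - 1) <= `|x| * `|expR x - 1| by rewrite -normrM ler_norm.
rewrite -(real_normK (num_real x)); have := normr_ge0 x; nra.
Qed.

(** Real and imaginary part each split into two errors, and each of the four is at most |z|^2 e^|z|;
    hence the constant 4. Every differentiability proof for exponentials below rests on this Taylor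
    bound. *)
Lemma cexp2_le z : cabs (cexp z - 1 - z) <= 4 * cabs z ^+ 2 * expR (cabs z).
Proof.
case E : z => [x y]; rewrite -E.
have hx : `|x| <= cabs z by have := ler_Re_cabs z; rewrite E.
have hy : `|y| <= cabs z by have := ler_Im_cabs z; rewrite E.
have ex : expR `|x| <= expR (cabs z) by rewrite ler_expR.
have ex1 : expR x <= expR `|x| by rewrite ler_expR ler_norm.
have e1 : 1 <= expR `|x| by rewrite -expR0 ler_expR.
have e0 := expR_gt0 x.
apply: le_trans (cabs_le_ReIm _) _.
have -> : cexp z - 1 - z = (expR x * cos y - 1 - x) +i* (expR x * sin y - y).
  by apply/eqP; rewrite E eq_complex /cexp /= ?subr0 ?oppr0 ?addr0 !eqxx.
rewrite /=.
have -> : expR x * cos y - 1 - x = (expR x - 1 - x) + expR x * (cos y - 1) by ring.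
have -> : expR x * sin y - y = (expR x - 1) * sin y + (sin y - y) by ring.
apply: le_trans (lerD (ler_normD _ _) (ler_normD _ _)) _.
rewrite !normrM (gtr0_norm e0).
set c := cabs z in hx hy ex *; set E1 := expR c in ex *.
have x2 : x ^+ 2 <= c ^+ 2.
  by rewrite -(real_normK (num_real x)) lerXn2r ?nnegrE // cabs_ge0.
have y2 : y ^+ 2 <= c ^+ 2.
  by rewrite -(real_normK (num_real y)) lerXn2r ?nnegrE // cabs_ge0.
have c0 : 0 <= c ^+ 2 by exact: sqr_ge0.
have t1 : `|expR x - 1 - x| <= c ^+ 2 * E1.
  by apply: le_trans (expR2_le _) _; apply: ler_pM => //; rewrite ?sqr_ge0 ?expR_ge0.
have t2 : expR x * `|cos y - 1| <= E1 * c ^+ 2.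
  apply: ler_pM; rewrite ?expR_ge0 ?normr_ge0 //; first exact: le_trans ex1 ex.
  exact: le_trans (cos1_le_sq _) y2.
have t3 : `|expR x - 1| * `|sin y| <= (c * E1) * c.
  apply: ler_pM; rewrite ?normr_ge0 //; last exact: le_trans (sin_le_abs _) hy.
  by apply: le_trans (expR1_le _) _; apply: ler_pM => //; rewrite expR_ge0.
have t4 : `|sin y - y| <= c ^+ 2 * E1.
  apply: le_trans (sin1_le_sq _) _; apply: le_trans y2 _.
  by rewrite ler_peMr // (le_trans e1).
have t5 : (c * E1) * c = c ^+ 2 * E1 by ring.
rewrite t5 in t3; have t6 : E1 * c ^+ 2 = c ^+ 2 * E1 by ring.
rewrite t6 in t2; lra.
Qed.

End ComplexExp.

(** * Holomorphic functions *)

Section Holomorphic.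
Variables (K : numFieldType) (g : nat).
Local Notation V := 'rV[K]_g.
Implicit Types (f : V -> K) (x y v : V).

(** This is the form of differentiability that Goursat's argument consumes: a complex derivative
    along one line, with an explicit radius. *)
Lemma holomorphic_line f (hf : holomorphic f) x v : exists D : K,
  forall e, 0 < e -> exists2 r, 0 < r &
    forall h : K, `|h| < r -> `|f (x + h *: v) - f x - D * h| <= e * `|h|.
Proof.
have /diff_locallyP [_ dE] := hf x.
exists ('d (f : V -> K^o) x v) => e e0.
pose k := e / (`|v| + 1).
have v1 : 0 < `|v| + 1 by rewrite ltr_wpDl.
have k0 : 0 < k by rewrite divr_gt0.
move: dE => /eqaddoP /(_ _ k0) /nbhs_ballP [r /= r0 hr].
exists (r / (`|v| + 1)); first by rewrite divr_gt0.
move=> h hlt.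
have := hr (h *: v).
rewrite -ball_normE /ball_ /= sub0r normrN normrZ.
have hv : `|h| * `|v| < r.
  rewrite (le_lt_trans _ (_ : `|h| * (`|v| + 1) < r)) //.
    by rewrite ler_wpM2l // lerDl.
  by rewrite -ltr_pdivlMr.
move=> /(_ hv).
rewrite !fctE [h *: v + x]addrC linearZ /= [X in f x + X]mulrC opprD addrA => H.
apply: le_trans H _.
rewrite /k -mulrA ler_pM2l // mulrCA ler_piMr //.
by rewrite mulrC ler_pdivrMr // mul1r lerDl.
Qed.

Lemma holomorphic_continuous f (hf : holomorphic f) x e : 0 < e ->
  exists2 r, 0 < r & forall y, `|y| < r -> `|f (x + y) - f x| <= e.
Proof.
move=> e0.
have /cvgrPdist_le /(_ _ e0) := differentiable_continuous (hf x).
move=> /nbhs_ballP [r /= r0 hr]; exists r => // y yr.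
rewrite distrC; apply: hr; rewrite -ball_normE /ball_ /=.
by rewrite opprD addrA subrr sub0r normrN.
Qed.

Lemma holomorphicM f1 f2 : holomorphic f1 -> holomorphic f2 ->
  holomorphic (fun v => f1 v * f2 v).
Proof. move=> h1 h2 v. exact: (differentiableM (h1 v) (h2 v)). Qed.

Lemma holomorphic_sum (I : Type) (r : seq I) (F : I -> V -> K) :
  (forall i, holomorphic (F i)) -> holomorphic (fun v => \sum_(i <- r) F i v).
Proof.
move=> h v; elim: r => [|i r IH].
  rewrite (_ : (fun _ => _) = cst 0); first exact: differentiable_cst.
  by apply/funext => u; rewrite big_nil.
rewrite (_ : (fun _ => _) = (F i : V -> K^o) + (fun u => \sum_(i <- r) F i u)).
  by apply: differentiableD => //; exact: h.
by apply/funext => u; rewrite big_cons.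
Qed.

Lemma holomorphicZ c f : holomorphic f -> holomorphic (fun v => c * f v).
Proof. by move=> h; apply: holomorphicM => // v; exact: differentiable_cst. Qed.

Definition lin_form (a : 'I_g -> K) (y : V) : K := \sum_i a i * y 0 i.

Lemma lin_form_linear a : linear (lin_form a : V -> K^o).
Proof.
move=> c u v; rewrite /lin_form scaler_sumr -big_split; apply: eq_bigr => i _ /=.
by rewrite !mxE mulrDr; congr (_ + _); rewrite mulrCA.
Qed.

HB.instance Definition _ a := GRing.isLinear.Build K V K^o _ (lin_form a : V -> K^o)
  (lin_form_linear a).

Lemma lin_form_continuous a : continuous (lin_form a : V -> K^o).
Proof.
move=> v; apply: (@differentiable_continuous K V K^o v (lin_form a)).
apply: (@holomorphic_sum _ _ (fun i (y : V) => a i * y 0 i)) => i.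
by apply: holomorphicZ => u; exact: differentiable_coord.
Qed.

(** A remainder of order two identifies the differential, so differentiability of theta series and
    Gaussian factors reduces to one norm estimate. *)
Lemma differentiable_quadratic (f : V -> K) x a (M : K) :
  (forall y, `|y| < 1 -> `|f (x + y) - f x - lin_form a y| <= M * `|y| ^+ 2) ->
  differentiable (f : V -> K^o) x.
Proof.
move=> H.
have dE : (f : V -> K^o) \o shift x = cst (f x) + (lin_form a : V -> K^o) +o_ (0 : V) id.
  apply/eqaddoP => e e0.
  have M1 : 0 < `|M| + 1 by rewrite ltr_wpDl.
  have M2 : 0 < `|M| + 1 + e by rewrite addr_gt0.
  apply/nbhs_ballP; exists (e / (`|M| + 1 + e)) => /=; first by rewrite divr_gt0.
  move=> y; rewrite -ball_normE /ball_ /= sub0r normrN.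
  rewrite [X in `|X| <= _](_ : _ = f (x + y) - f x - lin_form a y); last first.
    by rewrite -[LHS]/(f (y + x) - (f x + lin_form a y)) opprD addrA (addrC y).
  move=> yr; have y1 : `|y| < 1.
    by apply: lt_le_trans yr _; rewrite ler_pdivrMr // mul1r lerDr ltW.
  apply: le_trans (H _ y1) _.
  rewrite expr2 mulrA ler_wpM2r //.
  have ye : (`|M| + 1) * `|y| <= e.
    rewrite ltr_pdivlMr // mulrC in yr; apply: le_trans (ltW yr).
    by rewrite ler_wpM2r // lerDl ltW.
  apply: le_trans ye.
  have [->|y0] := eqVneq `|y| 0; first by rewrite !mulr0.
  have yp : 0 < `|y| by rewrite lt_def y0 /=.
  (* The bound at a nonzero [y] forces [M] to be nonnegative. *)
  have := H _ y1; have := normr_ge0 (f (x + y) - f x - lin_form a y) => /le_trans h1 /h1.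
  rewrite pmulr_lge0 ?exprn_gt0 // => M0.
  by rewrite ger0_norm // ler_wpM2r // lerDl.
apply/diff_locallyP.
rewrite (diff_unique (@lin_form_continuous a) dE); split=> //.
exact: lin_form_continuous.
Qed.

End Holomorphic.

(** * Limits and unconditional sums *)

Section Limits.
Variable R : realType.
Local Notation C := R[i].
Implicit Types (u w : nat -> C) (l : C).

(** The real-valued modulus keeps all estimates inside the ordered field [R]. *)
Definition ccvg u l := forall e : R, 0 < e ->
  exists N, forall n, (N <= n)%N -> cabs (u n - l) <= e.

Lemma eq_cabs0 (z : C) : (forall e : R, 0 < e -> cabs z <= e) -> z = 0.
Proof.
move=> h; apply/eqP; rewrite -cabs_eq0 eq_le cabs_ge0 andbT.
by apply/ler_addgt0Pr => e /h; rewrite add0r.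
Qed.

Lemma ccvg_unique u l l' : ccvg u l -> ccvg u l' -> l = l'.
Proof.
move=> h h'; apply/eqP; rewrite -subr_eq0; apply/eqP/eq_cabs0 => e e0.
have [N hN] := h _ (divr_gt0 e0 (ltr0n _ 2)).
have [N' hN'] := h' _ (divr_gt0 e0 (ltr0n _ 2)).
have := hN _ (leq_maxl N N'); have := hN' _ (leq_maxr N N').
have := ler_cabs_trans l (u (maxn N N')) l'; rewrite (cabsB l (u _)).
lra.
Qed.

Lemma ccvg_ext u w l : u =1 w -> ccvg u l -> ccvg w l.
Proof. by move=> /funext ->. Qed.

Lemma ccvg_cst l : ccvg (fun=> l) l.
Proof. by move=> e e0; exists 0%N => n _; rewrite subrr cabs0 ltW. Qed.

Lemma ccvgZ c u l : ccvg u l -> ccvg (fun n => c * u n) (c * l).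
Proof.
move=> h e e0; have c0 : 0 < cabs c + 1 by rewrite ltr_wpDl // cabs_ge0.
have [N hN] := h _ (divr_gt0 e0 c0); exists N => n /hN.
rewrite -mulrBr cabsM ler_pdivlMr // mulrC; apply: le_trans.
by rewrite ler_wpM2r ?cabs_ge0 // lerDl.
Qed.

Lemma ccvgD u w l l' : ccvg u l -> ccvg w l' -> ccvg (fun n => u n + w n) (l + l').
Proof.
move=> h h' e e0.
have [N hN] := h _ (divr_gt0 e0 (ltr0n _ 2)).
have [N' hN'] := h' _ (divr_gt0 e0 (ltr0n _ 2)).
exists (maxn N N') => n; rewrite geq_max => /andP[/hN h1 /hN' h2].
have -> : u n + w n - (l + l') = (u n - l) + (w n - l') by ring.
apply: le_trans (ler_cabsD _ _) _; lra.
Qed.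

Lemma ccvg_sum (I : Type) (r : seq I) (F : I -> nat -> C) (L : I -> C) :
  (forall i, ccvg (F i) (L i)) ->
  ccvg (fun n => \sum_(i <- r) F i n) (\sum_(i <- r) L i).
Proof.
move=> h; elim: r => [|i r IH].
  by rewrite big_nil; apply: ccvg_ext (@ccvg_cst 0) => n; rewrite big_nil.
rewrite big_cons; apply: ccvg_ext (ccvgD (h i) IH) => n; by rewrite big_cons.
Qed.

(** The limit is the lower limit, obtained as the supremum of the numbers that are eventually below
    the sequence. *)
Lemma real_cauchy_cvg (v : nat -> R) :
  (forall e : R, 0 < e -> exists N, forall n, (N <= n)%N -> `|v n - v N| <= e) ->
  exists l : R, forall e, 0 < e -> exists N, forall n, (N <= n)%N -> `|v n - l| <= e.
Proof.
move=> h; pose A : set R := [set x | exists N, forall n, (N <= n)%N -> x <= v n].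
have ub e : 0 < e -> exists N, [/\ A (v N - e), ubound A (v N + e) &
    forall n, (N <= n)%N -> `|v n - v N| <= e].
  move=> e0; have [N hN] := h _ e0; exists N; split=> //.
  - by exists N => n /hN; rewrite ler_norml => /andP[]; lra.
  - move=> x [M hM]; have := hM _ (leq_maxl M N).
    by have := hN _ (leq_maxr M N); rewrite ler_norml => /andP[]; lra.
have sA : has_sup A.
  have [N [h1 h2 _]] := ub 1 ltr01.
  by split; [exists (v N - 1) | exists (v N + 1)].
exists (sup A) => e e0.
have e2 : 0 < e / 2 by lra.
have [N [h1 h2 h3]] := ub _ e2; exists N => n /h3.
have := ub_le_sup (proj2 sA) h1.
have := ge_sup (proj1 sA) h2.
rewrite !ler_norml => ? ? /andP[? ?]; apply/andP; split; lra.
Qed.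

Lemma ccvg_cauchy u :
  (forall e : R, 0 < e -> exists N, forall n, (N <= n)%N -> cabs (u n - u N) <= e) ->
  exists l, ccvg u l.
Proof.
move=> h.
have [x hx] : exists l : R, forall e, 0 < e ->
    exists N, forall n, (N <= n)%N -> `|complex.Re (u n) - l| <= e.
  apply: real_cauchy_cvg => e /h [N hN]; exists N => n /hN; apply: le_trans.
  by rewrite -[_ - _](raddfB (@complex.Re R)) ler_Re_cabs.
have [y hy] : exists l : R, forall e, 0 < e ->
    exists N, forall n, (N <= n)%N -> `|complex.Im (u n) - l| <= e.
  apply: real_cauchy_cvg => e /h [N hN]; exists N => n /hN; apply: le_trans.
  by rewrite -[_ - _](raddfB (@complex.Im R)) ler_Im_cabs.
exists (x +i* y) => e e0; have e2 : 0 < e / 2 by lra.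
have [N hN] := hx _ e2; have [N' hN'] := hy _ e2.
exists (maxn N N') => n; rewrite geq_max => /andP[/hN h1 /hN' h2].
apply: le_trans (cabs_le_ReIm _) _.
by case: (u n) h1 h2 => a b /=; lra.
Qed.

End Limits.

(** * Unconditional sums and dominated convergence *)

Section UnconditionalSums.
Variables (R : realType) (I : choiceType).
Local Notation C := R[i].
Implicit Types (a : I -> C) (b : I -> R) (s : seq I) (S : C).

(** Finite subsets of [I] are represented by duplicate-free lists. *)
Definition hassum a S := forall e : R, 0 < e ->
  exists s0, forall s, uniq s -> {subset s0 <= s} -> cabs (\sum_(i <- s) a i - S) <= e.

(** For nonnegative [b] this is summability together with a bound on the sum. *)
Definition sum_bounded b (T : R) := forall s, uniq s -> \sum_(i <- s) b i <= T.

Lemma hassum_unique a S S' : hassum a S -> hassum a S' -> S = S'.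
Proof.
move=> h h'; apply/eqP; rewrite -subr_eq0; apply/eqP/eq_cabs0 => e e0.
have [s hs] := h _ (divr_gt0 e0 (ltr0n _ 2)).
have [s' hs'] := h' _ (divr_gt0 e0 (ltr0n _ 2)).
pose t := undup (s ++ s').
have h1 : {subset s <= t} by move=> i; rewrite mem_undup mem_cat => ->.
have h2 : {subset s' <= t} by move=> i; rewrite mem_undup mem_cat => ->; rewrite orbT.
have := hs _ (undup_uniq _) h1; have := hs' _ (undup_uniq _) h2.
have := ler_cabs_trans S (\sum_(i <- t) a i) S'; rewrite (cabsB S (\sum_(_ <- _) _)).
lra.
Qed.

Lemma eq_hassum a a' S : a =1 a' -> hassum a S -> hassum a' S.
Proof. by move=> /funext ->. Qed.

Lemma hassumD a a' S S' : hassum a S -> hassum a' S' ->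
  hassum (fun i => a i + a' i) (S + S').
Proof.
move=> h h' e e0.
have [s hs] := h _ (divr_gt0 e0 (ltr0n _ 2)).
have [s' hs'] := h' _ (divr_gt0 e0 (ltr0n _ 2)).
exists (s ++ s') => t tu st.
have h1 : {subset s <= t} by move=> i si; apply: st; rewrite mem_cat si.
have h2 : {subset s' <= t} by move=> i si; apply: st; rewrite mem_cat si orbT.
have := hs _ tu h1; have := hs' _ tu h2; rewrite big_split /=.
set x := \sum_(_ <- _) _; set y := \sum_(_ <- _) _.
have -> : y + x - (S + S') = (y - S) + (x - S') by ring.
have := ler_cabsD (y - S) (x - S'); lra.
Qed.

Lemma hassumZ c a S : hassum a S -> hassum (fun i => c * a i) (c * S).
Proof.
move=> h e e0; have c0 : 0 < cabs c + 1 by rewrite ltr_wpDl // cabs_ge0.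
have [s hs] := h _ (divr_gt0 e0 c0); exists s => t tu /(hs _ tu).
rewrite -mulr_sumr -mulrBr cabsM ler_pdivlMr // mulrC; apply: le_trans.
by rewrite ler_wpM2r ?cabs_ge0 // lerDl.
Qed.

Lemma hassum0 : hassum (fun=> 0) 0.
Proof. by move=> e e0; exists [::] => s _ _; rewrite big1 // subrr cabs0 ltW. Qed.

Lemma hassum_sum (J : Type) (r : seq J) (F : J -> I -> C) (L : J -> C) :
  (forall j, hassum (F j) (L j)) ->
  hassum (fun i => \sum_(j <- r) F j i) (\sum_(j <- r) L j).
Proof.
move=> h; elim: r => [|j r IH].
  by rewrite big_nil; apply: eq_hassum hassum0 => i; rewrite big_nil.
by rewrite big_cons; apply: eq_hassum (hassumD (h j) IH) => i; rewrite big_cons.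
Qed.

Lemma hassum_single a i0 : (forall i, i != i0 -> a i = 0) -> hassum a (a i0).
Proof.
move=> h e e0; exists [:: i0] => s su /(_ i0 (mem_head _ _)) si.
by rewrite (bigD1_seq i0) //= big1 ?addr0 ?subrr ?cabs0 ?ltW.
Qed.

Lemma hassum_reindex (f f' : I -> I) a S : cancel f f' -> cancel f' f ->
  hassum a S -> hassum (a \o f) S.
Proof.
move=> fK f'K h e /h [s hs]; exists (map f' s) => t tu st.
rewrite (_ : \sum_(i <- t) _ = \sum_(i <- map f t) a i); last by rewrite big_map.
apply: hs; first by rewrite map_inj_uniq //; exact: can_inj fK.
move=> i si; apply/mapP; exists (f' i); last by rewrite f'K.
by apply: st; exact: map_f.
Qed.

Lemma hassum_bound a S T : hassum a S ->
  sum_bounded (fun i => cabs (a i)) T -> cabs S <= T.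
Proof.
move=> h hT; apply/ler_addgt0Pr => e /h [s hs].
have := hs (undup s) (undup_uniq s) (fun i => etrans (mem_undup s i)).
have := hT (undup s) (undup_uniq s).
have := ler_cabs_sum (undup s) xpredT a.
have := ler_cabs_trans S (\sum_(i <- undup s) a i) 0.
rewrite !subr0 (cabsB S); lra.
Qed.

Lemma sum_bounded_le b b' T : (forall i, b i <= b' i) -> sum_bounded b' T ->
  sum_bounded b T.
Proof. by move=> h h' s /h'; apply: le_trans; exact: ler_sum. Qed.

Lemma sum_boundedZ b T c : 0 <= c -> sum_bounded b T ->
  sum_bounded (fun i => c * b i) (c * T).
Proof. by move=> c0 h s /h; rewrite -mulr_sumr; exact: ler_wpM2l. Qed.

Lemma sum_bounded_tail b T : (forall i, 0 <= b i) -> sum_bounded b T ->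
  forall e, 0 < e -> exists s0, uniq s0 /\ forall s, uniq s ->
    \sum_(i <- s) b i <= \sum_(i <- s0) b i + e.
Proof.
move=> b0 hT e e0.
pose A : set R := [set x | exists2 s, uniq s & x = \sum_(i <- s) b i].
have sA : has_sup A.
  split; first by exists 0, [::]; rewrite ?big_nil.
  by exists T => x [s /hT h ->].
have [x [s su ->] hs] := sup_adherent e0 sA.
exists s; split=> // t tu.
have : \sum_(i <- t) b i <= sup A by apply: (ub_le_sup (proj2 sA)); exists t.
lra.
Qed.

Lemma sum_bounded_tail_disjoint b T : (forall i, 0 <= b i) -> sum_bounded b T ->
  forall e, 0 < e -> exists s0, uniq s0 /\ forall s, uniq s ->
    \sum_(i <- s | i \notin s0) b i <= e.
Proof.
move=> b0 hT e e0; have [s0 [su hs]] := sum_bounded_tail b0 hT e0.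
exists s0; split=> // s ss.
have := hs (s0 ++ [seq i <- s | i \notin s0]).
rewrite big_cat /= big_filter lerD2l; apply.
rewrite cat_uniq su filter_uniq // andbT /=.
by apply/hasPn => i; rewrite mem_filter => /andP[].
Qed.

Lemma hassum_ge0 b T : (forall i, 0 <= b i) -> sum_bounded b T ->
  exists S : R, hassum (fun i => (b i)%:C) S%:C.
Proof.
move=> b0 hT.
pose A : set R := [set x | exists2 s, uniq s & x = \sum_(i <- s) b i].
have sA : has_sup A.
  split; first by exists 0, [::]; rewrite ?big_nil.
  by exists T => x [s /hT h ->].
exists (sup A) => e e0; have [x [s su ->] hs] := sup_adherent e0 sA.
exists s => t tu st.
have h1 : \sum_(i <- t) b i <= sup A by apply: (ub_le_sup (proj2 sA)); exists t.
have h2 : \sum_(i <- s) b i <= \sum_(i <- t) b i.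
  rewrite [leRHS](bigID (fun i => i \in s)) /=.
  rewrite -[X in X + _]big_filter [X in X + _](perm_big s) /=; last first.
    apply: uniq_perm; rewrite ?filter_uniq // => i.
    by rewrite mem_filter; apply: andb_idr => /st.
  by rewrite lerDl sumr_ge0.
rewrite -rmorph_sum -rmorphB cabs_real ler_norml.
by apply/andP; split; lra.
Qed.

(** Real and imaginary parts are differences of nonnegative families dominated by [b], and those
    have sums by completeness of [R]. *)
Lemma hassum_exists a b T : (forall i, cabs (a i) <= b i) -> sum_bounded b T ->
  exists S, hassum a S.
Proof.
move=> ab hT.
have aux (f : I -> R) : (forall i, `|f i| <= b i) -> exists S, hassum (fun i => (f i)%:C) S.
  move=> hf.
  have [||S1 h1] := @hassum_ge0 (fun i => (`|f i| + f i) / 2) T.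
  - by move=> i; have := ler_norm (- f i); rewrite normrN; lra.
  - by apply: sum_bounded_le hT => i; have := hf i; have := ler_norm (f i); lra.
  have [||S2 h2] := @hassum_ge0 (fun i => (`|f i| - f i) / 2) T.
  - by move=> i; have := ler_norm (f i); lra.
  - by apply: sum_bounded_le hT => i; have := hf i; have := ler_norm (- f i); rewrite normrN; lra.
  exists (S1%:C + (-1) * S2%:C); apply: eq_hassum (hassumD h1 (hassumZ (-1) h2)) => i.
  rewrite mulN1r -rmorphB; congr (_%:C); lra.
have [|S1 h1] := aux (fun i => complex.Re (a i)).
  by move=> i; exact: le_trans (ler_Re_cabs _) _.
have [|S2 h2] := aux (fun i => complex.Im (a i)).
  by move=> i; exact: le_trans (ler_Im_cabs _) _.
exists (S1 + 'i * S2); apply: eq_hassum (hassumD h1 (hassumZ 'i h2)) => i.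
by rewrite -complexE.
Qed.

(** Dominated convergence: outside a finite set the dominating family is small for all [n] at once,
    and on the finite set termwise convergence suffices. *)
Lemma tannery (a : nat -> I -> C) (a0 : I -> C) b T (S : nat -> C) (S0 : C) :
  (forall n i, cabs (a n i) <= b i) -> sum_bounded b T ->
  (forall i, ccvg (a ^~ i) (a0 i)) ->
  (forall n, hassum (a n) (S n)) -> hassum a0 S0 -> ccvg S S0.
Proof.
move=> ab hT ha hS hS0 e e0.
have b0 i : 0 <= b i by apply: le_trans (ab 0%N i); exact: cabs_ge0.
have a0b i : cabs (a0 i) <= b i.
  apply/ler_addgt0Pr => d /(ha i) [N /(_ N (leqnn _))].
  have := ler_cabs_trans (a0 i) (a N i) 0; rewrite !subr0 (cabsB (a0 i)).
  have := ab N i; lra.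
(* A tail term [a n i - a0 i] is at most [2 * b i], so a tail of [b] below [e / 4] costs [e / 2]. *)
have e4 : 0 < e / 4 by lra.
have [s0 [su hs]] := sum_bounded_tail_disjoint b0 hT e4.
have h : forall s : seq I, exists N, forall n, (N <= n)%N ->
    \sum_(i <- s) cabs (a n i - a0 i) <= e / 2.
  move=> s.
  have : forall i, ccvg (fun n => (cabs (a n i - a0 i))%:C) 0.
    move=> i d /(ha i) [N hN]; exists N => n /hN.
    by rewrite subr0 cabs_real ger0_norm ?cabs_ge0.
  move=> /(ccvg_sum s); rewrite big1 //.
  have e2 : 0 < e / 2 by lra.
  move=> /(_ _ e2) [N hN]; exists N => n /hN.
  rewrite -rmorph_sum subr0 cabs_real; apply: le_trans; exact: ler_norm.
have [N hN] := h s0; exists N => n /hN {}hN.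
apply: (@hassum_bound (fun i => a n i + (-1) * a0 i)).
  by rewrite -[- S0]mulN1r; apply: hassumD => //; exact: hassumZ.
move=> s ss; rewrite (bigID (fun i => i \in s0)) /=.
have -> : e = e / 2 + e / 2 by lra.
apply: lerD.
  apply: le_trans hN; under eq_bigr do rewrite mulN1r.
  rewrite -big_filter [leRHS](bigID (fun i => i \in s)) /=.
  rewrite -[X in X + _]big_filter (perm_big [seq i <- s0 | i \in s]); last first.
    apply: uniq_perm; rewrite ?filter_uniq // => i.
    by rewrite !mem_filter andbC.
  by rewrite lerDl sumr_ge0 // => i _; exact: cabs_ge0.
apply: le_trans (_ : \sum_(i <- s | i \notin s0) 2 * b i <= _).
  apply: ler_sum => i _; rewrite mulN1r; apply: le_trans (ler_cabsB _ _) _.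
  have := ab n i; have := a0b i; lra.
rewrite -mulr_sumr; have := hs _ ss; lra.
Qed.

End UnconditionalSums.

Section Summability.
Variables (R : realType) (I : choiceType).
Local Notation C := R[i].

(** Links the sum that occurs in [theta0] to [hassum]. *)
Lemma summability_sumE (a : I -> C) S : hassum a S ->
  (summability.sum (fun i => a i : C^o) : C) = S.
Proof.
move=> h; have F := @summability.totally_filter I.
apply: (@cvg_lim C^o); first exact: norm_hausdorff.
apply/(@cvgrPdist_le C C^o) => e e0.
have eR : (complex.Re e)%:C = e by rewrite RRe_real // gtr0_real.
have e0' : 0 < complex.Re e by rewrite -ltcR eR.
have [s hs] := h _ e0'.
exists (finmap.seq_fset tt s) => // J sJ.
rewrite -eR -le_cabs cabsB /summability.partial_sum.
rewrite -(finmap.big_seq_fsetE _ J xpredT a).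
apply: hs; first exact: finmap.fset_uniq.
by move=> i si; apply: (finmap.fsubsetP sJ); rewrite (finmap.seq_fsetE tt s).
Qed.

End Summability.

Section ProductBound.
Variables (R : realType) (g : nat).
Local Notation I := {ffun 'I_g -> int}.

Lemma geometric_bound (q : R) n : 0 <= q -> q < 1 -> \sum_(k < n) q ^+ k <= (1 - q)^-1.
Proof.
move=> q0 q1; have q2 : 0 < 1 - q by lra.
rewrite -[leRHS]mul1r ler_pdivlMr // mulrC -opprB mulNr -subrX1 opprB.
by rewrite gerBl exprn_ge0.
Qed.

(** Integers are encoded by sign and absolute value, and the product over coordinates is
    distributed. Each sign gives a geometric series, hence the factor 2; counting zero twice is
    harmless. *)
Lemma sum_bounded_prod (q : R) : 0 <= q -> q < 1 ->
  sum_bounded (fun l : I => \prod_i q ^+ `|l i|%N) ((2 * (1 - q)^-1) ^+ g).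
Proof.
move=> q0 q1 s su.
pose p := (\max_(l <- s) \max_i `|l i|%N).+1.
pose dec (j : bool * 'I_p) : int := if j.1 then - (Posz j.2) else Posz j.2.
pose enc (l : I) : {ffun 'I_g -> bool * 'I_p} :=
  [ffun i => (l i < 0, inord `|l i|%N)].
have small l i : l \in s -> (`|l i| < p)%N.
  move=> ls; rewrite ltnS; apply: (@leq_trans (\max_i `|l i|%N)).
    exact: (leq_bigmax i).
  exact: (@leq_bigmax_seq _ s xpredT (fun l : I => \max_i `|l i|%N)).
have encK l i : l \in s -> dec (enc l i) = l i.
  move=> ls; rewrite /dec ffunE /= inordK ?small //; case: (l i) => k //; rewrite NegzE abszN.
have -> : \sum_(l <- s) \prod_i q ^+ `|l i|%N =
    \sum_(f <- map enc s) \prod_i q ^+ (f i).2.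
  rewrite big_map big_seq [RHS]big_seq; apply: eq_bigr => l ls.
  by apply: eq_bigr => i _; rewrite ffunE /= inordK // small.
have mu : uniq (map enc s).
  rewrite map_inj_in_uniq // => l l' ls ls' ll'; apply/ffunP => i.
  by rewrite -encK // ll' encK.
apply: le_trans (_ : \sum_(f : {ffun 'I_g -> bool * 'I_p}) \prod_i q ^+ (f i).2 <= _).
  rewrite big_uniq //= [leRHS](bigID (fun f => f \in map enc s)) /= lerDl sumr_ge0 // => f _.
  by apply: prodr_ge0 => i _; exact: exprn_ge0.
rewrite -(bigA_distr_bigA (fun i (j : bool * 'I_p) => q ^+ j.2)).
rewrite prodr_const card_ord.
apply: lerXn2r; rewrite ?nnegrE; first by apply: sumr_ge0 => j _; exact: exprn_ge0.
  by rewrite mulr_ge0 // invr_ge0; lra.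
rewrite (eq_bigr (fun j : bool * 'I_p => (fun (b : bool) (k : 'I_p) => q ^+ k) j.1 j.2)) //.
rewrite -(pair_bigA _ (fun (b : bool) (k : 'I_p) => q ^+ k)) /=.
by rewrite big_bool /=; have := geometric_bound p q0 q1; lra.
Qed.

End ProductBound.

(** * Means of periodic functions and Fourier uniqueness *)

Section Torus.
Variables (R : realType) (g : nat).
Local Notation C := R[i].
Local Notation T := 'rV[R]_g.
Implicit Types (p q : T -> C) (t s : T).

Definition small (e : R) s := forall i, `|s 0 i| < e.
Definition unit_cube : set T := [set t | forall i, 0 <= t 0 i <= 1].
Definition latvec (c : R) (n : 'I_g -> int) : T := \row_i (c * (n i)%:~R).
Definition tcont p := forall t e, 0 < e ->
  exists2 r, 0 < r & forall s, small r s -> cabs (p (t + s) - p t) <= e.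
Definition invariant_by (c : R) p := forall t i, p (t + c *: delta_mx 0 i) = p t.
Notation periodic := (invariant_by 1).

(** Compactness of the cube, phrased so that one argument serves for uniform continuity, boundedness
    and the gap of the kernel: [h] is in turn a radius, the inverse of a bound and a distance to
    1. *)
Lemma cube_cover (Q : R -> T -> Prop) :
  (forall t, unit_cube t -> exists2 r, 0 < r & forall s, small r s ->
      forall h, 0 < h -> h < r -> Q h (t + s)) ->
  exists2 h, 0 < h & forall t, unit_cube t -> Q h t.
Proof.
move=> H.
have cK : compact [set v : T | forall i, `[0, 1]%classic (v ord0 i)].
  by apply: (@rV_compact R g (fun=> `[0, 1]%classic)) => _; exact: segment_compact.
move/compact_near_coveringP in cK.
have := cK R (0 : R)^'+ (fun h t => Q h t) _.
move=> /(_ _) [].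
  move=> x xK; have [|r r0 hr] := H x.
    by move=> i; have /= := xK i; rewrite in_itv.
  exists (ball x r, [set h | 0 < h < r]).
    split; first by apply/nbhs_ballP; exists r.
    near=> h; apply/andP; split; near: h; [exact: nbhs_right_gt | exact: nbhs_right_lt].
  move=> [y h] [/= xy /andP[h0 hr']].
  rewrite -(subrK x y) addrC; apply: hr => // i.
  by have [_ /(_ 0 i)] := xy; rewrite -ball_normE /ball_ /= !mxE distrC.
move=> e /= e0 he; exists (e / 2); first by rewrite divr_gt0.
move=> t tK; apply: (he (e / 2)) => //=.
- by rewrite /ball_ /= sub0r normrN gtr0_norm ?divr_gt0 //; move: e0 => /=; lra.
- by rewrite divr_gt0.
Unshelve. all: by end_near. Qed.

Lemma invariant_latvec c p (hp : invariant_by c p) t n : p (t + latvec c n) = p t.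
Proof.
have step i (m : int) t' : p (t' + (c * m%:~R) *: delta_mx 0 i) = p t'.
  case: m => m.
    elim: m t' => [|m IH] t'; first by rewrite mulr0 scale0r addr0.
    by rewrite intS rmorphD mulrDr mulr1 scalerDl addrA IH hp.
  have nat_step k t2 : p (t2 + (c * k%:R) *: delta_mx 0 i) = p t2.
    elim: k t2 => [|k IH] t2; first by rewrite mulr0 scale0r addr0.
    by rewrite -[k.+1%:R]natr1 mulrDr mulr1 scalerDl addrA hp IH.
  have -> : (Negz m)%:~R = - (m.+1%:R) :> R by rewrite NegzE rmorphN.
  by rewrite mulrN scaleNr -[LHS](nat_step m.+1) subrK.
have -> : latvec c n = \sum_i (c * (n i)%:~R) *: delta_mx 0 i.
  apply/rowP => j; rewrite !mxE summxE (bigD1 j) //= !mxE !eqxx mulr1 big1 ?addr0 // => i ij.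
  by rewrite !mxE eqxx /= eq_sym (negbTE ij) mulr0.
elim: (index_enum _) t => [|i r IH] t; first by rewrite big_nil addr0.
by rewrite big_cons addrA IH step.
Qed.

Lemma latvec_reduce (c : R) t : 0 < c -> exists n : 'I_g -> int,
  forall i, 0 <= (t - latvec c n) 0 i < c.
Proof.
move=> c0; exists (fun i => Num.floor (t 0 i / c)) => i; rewrite !mxE.
have /andP[] := floor_itv (t 0 i / c).
rewrite ler_pdivlMr // ltr_pdivrMr // rmorphD /= => h1 h2.
by apply/andP; split; lra.
Qed.

Lemma periodic_cube p (hp : periodic p) t : exists2 t', unit_cube t' &
  exists2 n, t = t' + latvec 1 n & p t' = p t.
Proof.
have [n hn] := latvec_reduce t ltr01.
exists (t - latvec 1 n); first by move=> i; have /andP[-> /ltW] := hn i.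
exists n; first by rewrite subrK.
by rewrite -{2}(subrK (latvec 1 n) t) (invariant_latvec hp).
Qed.

Lemma tcont_uniform p : tcont p -> periodic p -> forall e, 0 < e ->
  exists2 r, 0 < r & forall t s, small r s -> cabs (p (t + s) - p t) <= e.
Proof.
move=> cp pp e e0.
have [|r r0 hr] := @cube_cover (fun h t => forall s, small h s -> cabs (p (t + s) - p t) <= e).
  move=> t _; have [r r0 hr] := cp t _ (divr_gt0 e0 (ltr0n _ 2)).
  exists (r / 2); first by lra.
  move=> s ss h h0 hh s' ss'.
  have h1 : cabs (p (t + s) - p t) <= e / 2.
    by apply: hr => i; apply: lt_trans (ss i) _; lra.
  have h2 : cabs (p (t + s + s') - p t) <= e / 2.
    rewrite -addrA; apply: hr => i; rewrite mxE.
    have := ss i; have := ss' i; have := ler_normD (s 0 i) (s' 0 i); lra.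
  have := ler_cabs_trans (p (t + s + s')) (p t) (p (t + s)).
  rewrite (cabsB (p t)); lra.
exists r => // t s ss; have [t' tc [n tE pt]] := periodic_cube pp t.
rewrite -pt; have -> : p (t + s) = p (t' + s).
  by rewrite tE -addrA (addrC _ s) addrA (invariant_latvec pp).
exact: hr.
Qed.

Lemma tcont_bounded p : tcont p -> periodic p ->
  exists2 S, 0 < S & forall t, cabs (p t) <= S.
Proof.
move=> cp pp.
have [|r r0 hr] := @cube_cover (fun h t => cabs (p t) <= h^-1).
  move=> t _; have [r r0 hr] := cp t 1 ltr01.
  pose M := cabs (p t) + 1; have M0 : 0 < M by rewrite ltr_wpDl // cabs_ge0.
  exists (Num.min r M^-1); first by rewrite lt_min r0 invr_gt0.
  move=> s ss h h0; rewrite lt_min => /andP[_ hM].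
  apply: le_trans (_ : M <= _).
    have := ler_cabs_trans (p (t + s)) (p t) 0; rewrite !subr0.
    have : cabs (p (t + s) - p t) <= 1.
      by apply: hr => i; have := ss i; rewrite lt_min => /andP[].
    by rewrite /M; lra.
  by rewrite -[M]invrK lef_pV2 ?posrE ?invr_gt0 // ltW.
exists r^-1; first by rewrite invr_gt0.
by move=> t; have [t' tc [n _ <-]] := periodic_cube pp t; exact: hr.
Qed.

Definition grid N (k : {ffun 'I_g -> 'I_N.+1}) : T := \row_i ((k i)%:R / N.+1%:R).
Definition mean N p t : C := (N.+1%:R ^+ g)^-1 * \sum_(k : {ffun 'I_g -> 'I_N.+1}) p (t + grid k).

Lemma mean_sum N (I : Type) (r : seq I) (F : I -> T -> C) t :
  mean N (fun t => \sum_(i <- r) F i t) t = \sum_(i <- r) mean N (F i) t.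
Proof. by rewrite /mean exchange_big mulr_sumr. Qed.

Lemma meanD N p q t : mean N (fun t => p t + q t) t = mean N p t + mean N q t.
Proof. by rewrite /mean big_split mulrDr. Qed.

Lemma meanZ N c p t : mean N (fun t => c * p t) t = c * mean N p t.
Proof. by rewrite /mean -mulr_sumr mulrCA. Qed.

Lemma mean_const N c t : mean N (fun=> c) t = c.
Proof.
rewrite /mean sumr_const card_ffun !card_ord -[c *+ _]mulr_natl natrX mulKf // expf_neq0 // pnatr_eq0.
Qed.

Lemma mean_shift N p t s : mean N p (t + s) = mean N (fun t => p (t + s)) t.
Proof. by rewrite /mean; congr (_ * _); apply: eq_bigr => k _; rewrite addrAC. Qed.

Lemma mean_le N p t (b : T -> R) : (forall k, cabs (p (t + @grid N k)) <= b (t + grid k)) ->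
  cabs (mean N p t) <= (N.+1%:R ^+ g)^-1 * \sum_(k : {ffun 'I_g -> 'I_N.+1}) b (t + grid k).
Proof.
move=> h; rewrite /mean cabsM cabsV cabsX cabs_nat ler_wpM2l ?invr_ge0 ?exprn_ge0 //.
by apply: le_trans (ler_cabs_sum _ _ _) _; exact: ler_sum.
Qed.

Lemma mean_le_cst N p t (b : R) : (forall s, cabs (p s) <= b) -> cabs (mean N p t) <= b.
Proof.
move=> h; apply: le_trans (@mean_le N p t (fun=> b) _) _ => //.
rewrite sumr_const card_ffun !card_ord -[b *+ _]mulr_natl natrX mulKf // expf_neq0 // pnatr_eq0.
Qed.

Lemma mean_comm N M p t : mean N (mean M p) t = mean M (mean N p) t.
Proof.
rewrite /mean -!mulr_sumr mulrCA; congr (_ * (_ * _)).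
rewrite exchange_big; apply: eq_bigr => k _; apply: eq_bigr => j _.
by rewrite addrAC.
Qed.

(** A translation by one grid step permutes the grid points cyclically, up to a period. *)
Lemma mean_invariant N p : periodic p -> invariant_by N.+1%:R^-1 (mean N p).
Proof.
move=> pp t i; rewrite /mean; congr (_ * _).
pose h (k : {ffun 'I_g -> 'I_N.+1}) := [ffun j => if j == i then ordS (k j) else k j].
have hi : injective h.
  move=> k k' /ffunP e; apply/ffunP => j; have := e j; rewrite !ffunE.
  by case: ifP => // _; exact: (can_inj (@ordSK _)).
rewrite [RHS](reindex_inj hi); apply: eq_bigr => k _.
have N0 : N.+1%:R != 0 :> R by rewrite pnatr_eq0.
have [kN|kN] := ltnP (k i).+1 N.+1.
  congr p; rewrite -addrA; congr (t + _); apply/rowP => j; rewrite !mxE eqxx /= ffunE.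
  case: (eqVneq j i) => [->|ji] /=; last by rewrite mulr0 add0r.
  by rewrite modn_small // -[(k i).+1%:R]natr1 mulr1; field.
(* Here [k i] is [N]: the shifted point is the first grid point of its line plus one period. *)
rewrite -[RHS](pp _ i); congr p; rewrite -!addrA; congr (t + _); apply/rowP => j.
rewrite !mxE eqxx /= ffunE; case: (eqVneq j i) => [->|ji] /=; last by rewrite !mulr0 add0r addr0.
have -> : (k i).+1 = N.+1 by apply/eqP; rewrite eqn_leq kN ltn_ord.
have -> : (k i : nat) = N by apply/eqP; rewrite eqn_leq -ltnS ltn_ord -ltnS.
by rewrite modnn mulr1 -natr1; field; rewrite natr1.
Qed.

(** Invariance under the grid step reduces [s] to a vector shorter than the step, hence within the
    range of uniform continuity. *)
Lemma mean_mean p e r N : (forall t s, small r s -> cabs (p (t + s) - p t) <= e) ->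
  periodic p -> N.+1%:R^-1 <= r ->
  forall t s, cabs (mean N p (t + s) - mean N p t) <= e.
Proof.
move=> hp pp Nr t s.
have N0 : 0 < N.+1%:R^-1 :> R by rewrite invr_gt0.
have [n hn] := latvec_reduce s N0.
rewrite -(subrK (latvec N.+1%:R^-1 n) s) addrA (invariant_latvec (mean_invariant N pp)).
set s' := s - _.
have ss : small r s'.
  by move=> i; have /andP[h1 h2] := hn i; rewrite ger0_norm //; apply: lt_le_trans Nr.
rewrite mean_shift -mulN1r -meanZ -meanD.
by apply: mean_le_cst => x; rewrite mulN1r; exact: hp.
Qed.

(** The means of orders [N] and [N0] are compared through the iterated mean: since the two
    averagings commute, it is within [e / 2] of both. *)
Lemma mean_cauchy p : tcont p -> periodic p -> forall e, 0 < e ->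
  exists N0, forall N, (N0 <= N)%N -> (forall t s, cabs (mean N p (t + s) - mean N p t) <= e) /\
    forall t, cabs (mean N p t - mean N0 p t) <= e.
Proof.
move=> cp pp e e0.
have e2 : 0 < e / 2 by lra.
have [r r0 hr] := tcont_uniform cp pp e2.
pose N0 := Num.truncn (r^-1).
have hN N : (N0 <= N)%N -> N.+1%:R^-1 <= r.
  move=> h; rewrite -[r]invrK lef_pV2 ?posrE ?invr_gt0 //.
  have : r^-1 < N0.+1%:R by apply: truncnS_gt.
  move=> /ltW /le_trans; apply; by rewrite ler_nat.
have comp N M t : (N0 <= N)%N -> cabs (mean M (mean N p) t - mean N p t) <= e / 2.
  move=> h; rewrite -(mean_const M (mean N p t) t) -mulN1r -meanZ -meanD.
  rewrite /mean cabsM cabsV cabsX cabs_nat.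
  rewrite -ler_pdivlMl ?invr_gt0 ?exprn_gt0 // invrK.
  apply: le_trans (ler_cabs_sum _ _ _) _.
  apply: le_trans (_ : \sum_(k : {ffun 'I_g -> 'I_M.+1}) (e / 2) <= _); last first.
    by rewrite sumr_const card_ffun !card_ord -[_ *+ _]mulr_natl natrX.
  apply: ler_sum => k _; rewrite mulN1r.
  exact: (mean_mean hr pp (hN _ h)).
exists N0 => N h; split.
  move=> t s; apply: le_trans (mean_mean hr pp (hN _ h) t s) _; lra.
move=> t; have := comp N N0 t h; have := comp N0 N t (leqnn _); rewrite mean_comm.
have := ler_cabs_trans (mean N p t) (mean N0 (mean N p) t) (mean N0 p t).
rewrite (cabsB (mean N p t) (mean N0 (mean N p) t)); lra.
Qed.

Lemma mean_cvg p : tcont p -> periodic p -> exists l, ccvg (fun N => mean N p 0) l.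
Proof.
move=> cp pp; apply: ccvg_cauchy => e e0; have [N0 h] := mean_cauchy cp pp e0.
by exists N0 => n /h [].
Qed.

End Torus.

Lemma cexp_near0 (R : realType) (e : R) : 0 < e ->
  exists2 r, 0 < r & forall z : R[i], cabs z < r -> cabs (cexp z - 1) <= e.
Proof.
move=> e0; pose K := 1 + 4 * expR (1 : R).
have K0 : 0 < K by rewrite /K; have := expR_gt0 (1 : R); lra.
exists (Num.min 1 (e / K)); first by rewrite lt_min ltr01 divr_gt0.
move=> z; rewrite lt_min => /andP[z1 zK].
have -> : cexp z - 1 = (cexp z - 1 - z) + z by ring.
apply: le_trans (ler_cabsD _ _) _.
have h := cexp2_le z; have z0 := cabs_ge0 z.
rewrite ltr_pdivlMr // in zK; apply: le_trans (ltW zK).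
have h1 : expR (cabs z) <= expR 1 by rewrite ler_expR ltW.
have h2 : 4 * cabs z ^+ 2 * expR (cabs z) <= cabs z * (4 * expR 1).
  have -> : 4 * cabs z ^+ 2 * expR (cabs z) = cabs z * (4 * (cabs z * expR (cabs z))) by ring.
  rewrite ler_wpM2l // ler_wpM2l // -[leRHS]mul1r.
  by apply: ler_pM; rewrite ?expR_ge0 // ltW.
by rewrite /K mulrDr mulr1; lra.
Qed.

(** * Uniqueness of Fourier coefficients by an approximate identity *)

Section FourierUniqueness.
Variables (R : realType) (g : nat).
Local Notation C := R[i].
Local Notation T := 'rV[R]_g.
Local Notation Z := {ffun 'I_g -> int}.
Implicit Types (p q : T -> C) (t s : T) (n m : Z).
Local Notation periodic := (invariant_by 1).

Definition echar n t : C := cexp (2 * piC R * 'i * (\sum_i (n i)%:~R * t 0 i)%:C).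

Lemma echar0 t : echar 0 t = 1.
Proof.
by rewrite /echar big1 ?mulr0 ?cexp0 // => i _; rewrite ffunE mul0r.
Qed.

Lemma echarD n m t : echar (n + m) t = echar n t * echar m t.
Proof.
rewrite /echar -cexpD -mulrDr -rmorphD -big_split; congr (cexp (_ * _%:C)).
by apply: eq_bigr => i _; rewrite ffunE rmorphD mulrDl.
Qed.

Lemma echarDt n t s : echar n (t + s) = echar n t * echar n s.
Proof.
rewrite /echar -cexpD -mulrDr -rmorphD -big_split; congr (cexp (_ * _%:C)).
by apply: eq_bigr => i _; rewrite mxE mulrDr.
Qed.

Lemma cabs_echar n t : cabs (echar n t) = 1.
Proof.
rewrite /echar cabs_cexp (_ : complex.Re _ = 0) ?expR0 //.
by rewrite /piC -(rmorph_nat (real_complex R)) -rmorphM /=; simpc.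
Qed.

Lemma echar_periodic n : periodic (echar n).
Proof.
move=> t i; rewrite echarDt scale1r.
rewrite {2}/echar (bigD1 i) //= big1 => [|j ji]; last first.
  by rewrite mxE eqxx (negbTE ji) mulr0.
rewrite mxE !eqxx mulr1 addr0 (rmorph_int (real_complex R)).
by rewrite cexp_2piMint mulr1.
Qed.

Lemma echar_tcont n : tcont (echar n).
Proof.
move=> t e e0; have [r r0 hr] := cexp_near0 e0.
pose K := 2 * pi * (\sum_i `|(n i)%:~R|) + 1 : R.
have s0 : 0 <= \sum_i `|(n i)%:~R| :> R by apply: sumr_ge0.
have K0 : 0 < K by rewrite /K ltr_wpDl // !mulr_ge0 // pi_ge0.
exists (r / K); first by rewrite divr_gt0.
move=> s ss; rewrite echarDt.
have -> : echar n t * echar n s - echar n t = echar n t * (echar n s - 1) by ring.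
rewrite cabsM cabs_echar mul1r; apply: hr.
rewrite !cabsM cabs_i cabs_nat /piC !cabs_real mulr1 (ger0_norm (pi_ge0 R)).
apply: le_lt_trans (_ : 2 * pi * ((\sum_i `|(n i)%:~R|) * (r / K)) < _).
  rewrite ler_wpM2l ?mulr_ge0 ?pi_ge0 // mulr_suml.
  apply: le_trans (ler_norm_sum _ _ _) _; apply: ler_sum => i _.
  by rewrite normrM ler_wpM2l // ltW.
have -> : 2 * pi * ((\sum_i `|(n i)%:~R|) * (r / K)) = r * ((K - 1) / K).
  rewrite mulrA (_ : 2 * pi * _ = K - 1); last by rewrite /K addrK.
  by rewrite mulrCA.
by rewrite gtr_pMr // ltr_pdivrMr // mul1r; lra.
Qed.

Lemma tcont_const c : tcont (fun _ : T => c : C).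
Proof. by move=> t e e0; exists 1 => // s _; rewrite subrr cabs0 ltW. Qed.

Lemma tcontD p q : tcont p -> tcont q -> tcont (fun t => p t + q t).
Proof.
move=> hp hq t e e0; have e2 : 0 < e / 2 by lra.
have [r r0 hr] := hp t _ e2; have [r' r0' hr'] := hq t _ e2.
exists (Num.min r r'); first by rewrite lt_min r0.
move=> s ss; have s1 : small r s by move=> i; have := ss i; rewrite lt_min => /andP[].
have s2 : small r' s by move=> i; have := ss i; rewrite lt_min => /andP[].
have := hr _ s1; have := hr' _ s2.
have := ler_cabsD (p (t + s) - p t) (q (t + s) - q t).
by rewrite (_ : p (t + s) - p t + (q (t + s) - q t) = p (t + s) + q (t + s) - (p t + q t)); [lra|ring].
Qed.

Lemma tcontM p q : tcont p -> tcont q -> tcont (fun t => p t * q t).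
Proof.
move=> hp hq t e e0.
pose A := cabs (p t) + 1; pose B := cabs (q t) + 1.
have A0 : 0 < A by rewrite ltr_wpDl // cabs_ge0.
have B0 : 0 < B by rewrite ltr_wpDl // cabs_ge0.
have [r1 r10 hr1] := hq t 1 ltr01.
have [|r2 r20 hr2] := hq t (e / 2 / A); first by rewrite !divr_gt0.
have [|r3 r30 hr3] := hp t (e / 2 / B); first by rewrite !divr_gt0.
exists (Num.min r1 (Num.min r2 r3)); first by rewrite !lt_min r10 r20.
move=> s ss.
have s1 : small r1 s by move=> i; have := ss i; rewrite !lt_min => /and3P[].
have s2 : small r2 s by move=> i; have := ss i; rewrite !lt_min => /and3P[].
have s3 : small r3 s by move=> i; have := ss i; rewrite !lt_min => /and3P[].
have -> : p (t + s) * q (t + s) - p t * q t =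
  (p (t + s) - p t) * q (t + s) + p t * (q (t + s) - q t) by ring.
apply: le_trans (ler_cabsD _ _) _; rewrite !cabsM.
have hB : cabs (q (t + s)) <= B.
  have := hr1 _ s1; have := ler_cabs_trans (q (t + s)) (q t) 0; rewrite !subr0 /B; lra.
have hA : cabs (p t) <= A by rewrite /A lerDl.
have -> : e = e / 2 / B * B + A * (e / 2 / A) by field; rewrite !gt_eqF.
apply: lerD; apply: ler_pM; rewrite ?cabs_ge0 //; [exact: hr3|exact: hr2].
Qed.

Lemma tcont_prod (I : Type) (r : seq I) (F : I -> T -> C) :
  (forall i, tcont (F i)) -> tcont (fun t => \prod_(i <- r) F i t).
Proof.
move=> h; elim: r => [|i r IH].
  rewrite (_ : (fun _ => _) = fun=> 1); first exact: tcont_const.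
  by apply/funext => t; rewrite big_nil.
rewrite (_ : (fun _ => _) = fun t => F i t * \prod_(i <- r) F i t).
  exact: tcontM.
by apply/funext => t; rewrite big_cons.
Qed.

Definition cos_sq (x : R) : R := cos (pi * x) ^+ 2.
(** A trigonometric polynomial equal to 1 exactly at the integer points: its powers concentrate
    there, and their means against [p] are controlled by the Fourier coefficients of [p]. *)
Definition kernel t : R := \prod_i cos_sq (t 0 i).
Definition unit_ffun (i : 'I_g) : Z := [ffun j => (j == i)%:R].
(** The factors for [unit_ffun i] and its opposite multiply to cos^2(pi t_i), so a multiplication by
    the kernel is a succession of multiplications by 1 plus a character. *)
Definition half_char n t : C := 2^-1 * (1 + echar n t).

Lemma cos_sq_sin x : cos_sq x = 1 - sin (pi * x) ^+ 2.
Proof. by rewrite /cos_sq -(cos2Dsin2 (pi * x)) addrK. Qed.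

Lemma cos_sq_ge0 x : 0 <= cos_sq x. Proof. exact: sqr_ge0. Qed.
Lemma cos_sq_le1 x : cos_sq x <= 1.
Proof. by rewrite cos_sq_sin gerBl sqr_ge0. Qed.

Lemma cos_sq_lower x : 1 - pi ^+ 2 * x ^+ 2 <= cos_sq x.
Proof.
rewrite cos_sq_sin lerD2l lerN2 -(real_normK (num_real (sin _))).
rewrite -exprMn -(real_normK (num_real (pi * x))) lerXn2r ?nnegrE //.
exact: sin_le_abs.
Qed.

Lemma half_charE i t : half_char (unit_ffun i) t * half_char (- unit_ffun i) t =
  (cos_sq (t 0 i))%:C.
Proof.
have e1 : echar (unit_ffun i) t = cexp (2 * piC R * 'i * (t 0 i)%:C).
  rewrite /echar (bigD1 i) //= big1 => [|j ji]; last by rewrite ffunE (negbTE ji) mul0r.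
  by rewrite ffunE eqxx mul1r addr0.
have e2 : echar (- unit_ffun i) t = cexp (- (2 * piC R * 'i * (t 0 i)%:C)).
  rewrite /echar (bigD1 i) //= big1 => [|j ji]; last by rewrite !ffunE (negbTE ji) oppr0 mul0r.
  by rewrite !ffunE eqxx mulN1r addr0 rmorphN mulrN.
rewrite /half_char e1 e2; set x := t 0 i.
have -> : 2 * piC R * 'i * x%:C = 0 +i* (2 * (pi * x)).
  rewrite /piC -(rmorph_nat (real_complex R)); simpc; congr (_ +i* _); ring.
rewrite /cexp /= oppr0 expR0 cosN sinN /cos_sq.
have -> : 2 * (pi * x) = pi * x + pi * x by ring.
rewrite cosD sinD; set c := cos _; set s := sin _.
have cs : s * s = 1 - c * c by rewrite -!expr2 -(cos2Dsin2 (pi * x)) addrAC subrr add0r.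
rewrite -(rmorph_nat (real_complex R)) -fmorphV.
apply/eqP; rewrite eq_complex /=; apply/andP; split; apply/eqP; last by ring.
transitivity (4^-1 * ((1 + (c * c - s * s)) ^+ 2 + 4 * (s * s) * (c * c))); first by field.
by rewrite cs; field.
Qed.

Lemma kernelE t : \prod_i (half_char (unit_ffun i) t * half_char (- unit_ffun i) t) = (kernel t)%:C.
Proof. by rewrite rmorph_prod; apply: eq_bigr => i _; exact: half_charE. Qed.

Lemma kernel_ge0 t : 0 <= kernel t.
Proof. by apply: prodr_ge0 => i _; exact: cos_sq_ge0. Qed.

Lemma kernel_le_cos t i : kernel t <= cos_sq (t 0 i).
Proof.
rewrite /kernel (bigD1 i) //= ler_piMr ?cos_sq_ge0 //.
apply: prodr_ile1 => j _; by rewrite cos_sq_ge0 cos_sq_le1.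
Qed.

Lemma kernel_le1 t : kernel t <= 1.
Proof. by apply: prodr_ile1 => j _; rewrite cos_sq_ge0 cos_sq_le1. Qed.

Lemma half_char_tcont n : tcont (half_char n).
Proof.
by apply: tcontM; [exact: tcont_const|apply: tcontD; [exact: tcont_const|exact: echar_tcont]].
Qed.

Lemma kernel_tcont : tcont (fun t => (kernel t)%:C).
Proof.
rewrite (_ : (fun _ => _) = fun t => \prod_i (half_char (unit_ffun i) t * half_char (- unit_ffun i) t)).
  by apply: tcont_prod => i; apply: tcontM; exact: half_char_tcont.
by apply/funext => t; rewrite kernelE.
Qed.

Lemma cos_sq_eq1 x : 0 <= x <= 1 -> cos_sq x = 1 -> x = 0 \/ x = 1.
Proof.
move=> /andP[x0 x1]; rewrite cos_sq_sin => h.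
have [->|xn0] := eqVneq x 0; first by left.
have [->|xn1] := eqVneq x 1; first by right.
have : 0 < sin (pi * x).
  apply: sin_gt0_pi; apply/andP; split; first by rewrite mulr_gt0 ?pi_gt0 // lt_def xn0.
  by rewrite gtr_pMr ?pi_gt0 // lt_neqAle xn1.
move=> /(exprn_gt0 2); lra.
Qed.

(** On the cube the kernel reaches 1 only at vertices, where [p] takes the value [p 0] by
    periodicity; near any other point it stays away from 1. *)
Lemma kernel_dichotomy p e : tcont p -> periodic p -> 0 < e ->
  exists2 h, 0 < h & forall t, unit_cube t -> cabs (p t - p 0) <= e \/ kernel t <= 1 - h.
Proof.
move=> cp pp e0.
apply: (@cube_cover _ _ (fun h t => cabs (p t - p 0) <= e \/ kernel t <= 1 - h)) => t tc.
have [k1|k1] := eqVneq (kernel t) 1.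
  have [r r0 hr] := cp t _ e0; exists r => // s ss h _ _; left.
  suff -> : p 0 = p t by exact: hr.
  pose n := fun i : 'I_g => if t 0 i == 0 then 0 else 1 : int.
  rewrite -(invariant_latvec pp 0 n) add0r; congr p; apply/rowP => i; rewrite mxE mul1r /n.
  have [||->|->] := @cos_sq_eq1 (t 0 i); rewrite ?eqxx //; last by rewrite oner_eq0.
  by apply/eqP; rewrite eq_le cos_sq_le1 -k1 kernel_le_cos.
pose d := (1 - kernel t) / 2.
have d0 : 0 < d.
  by have := kernel_le1 t; rewrite le_eqVlt (negbTE k1) /= /d; lra.
have [r r0 hr] := kernel_tcont t d0.
exists (Num.min r d); first by rewrite lt_min r0.
move=> s ss h h0; rewrite lt_min => /andP[_ hd]; right.
have sr : small r s by move=> i; have := ss i; rewrite lt_min => /andP[].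
have := hr _ sr; rewrite -rmorphB cabs_real ler_norml => /andP[_]; rewrite /d in hd *; lra.
Qed.

(** At least (N + 1) / q grid points lie in [0, 1/q]. There cos^2(pi x) >= 1 - pi^2 x^2 and
    Bernoulli's inequality give cos^(2q)(pi x) >= 1/2, since pi^2 x^2 q <= 1/2 by the assumption on
    [q]. The bound is uniform in [N]. *)
Lemma cos_sq_sum_lower (q N : nat) : (1 < q)%N -> 2 * pi ^+ 2 <= q%:R :> R ->
  (2 * q%:R)^-1 * N.+1%:R <= \sum_(j < N.+1) cos_sq (j%:R / N.+1%:R) ^+ q.
Proof.
move=> q1 hq; pose M := (N.+1 %/ q)%N.
have q0 : 0 < q%:R :> R by rewrite ltr0n; apply: leq_trans q1.
have MN : (M.+1 <= N.+1)%N by rewrite /M ltn_Pdiv.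
rewrite -(big_mkord xpredT (fun j => cos_sq (j%:R / N.+1%:R) ^+ q)).
rewrite (big_cat_nat (leq0n M.+1) MN) /=.
apply: le_trans (_ : \sum_(0 <= j < M.+1) 2^-1 <= _); last first.
  rewrite -[leLHS]addr0; apply: lerD; last by apply: sumr_ge0 => j _; rewrite exprn_ge0 ?cos_sq_ge0.
  apply: ler_sum_nat => j /andP[_ jM].
  set x := j%:R / N.+1%:R.
  have x0 : 0 <= x by rewrite divr_ge0.
  have xq : x * q%:R <= 1.
    rewrite /x mulrAC ler_pdivrMr ?ltr0n // mul1r -natrM ler_nat.
    by apply: leq_trans (leq_divM _ q); rewrite leq_mul2r -ltnS jM orbT.
  have h1 : 1 - pi ^+ 2 * x ^+ 2 <= cos_sq x := cos_sq_lower x.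
  have h2 : pi ^+ 2 * x ^+ 2 * q%:R <= 2^-1.
    have -> : pi ^+ 2 * x ^+ 2 * q%:R = pi ^+ 2 * (x * (x * q%:R)) by ring.
    have p0 := sqr_ge0 (pi : R).
    apply: le_trans (_ : pi ^+ 2 * x <= _).
      by rewrite ler_wpM2l // ler_piMr.
    have : 2 * pi ^+ 2 * x <= q%:R * x by rewrite ler_wpM2r.
    lra.
  set y := pi ^+ 2 * x ^+ 2 in h1 h2.
  have y0 : 0 <= y by rewrite mulr_ge0 ?sqr_ge0.
  have y1 : y <= 1.
    have : y * 1 <= y * q%:R by rewrite ler_wpM2l // ler1n (leq_trans _ q1).
    lra.
  have bern k : 1 - y * k%:R <= (1 - y) ^+ k.
    elim: k => [|k IH]; first by rewrite mulr0 subr0 expr0.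
    have : (1 - y) * (1 - y * k%:R) <= (1 - y) ^+ k.+1 by rewrite exprS ler_wpM2l // subr_ge0.
    apply: le_trans; rewrite -natr1.
    have : 0 <= y * y * k%:R by apply: mulr_ge0 => //; exact: mulr_ge0.
    lra.
  apply: le_trans (_ : (1 - y) ^+ q <= _).
    by have := bern q; lra.
  by rewrite lerXn2r // nnegrE ?cos_sq_ge0 // subr_ge0.
rewrite sumr_const_nat subn0 -[leRHS]mulr_natl invfM.
rewrite -mulrA [leRHS]mulrC ler_wpM2l ?invr_ge0 // mulrC ler_pdivrMr //.
by rewrite -natrM ler_nat ltnW // ltn_ceil // (leq_trans _ q1).
Qed.

Lemma kernel_mean_lower (q N : nat) : (1 < q)%N -> 2 * pi ^+ 2 <= q%:R :> R ->
  (2 * q%:R)^-1 ^+ g <= (N.+1%:R ^+ g)^-1 *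
    \sum_(k : {ffun 'I_g -> 'I_N.+1}) kernel (0 + grid R k) ^+ q.
Proof.
move=> q1 hq.
have -> : \sum_(k : {ffun 'I_g -> 'I_N.+1}) kernel (0 + grid R k) ^+ q =
    (\sum_(j < N.+1) cos_sq (j%:R / N.+1%:R) ^+ q) ^+ g.
  transitivity (\prod_(i < g) \sum_(j < N.+1) cos_sq (j%:R / N.+1%:R) ^+ q).
    rewrite bigA_distr_bigA; apply: eq_bigr => k _.
    by rewrite add0r /kernel -prodrXl; apply: eq_bigr => i _; rewrite mxE.
  by rewrite prodr_const card_ord.
rewrite -exprVn -exprMn; apply: lerXn2r; rewrite ?nnegrE.
- by rewrite invr_ge0 mulr_ge0.
- by rewrite mulr_ge0 // ?invr_ge0 // sumr_ge0 // => j _; rewrite exprn_ge0 ?cos_sq_ge0.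
by rewrite ler_pdivlMl ?ltr0n // mulrC; exact: cos_sq_sum_lower.
Qed.

(** (1 - h)^k <= e^(-kh) <= (g + 1)! / (kh)^(g + 1), which has one power of k more than the factor
    to be beaten. *)
Lemma geometric_beats_power (K h d : R) : 0 <= K -> 0 < h -> h < 1 -> 0 < d ->
  exists Q, forall k : nat, (Q <= k)%N -> K * (2 * k%:R) ^+ g * (1 - h) ^+ k < d.
Proof.
move=> K0 h0 h1 d0.
pose A := K * 2 ^+ g * (g.+1)`!%:R / h ^+ g.+1.
have hg : 0 < h ^+ g.+1 by rewrite exprn_gt0.
have f0 : 0 < (g.+1)`!%:R :> R by rewrite ltr0n fact_gt0.
have A0 : 0 <= A by rewrite !mulr_ge0 ?invr_ge0 ?exprn_ge0 // ltW.
exists (Num.truncn (A / d)).+1 => k hk.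
have k0 : 0 < k%:R :> R by rewrite ltr0n; apply: leq_trans hk.
have Aq : A < d * k%:R.
  rewrite -ltr_pdivrMl // mulrC; apply: lt_le_trans (truncnS_gt _) _.
  by rewrite ler_nat.
have e1 : (1 - h) ^+ k <= (expR (k%:R * h))^-1.
  rewrite -expRN -mulrN expRM_natl; apply: lerXn2r; rewrite ?nnegrE ?expR_ge0 //.
    lra.
  exact: expR_ge1Dx.
have x0 : 0 < k%:R * h by rewrite mulr_gt0.
have e2 : (expR (k%:R * h))^-1 <= (g.+1)`!%:R / (k%:R * h) ^+ g.+1.
  rewrite -[leRHS]invrK invfM invrK lef_pV2 ?posrE ?expR_gt0 //; last first.
    by rewrite mulr_gt0 ?invr_gt0 ?exprn_gt0.
  rewrite mulrC; have := expR_ge1Dxn g (ltW x0); lra.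
apply: le_lt_trans (_ : K * (2 * k%:R) ^+ g * ((g.+1)`!%:R / (k%:R * h) ^+ g.+1) < _).
  apply: ler_wpM2l; last exact: le_trans e1 e2.
  by rewrite mulr_ge0 // exprn_ge0 // mulr_ge0 // ltW.
have -> : K * (2 * k%:R) ^+ g * ((g.+1)`!%:R / (k%:R * h) ^+ g.+1) = A / k%:R.
  rewrite /A !exprMn !exprS; field; by rewrite !expf_neq0 ?gt_eqF.
by rewrite ltr_pdivrMr.
Qed.

(** If [p 0] were nonzero, the mean of [kernel ^+ q] times [p] would be close to [p 0] times the
    mean of [kernel ^+ q]. The latter is at least (2q)^(-g), while the error away from the integer
    points decreases geometrically in q. *)
Theorem fourier_uniqueness p : tcont p -> periodic p ->
  (forall n, ccvg (fun N => mean N (fun t => echar n t * p t) 0) 0) -> p 0 = 0.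
Proof.
move=> cp pp hp.
(* [ann f] means that [f * p] still has vanishing Fourier coefficients; this is stable under
   multiplication by 1 plus a character. *)
pose ann (f : T -> C) := forall n, ccvg (fun N => mean N (fun t => f t * echar n t * p t) 0) 0.
have ann1 : ann (fun=> 1).
  by move=> n; apply: ccvg_ext (hp n) => N; congr mean; apply/funext => t; rewrite mul1r.
have annM f m : ann f -> ann (fun t => f t * half_char m t).
  move=> hf n; have := ccvgZ 2^-1 (ccvgD (hf n) (hf (m + n))).
  rewrite addr0 mulr0; apply: ccvg_ext => N.
  rewrite -meanD -meanZ; congr mean; apply/funext => t.
  by rewrite echarD /half_char; ring.
have ann_kernel f : ann f -> ann (fun t => f t * (kernel t)%:C).
  move=> hf.
  have : forall r : seq 'I_g, ann (fun t => f t *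
     \prod_(i <- r) (half_char (unit_ffun i) t * half_char (- unit_ffun i) t)).
    elim => [|i r IH].
      rewrite (_ : (fun _ => _) = f) //.
      by apply/funext => t; rewrite big_nil mulr1.
    move: (annM _ (unit_ffun i) (annM _ (- unit_ffun i) IH)).
    congr ann; apply/funext => t; rewrite big_cons; ring.
  move/(_ (index_enum _)); congr ann; apply/funext => t.
  by rewrite -kernelE.
have ann_pow (q : nat) : ann (fun t => (kernel t ^+ q)%:C).
  elim: q => [|q IH].
    by rewrite (_ : (fun _ => _) = fun=> 1).
  move: (ann_kernel _ IH); congr ann; apply/funext => t.
  by rewrite -rmorphM -exprSr.
apply/eqP; rewrite -cabs_eq0; apply/negPn/negP => p0.
have {p0}P0 : 0 < cabs (p 0) by rewrite lt_def p0 cabs_ge0.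
set P := cabs (p 0) in P0.
have P4 : 0 < P / 4 by lra.
have [h' h0' hk'] := kernel_dichotomy cp pp P4.
have [h h0 [h1 hk]] : exists2 h, 0 < h & h < 1 /\
    forall t, unit_cube t -> cabs (p t - p 0) <= P / 4 \/ kernel t <= 1 - h.
  exists (Num.min h' 2^-1); first by rewrite lt_min h0' /=.
  split; first by rewrite gt_min; apply/orP; right; lra.
  move=> t /hk' [?|h2]; [by left|right].
  by apply: le_trans h2 _; rewrite lerD2l lerN2 ge_min lexx.
have [S S0 hS] := tcont_bounded cp pp.
have [|Q hQ] := @geometric_beats_power (4 * S) h P _ h0 h1 P0; first by lra.
(* Beyond [Q] for the geometric decay, at least 2 and 2 pi^2 for the lower bound on the mean. *)
pose q := maxn Q (maxn 2 (Num.truncn (2 * pi ^+ 2 : R)).+1).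
have q1 : (1 < q)%N by rewrite /q !leq_max leqnn orbT.
have qpi : 2 * pi ^+ 2 <= q%:R :> R.
  apply: le_trans (ltW (truncnS_gt _)) _; rewrite ler_nat /q !leq_max leqnn !orbT //.
have := hQ q (leq_maxl _ _).
have q0 : 0 < q%:R :> R by rewrite ltr0n; apply: leq_trans q1.
set c := (2 * q%:R)^-1 ^+ g : R.
have c0 : 0 < c by rewrite exprn_gt0 // invr_gt0 mulr_gt0.
(* A single grid suffices, because the bounds on the means of the powers hold for every [N]. *)
have [|N hN] := ann_pow q 0 (P * c / 4); first by rewrite divr_gt0 // mulr_gt0.
have {hN} := hN N (leqnn _); rewrite subr0.
have -> : (fun t => (kernel t ^+ q)%:C * echar 0 t * p t) =
    (fun t => p 0 * (kernel t ^+ q)%:C + (kernel t ^+ q)%:C * (p t - p 0)).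
  by apply/funext => t; rewrite echar0; ring.
rewrite meanD meanZ => hN.
set m := (N.+1%:R ^+ g)^-1 * \sum_(k : {ffun 'I_g -> 'I_N.+1}) kernel (0 + grid R k) ^+ q.
have mc : c <= m by exact: kernel_mean_lower.
have e1 : mean N (fun t => (kernel t ^+ q)%:C) 0 = m%:C.
  by rewrite /mean /m rmorphM fmorphV rmorphXn rmorph_nat rmorph_sum.
have e2 : cabs (mean N (fun t => (kernel t ^+ q)%:C * (p t - p 0)) 0) <=
    P / 4 * m + 2 * S * (1 - h) ^+ q.
  apply: le_trans (@mean_le _ _ N _ 0 (fun t => P / 4 * kernel t ^+ q + 2 * S * (1 - h) ^+ q) _) _.
    move=> k; rewrite cabsM cabs_real ger0_norm ?exprn_ge0 ?kernel_ge0 //.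
    set t := 0 + _.
    have tc : unit_cube t.
      move=> i; rewrite /t add0r mxE; apply/andP; split; first by rewrite divr_ge0.
      by rewrite ler_pdivrMr ?ltr0n // mul1r ler_nat ltnW.
    have k0 : 0 <= kernel t ^+ q by rewrite exprn_ge0 ?kernel_ge0.
    have h2 : 0 <= 2 * S * (1 - h) ^+ q by rewrite !mulr_ge0 ?exprn_ge0 //; lra.
    have [h3|h3] := hk t tc.
      by rewrite -[leLHS]addr0 [P / 4 * _]mulrC; apply: lerD => //; rewrite ler_wpM2l.
    rewrite -[leLHS]add0r; apply: lerD; first by rewrite mulr_ge0 // ltW.
    rewrite mulrC; apply: ler_pM; rewrite ?cabs_ge0 //.
      have := ler_cabsB (p t) (p 0); have := hS t; have := hS 0; lra.
    rewrite lerXn2r // nnegrE ?kernel_ge0 //; lra.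
  rewrite big_split /= mulrDr -mulr_sumr mulrCA lerD2l.
  rewrite sumr_const card_ffun !card_ord -[_ *+ (_ ^ _)]mulr_natl natrX mulKf // expf_neq0 //.
rewrite e1 in hN.
have e3 : P * m <= P * c / 4 + (P / 4 * m + 2 * S * (1 - h) ^+ q).
  have m0 : 0 <= m by apply: le_trans mc; exact: ltW.
  have -> : P * m = cabs (p 0 * m%:C) by rewrite cabsM cabs_real ger0_norm.
  set x := p 0 * _ in hN *; set y := mean N _ 0 in hN e2.
  have -> : x = (x + y) - y by ring.
  apply: le_trans (ler_cabsB _ _) _; exact: lerD.
have e4 : P * c / 2 <= 2 * S * (1 - h) ^+ q by nra.
have e5 : P <= 4 * S * (2 * q%:R) ^+ g * (1 - h) ^+ q.
  rewrite -(ler_pM2r c0).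
  have -> : 4 * S * (2 * q%:R) ^+ g * (1 - h) ^+ q * c = 4 * S * (1 - h) ^+ q * ((2 * q%:R) ^+ g * c) by ring.
  rewrite /c -exprMn mulfV ?expr1n; last by rewrite lt0r_neq0 // mulr_gt0.
  rewrite -/c; lra.
lra.
Qed.

End FourierUniqueness.

(** * Goursat's theorem for Riemann sums *)

Section Goursat.
Variable R : realType.
Local Notation C := R[i].
Implicit Types (f : C -> C) (w a b z : C).

Definition cdiff f := forall z, exists D, forall e : R, 0 < e -> exists2 r : R, 0 < r &
  forall h, cabs h < r -> cabs (f (z + h) - f z - D * h) <= e * cabs h.

(* Riemann sum of the integral of [f] along the segment from [w] to [w + a]. *)
Definition lsum f n w a : C :=
  a / (2 ^ n)%:R * \sum_(0 <= k < 2 ^ n) f (w + k%:R / (2 ^ n)%:R * a).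

(** The boundary of the parallelogram w, w + a, w + a + b, w + b, with opposite sides in opposite
    directions. *)
Definition contour f n w a b : C :=
  lsum f n w a + lsum f n (w + a) b - lsum f n (w + b) a - lsum f n w b.

Lemma pow2_neq0 n : (2 ^ n)%:R != 0 :> C.
Proof. by rewrite pnatr_eq0 -lt0n expn_gt0. Qed.

(** Dyadic subdivision makes this exact rather than true up to an error, and the bisection of
    parallelograms inherits the exactness. *)
Lemma lsum_split f n w a :
  lsum f n.+1 w a = lsum f n w (a / 2) + lsum f n (w + a / 2) (a / 2).
Proof.
have e2 := pow2_neq0 n.
have e3 : (2 ^ n + 2 ^ n)%:R = 2 * (2 ^ n)%:R :> C by rewrite addnn -mul2n natrM.
rewrite /lsum expnS mul2n -addnn (big_cat_nat (leq0n (2 ^ n)) (leq_addr _ _)) /=.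
have -> : a / 2 / (2 ^ n)%:R = a / (2 ^ n + 2 ^ n)%:R by rewrite e3; field.
rewrite -mulrDr; congr (_ * (_ + _)).
  by apply: eq_bigr => k _; congr f; rewrite e3; field.
rewrite -{1}[(2 ^ n)%N]add0n big_addn addnK.
by apply: eq_bigr => k _; congr f; rewrite e3 natrD; field.
Qed.

Lemma contour_split f n w a b (c := a / 2) (d := b / 2) :
  contour f n.+1 w a b = contour f n w c d + contour f n (w + c) c d
    + contour f n (w + d) c d + contour f n (w + c + d) c d.
Proof.
rewrite /contour !lsum_split -/c -/d.
have -> : w + a = w + c + c by rewrite /c; field.
have -> : w + b = w + d + d by rewrite /d; field.
have -> : w + d + c = w + c + d by ring.
have -> : w + d + d + c = w + c + d + d by ring.
have -> : w + c + c + d = w + c + d + c by ring.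
ring.
Qed.

Lemma lsumD f f' n w a : lsum (fun z => f z + f' z) n w a = lsum f n w a + lsum f' n w a.
Proof. by rewrite /lsum big_split mulrDr. Qed.

(** For an affine function the error of the left Riemann sum depends on the side vector but not on
    its position, so it cancels between opposite sides at every level [n]. *)
Lemma contour_affine n w a b c d : contour (fun z => c + d * z) n w a b = 0.
Proof.
have e2 := pow2_neq0 n.
have lE v l : lsum (fun z => c + d * z) n v l = l * (c + d * v) +
    d * (l ^+ 2 * (\sum_(0 <= k < 2 ^ n) k%:R / (2 ^ n)%:R ^+ 2)).
  rewrite /lsum.
  rewrite (eq_bigr (fun k => (c + d * v) + d * l * (k%:R / (2 ^ n)%:R))); last by move=> k _; ring.
  rewrite big_split /= sumr_const_nat subn0 mulrDr -mulr_natr.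
  congr (_ + _); first by field.
  rewrite -mulr_sumr !mulr_sumr; apply: eq_bigr => k _; by field.
rewrite /contour !lE; ring.
Qed.

Lemma contourD f f' n w a b :
  contour (fun z => f z + f' z) n w a b = contour f n w a b + contour f' n w a b.
Proof. rewrite /contour !lsumD; ring. Qed.

Lemma lsum_bound f n w a (M : R) :
  (forall t : R, 0 <= t <= 1 -> cabs (f (w + t%:C * a)) <= M) ->
  cabs (lsum f n w a) <= cabs a * M.
Proof.
move=> h; rewrite /lsum !cabsM cabsV cabs_nat -mulrA ler_wpM2l ?cabs_ge0 //.
have p0 : 0 < (2 ^ n)%:R :> R by rewrite ltr0n expn_gt0.
rewrite ler_pdivrMl //; apply: le_trans (ler_cabs_sum _ _ _) _.
apply: le_trans (_ : \sum_(0 <= k < 2 ^ n) M <= _); last by rewrite sumr_const_nat subn0 mulr_natl.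
apply: ler_sum_nat => k /andP[_ k2].
have -> : k%:R / (2 ^ n)%:R = (k%:R / (2 ^ n)%:R : R)%:C :> C.
  by rewrite rmorphM fmorphV !rmorph_nat.
by apply: h; rewrite divr_ge0 //= ler_pdivrMr // mul1r ler_nat ltnW.
Qed.

Lemma contour_bound f n w a b (M : R) :
  (forall z, cabs (z - w) <= cabs a + cabs b -> cabs (f z) <= M) ->
  cabs (contour f n w a b) <= 2 * (cabs a + cabs b) * M.
Proof.
move=> h; rewrite /contour.
have tb (t : R) c : 0 <= t <= 1 -> cabs (t%:C * c) <= cabs c.
  by move=> /andP[t0 t1]; rewrite cabsM cabs_real ger0_norm // ler_piMl ?cabs_ge0.
have h1 : cabs (lsum f n w a) <= cabs a * M.
  apply: lsum_bound => t /(tb _ a) ta; apply: h.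
  have -> : w + t%:C * a - w = t%:C * a by ring.
  by have := cabs_ge0 b; lra.
have h2 : cabs (lsum f n (w + a) b) <= cabs b * M.
  apply: lsum_bound => t /(tb _ b) ta; apply: h.
  have -> : w + a + t%:C * b - w = a + t%:C * b by ring.
  by have := ler_cabsD a (t%:C * b); lra.
have h3 : cabs (lsum f n (w + b) a) <= cabs a * M.
  apply: lsum_bound => t /(tb _ a) ta; apply: h.
  have -> : w + b + t%:C * a - w = b + t%:C * a by ring.
  by have := ler_cabsD b (t%:C * a); lra.
have h4 : cabs (lsum f n w b) <= cabs b * M.
  apply: lsum_bound => t /(tb _ b) ta; apply: h.
  have -> : w + t%:C * b - w = t%:C * b by ring.
  by have := cabs_ge0 a; lra.
apply: le_trans (ler_cabsB _ _) _.
have := ler_cabsB (lsum f n w a + lsum f n (w + a) b) (lsum f n (w + b) a).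
have := ler_cabsD (lsum f n w a) (lsum f n (w + a) b).
lra.
Qed.

(* If f - affine is o(|z - z0|), the contour integral over a small parallelogram
   near z0 is o(size^2); bisection transports this to the whole parallelogram. *)
Theorem goursat f w a b : cdiff f -> ccvg (fun n => contour f n w a b) 0.
Proof.
move=> df e e0; apply: contrapT => nN.
pose sc j (c : C) := c / (2 ^ j)%:R.
(* A piece of scale 2^(-j) is bad if its contour sums are not eventually below its share e / 4^j of
   the tolerance. *)
pose bad j v := ~ exists N, forall n, (N <= n)%N ->
  cabs (contour f n v (sc j a) (sc j b)) <= e / (4 ^ j)%:R.
have p0 j : 0 < (2 ^ j)%:R :> R by rewrite ltr0n expn_gt0.
have q0 j : 0 < (4 ^ j)%:R :> R by rewrite ltr0n expn_gt0.
pose l := cabs a + cabs b.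
have scS j c : sc j c / 2 = sc j.+1 c.
  by rewrite /sc expnS natrM; field; exact: pow2_neq0.
have cabs_sc j c : cabs (sc j c) = cabs c / (2 ^ j)%:R by rewrite /sc cabsM cabsV cabs_nat.
have step j v : bad j v -> exists v', bad j.+1 v' /\ cabs (v' - v) <= l / (2 ^ j.+1)%:R.
  move=> hb; apply: contrapT => hn.
  have good v' : cabs (v' - v) <= l / (2 ^ j.+1)%:R -> exists N, forall n, (N <= n)%N ->
      cabs (contour f n v' (sc j.+1 a) (sc j.+1 b)) <= e / (4 ^ j.+1)%:R.
    by move=> hv; apply: contrapT => hb'; apply: hn; exists v'.
  have l1 : cabs (sc j.+1 a) <= l / (2 ^ j.+1)%:R.
    by rewrite cabs_sc ler_pM2r ?invr_gt0 // lerDl cabs_ge0.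
  have l2 : cabs (sc j.+1 b) <= l / (2 ^ j.+1)%:R.
    by rewrite cabs_sc ler_pM2r ?invr_gt0 // lerDr cabs_ge0.
  have [|N1 h1] := good v.
    by rewrite subrr cabs0 divr_ge0 // /l addr_ge0 ?cabs_ge0.
  have [|N2 h2] := good (v + sc j.+1 a); first by rewrite addrC addKr.
  have [|N3 h3] := good (v + sc j.+1 b); first by rewrite addrC addKr.
  have [|N4 h4] := good (v + sc j.+1 a + sc j.+1 b).
    have -> : v + sc j.+1 a + sc j.+1 b - v = sc j.+1 a + sc j.+1 b by ring.
    apply: le_trans (ler_cabsD _ _) _.
    by rewrite !cabs_sc -mulrDl.
  (* The threshold grows by one because [contour_split] passes from level [n.+1] to level [n]. *)
  apply: hb; exists (maxn (maxn N1 N2) (maxn N3 N4)).+1 => -[//|n].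
  rewrite ltnS !geq_max => /andP[/andP[/h1 {}h1 /h2 {}h2] /andP[/h3 {}h3 /h4 {}h4]].
  rewrite contour_split !scS.
  have e4 : e / (4 ^ j)%:R = 4 * (e / (4 ^ j.+1)%:R).
    by rewrite expnS natrM; field; rewrite gt_eqF.
  rewrite e4; set x1 := contour _ _ _ _ _ in h1 *; set x2 := contour _ _ _ _ _ in h2 *.
  set x3 := contour _ _ _ _ _ in h3 *; set x4 := contour _ _ _ _ _ in h4 *.
  have := ler_cabsD (x1 + x2 + x3) x4; have := ler_cabsD (x1 + x2) x3.
  have := ler_cabsD x1 x2; lra.
have [nx hnx] : exists nx : nat * C -> C, forall jv, bad jv.1 jv.2 ->
    bad jv.1.+1 (nx jv) /\ cabs (nx jv - jv.2) <= l / (2 ^ jv.1.+1)%:R.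
  suff : forall jv : nat * C, exists v' : C, bad jv.1 jv.2 -> bad jv.1.+1 v' /\
      cabs (v' - jv.2) <= l / (2 ^ jv.1.+1)%:R.
    by move=> /choice [nx hnx]; exists nx.
  move=> [j v] /=.
  (* A choice function must be total: pieces that are not bad receive the dummy value 0. *)
  have [hb|hb] := pselect (bad j v); last by exists 0.
  by have [v' hv'] := step j v hb; exists v'.
pose v := fix v j := if j is j'.+1 then nx (j', v j') else w.
have vb j : bad j (v j).
  elim: j => [|j IH]; last by have [] := hnx (j, v j) IH.
  move=> [N hN]; apply: nN; exists N => n /hN.
  by rewrite /sc expn0 !divr1 subr0.
have vs j : cabs (v j.+1 - v j) <= l / (2 ^ j.+1)%:R by have [] := hnx (j, v j) (vb j).
have l0 : 0 <= l by rewrite addr_ge0 ?cabs_ge0.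
have vk j k : cabs (v (j + k)%N - v j) <= l / (2 ^ j)%:R - l / (2 ^ (j + k))%:R.
  elim: k => [|k IH]; first by rewrite addn0 !subrr cabs0.
  rewrite addnS; have := vs (j + k)%N.
  have := ler_cabs_trans (v (j + k).+1) (v (j + k)%N) (v j).
  have : l / (2 ^ (j + k))%:R = 2 * (l / (2 ^ (j + k).+1)%:R).
    by rewrite expnS natrM; field; rewrite gt_eqF.
  lra.
have vk' j k : cabs (v (j + k)%N - v j) <= l / (2 ^ j)%:R.
  by apply: le_trans (vk j k) _; rewrite gerBl divr_ge0.
have small_l (r : R) : 0 < r -> exists j, l / (2 ^ j)%:R <= r.
  move=> r0; exists (Num.truncn (l / r)).
  rewrite ler_pdivrMr // mulrC -ler_pdivrMr //.
  apply: le_trans (ltW (truncnS_gt _)) _; rewrite ler_nat; exact: ltn_expl.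
have [z hz] : exists z, ccvg v z.
  apply: ccvg_cauchy => r /small_l [j hj]; exists j => n jn.
  by rewrite -(subnKC jn); apply: le_trans (vk' _ _) hj.
have vz j : cabs (v j - z) <= l / (2 ^ j)%:R.
  apply/ler_addgt0Pr => r /hz [N hN].
  have := hN _ (leq_addl j N); have := vk' j N.
  have := ler_cabs_trans (v j) (v (j + N)%N) z; rewrite (cabsB (v j) (v (j + N)%N)); lra.
have [D hD] := df z.
(* At scale j the remainder is at most h times 2 sj on a contour of length 2 sj, so this [h] yields
   at most e / 4^j; [l] itself may vanish. *)
pose h := e / (4 * (l + 1) ^+ 2).
have l1 : 0 < l + 1 by lra.
have h0 : 0 < h by rewrite divr_gt0 // mulr_gt0 // exprn_gt0.
have [r r0 hr] := hD h h0.
have [j hj] := small_l (r / 4) (divr_gt0 r0 (ltr0n _ 4)).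
apply: (vb j); exists 0%N => n _.
set sj := l / (2 ^ j)%:R in hj *.
have sE : cabs (sc j a) + cabs (sc j b) = sj by rewrite !cabs_sc -mulrDl.
have sj0 : 0 <= sj by rewrite /sj divr_ge0.
have -> : f = fun y => (f z - D * z + D * y) + (f y - f z - D * (y - z)).
  by apply/funext => y; ring.
rewrite contourD contour_affine add0r.
apply: le_trans (@contour_bound _ _ _ _ _ (h * (2 * sj)) _) _.
  move=> y; rewrite sE => hy.
  have yz : cabs (y - z) <= 2 * sj.
    by have := ler_cabs_trans y (v j) z; have := vz j; rewrite -/sj; lra.
  have := hr (y - z); rewrite (addrC z) subrK => /(_ _)/le_trans; apply.
    by apply: le_lt_trans yz _; lra.
  by rewrite ler_wpM2l // ltW.
rewrite sE.
have -> : e / (4 ^ j)%:R = h * 4 * ((l + 1) / (2 ^ j)%:R) ^+ 2.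
  have -> : (4 ^ j)%:R = (2 ^ j)%:R ^+ 2 :> R by rewrite -natrX -expnM mulnC expnM.
  by rewrite /h; field; rewrite !gt_eqF.
have -> : 2 * sj * (h * (2 * sj)) = h * 4 * sj ^+ 2 by ring.
apply: ler_wpM2l; first by rewrite mulr_ge0 // ltW.
apply: lerXn2r; rewrite ?nnegrE // ?divr_ge0 // ?(ltW l1) //.
by rewrite ler_pM2r ?invr_gt0 // lerDl.
Qed.

Definition dyadic_mean f n w : C :=
  (2 ^ n)%:R^-1 * \sum_(0 <= k < 2 ^ n) f (w + k%:R / (2 ^ n)%:R).

(** In the parallelogram with sides 1 and [s], the two sides parallel to [s] cancel by periodicity;
    the other two are the dyadic means. *)
Lemma periodic_dyadic_mean f w s : cdiff f -> (forall z, f (z + 1) = f z) ->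
  ccvg (fun n => dyadic_mean f n w - dyadic_mean f n (w + s)) 0.
Proof.
move=> df pf; apply: ccvg_ext (@goursat f w 1 s df) => n.
rewrite /contour.
have -> : lsum f n (w + 1) s = lsum f n w s.
  by rewrite /lsum; congr (_ * _); apply: eq_bigr => k _; rewrite addrAC pf.
rewrite addrAC addrK /lsum /dyadic_mean !mul1r.
by congr (_ * _ - _ * _); apply: eq_bigr => k _; rewrite mulr1.
Qed.

End Goursat.

Lemma holomorphic_translate (K : numFieldType) (g : nat) (f : 'rV[K]_g -> K) c :
  holomorphic f -> holomorphic (fun v => f (v + c)).
Proof.
move=> hf v; apply: (@differentiable_comp K _ _ _ (fun v : 'rV[K]_g => v + c) f).
  apply: (@differentiableD K _ _ idfun (cst c)); last exact: differentiable_cst.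
  by apply: linear_differentiable => u; exact: cvg_id.
exact: hf.
Qed.

(** * Means of holomorphic functions over a torus *)

Section TorusMean.
Variables (R : realType) (g : nat) (nu : 'I_g -> 'rV[R[i]]_g).
Local Notation C := R[i].
Local Notation V := 'rV[C]_g.
Local Notation T := 'rV[R]_g.
Implicit Types (P : V -> C) (x v : V) (t s : T).

Definition torus_pt t : V := \sum_i (t 0 i)%:C *: nu i.
Definition pull P x t : C := P (x + torus_pt t).
Definition nu_periodic P := forall v i, P (v + nu i) = P v.

Lemma torus_ptD t s : torus_pt (t + s) = torus_pt t + torus_pt s.
Proof.
rewrite /torus_pt -big_split; apply: eq_bigr => i _.
by rewrite mxE rmorphD scalerDl.
Qed.

Lemma torus_pt0 : torus_pt 0 = 0.
Proof. by rewrite /torus_pt big1 // => i _; rewrite mxE scale0r. Qed.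

Lemma torus_pt_delta (c : R) i : torus_pt (c *: delta_mx 0 i) = c%:C *: nu i.
Proof.
rewrite /torus_pt (bigD1 i) //= big1 => [|j ji]; last first.
  by rewrite !mxE (negbTE ji) andbF mulr0 scale0r.
by rewrite !mxE !eqxx mulr1 addr0.
Qed.

Lemma pull_periodic P x : nu_periodic P -> invariant_by 1 (pull P x).
Proof.
by move=> hP t i; rewrite /pull torus_ptD torus_pt_delta scale1r addrA hP.
Qed.

Lemma gt0_Re (e : C) : 0 < e -> 0 < complex.Re e /\ (complex.Re e)%:C = e.
Proof.
move=> e0; have eR : (complex.Re e)%:C = e by rewrite RRe_real // gtr0_real.
by split=> //; rewrite -ltcR eR.
Qed.

Lemma pull_tcont P x : holomorphic P -> tcont (pull P x).
Proof.
move=> hP t e e0.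
have e0' : (0 : C) < e%:C by rewrite ltcR.
have [r /gt0_Re [r0 <-] hr] := holomorphic_continuous hP (x + torus_pt t) e0'.
set r' := complex.Re r in r0 hr *.
pose K := \sum_i cabs `|nu i| + 1.
have K0 : 0 < K by rewrite ltr_wpDl // sumr_ge0 // => i _; exact: cabs_ge0.
exists (r' / K); first by rewrite divr_gt0.
move=> s ss; rewrite /pull torus_ptD addrA le_cabs; apply: hr.
apply: (@le_lt_trans _ _ (\sum_i (r' / K * cabs `|nu i|)%:C)).
  apply: le_trans (ler_norm_sum _ _ _) _; apply: ler_sum => i _.
  rewrite normrZ rmorphM /= cabsE normr_id ler_wpM2r //.
  by rewrite -cabsE cabs_real lecR ltW.
rewrite -rmorph_sum ltcR -mulr_sumr -mulrAC -mulrA gtr_pMr //.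
by rewrite ltr_pdivrMr // mul1r /K ltrDl.
Qed.

Lemma line_cdiff P x v : holomorphic P -> cdiff (fun z => P (x + z *: v)).
Proof.
move=> hP z; have [D hD] := holomorphic_line hP (x + z *: v) v.
exists D => e e0; have e0' : (0 : C) < e%:C by rewrite ltcR.
have [r /gt0_Re [r0 rE] hr] := hD _ e0'; exists (complex.Re r) => // h hh.
rewrite le_cabs rmorphM /= cabsE scalerDl addrA; apply: hr.
by rewrite -rE -lt_cabs.
Qed.

Lemma mean_pull_holomorphic P N : holomorphic P ->
  holomorphic (fun v => mean N (pull P v) 0).
Proof.
move=> hP; apply: holomorphicZ.
apply: (@holomorphic_sum _ _ _ _ (fun k v => pull P v (0 + grid R k))) => k.
exact: holomorphic_translate.
Qed.

Lemma mean_pull_periodic P N : nu_periodic P -> nu_periodic (fun v => mean N (pull P v) 0).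
Proof.
move=> hP v i; rewrite /mean; congr (_ * _); apply: eq_bigr => k _.
by rewrite /pull addrAC hP.
Qed.

Lemma mean_pullDt P x N t : mean N (pull P x) t = mean N (pull P (x + torus_pt t)) 0.
Proof.
rewrite /mean; congr (_ * _); apply: eq_bigr => k _.
by rewrite /pull add0r torus_ptD addrA.
Qed.

(** With 2^n points per direction the mean is invariant under steps 1 / 2^n, so averaging it again
    along direction [j] changes nothing and produces a dyadic mean in one complex variable. *)
Lemma mean_dyadic P x n j M : nu_periodic P -> M.+1 = (2 ^ n)%N ->
  mean M (pull P x) 0 =
  (2 ^ n)%:R^-1 * \sum_(0 <= k < 2 ^ n) mean M (pull P x) ((k%:R / (2 ^ n)%:R) *: delta_mx 0 j).
Proof.
move=> hP ME.
rewrite (eq_bigr (fun=> mean M (pull P x) 0)) => [|k _].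
  by rewrite sumr_const_nat subn0 -[mean _ _ _ *+ _]mulr_natl mulKf // pow2_neq0.
have := invariant_latvec (mean_invariant M (pull_periodic x hP)) 0
   (fun i => if i == j then Posz k else 0).
move<-; congr mean; apply/rowP => i; rewrite !mxE add0r ME.
by rewrite eqxx /=; case: (i == j); rewrite ?mulr1 ?mulr0 // mulrC.
Qed.

(* The mean over a real translate of the torus does not change under a complex
   translation: one of the averages is computed by Goursat's theorem, the others
   being replaced by finite ones, uniformly. *)
Lemma mean_limit_shift P x j (s l l' : C) : holomorphic P -> nu_periodic P ->
  ccvg (fun N => mean N (pull P x) 0) l ->
  ccvg (fun N => mean N (pull P (x + s *: nu j)) 0) l' -> l = l'.
Proof.
move=> hP pP hl hl'; set x' := x + s *: nu j in hl' *.
apply/eqP; rewrite -subr_eq0; apply/eqP/eq_cabs0 => e e0.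
have e8 : 0 < e / 8 by lra.
have [N1 h1] := mean_cauchy (pull_tcont x hP) (pull_periodic x pP) e8.
have [N2 h2] := mean_cauchy (pull_tcont x' hP) (pull_periodic x' pP) e8.
pose M := maxn N1 N2.
have c1 N t : (M <= N)%N -> cabs (mean N (pull P x) t - mean M (pull P x) t) <= e / 4.
  rewrite geq_max => /andP[/h1 [_ /(_ t) a1] _]; have [_ /(_ t) a2] := h1 _ (leq_maxl N1 N2).
  have := ler_cabs_trans (mean N (pull P x) t) (mean N1 (pull P x) t) (mean M (pull P x) t).
  rewrite (cabsB (mean N1 _ _)) -/M in a2 *; lra.
have c2 N t : (M <= N)%N -> cabs (mean N (pull P x') t - mean M (pull P x') t) <= e / 4.
  rewrite geq_max => /andP[_ /h2 [_ /(_ t) a1]]; have [_ /(_ t) a2] := h2 _ (leq_maxr N1 N2).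
  have := ler_cabs_trans (mean N (pull P x') t) (mean N2 (pull P x') t) (mean M (pull P x') t).
  rewrite (cabsB (mean N2 _ _)) -/M in a2 *; lra.
(* The level [M] is frozen here: [Q] is holomorphic and periodic, so Goursat's theorem applies to it
   on the complex line in direction [nu j]. *)
pose Q v := mean M (pull P v) 0.
have hQ : holomorphic Q by exact: mean_pull_holomorphic.
have pQ : nu_periodic Q by exact: mean_pull_periodic.
have e4 : 0 < e / 16 by lra.
have [|n1 hn1] := @periodic_dyadic_mean R (fun z => Q (x + z *: nu j)) 0 s (line_cdiff x (nu j) hQ) _ _ e4.
  by move=> z; rewrite scalerDl scale1r addrA pQ.
have [N3 h3] := hl _ e4; have [N4 h4] := hl' _ e4.
pose n := maxn n1 (maxn M (maxn N3 N4)).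
have n2 := ltn_expl n (isT : (1 < 2)%N).
(* The grid of order [N] has [2 ^ n] points per direction. *)
pose N := (2 ^ n).-1; have NE : N.+1 = (2 ^ n)%N by rewrite /N prednK // expn_gt0.
have nN : (n <= N)%N by rewrite -ltnS NE.
have := hn1 n (leq_maxl _ _); rewrite subr0 => {}hn1.
have MN : (M <= N)%N by apply: leq_trans nN; exact: leq_trans (leq_maxl M _) (leq_maxr n1 _).
have N3N : (N3 <= N)%N.
  apply: leq_trans nN; apply: leq_trans (leq_maxl N3 N4) _.
  exact: leq_trans (leq_maxr M _) (leq_maxr n1 _).
have N4N : (N4 <= N)%N.
  apply: leq_trans nN; apply: leq_trans (leq_maxr N3 N4) _.
  exact: leq_trans (leq_maxr M _) (leq_maxr n1 _).
have dm y z0 : (forall t, cabs (mean N (pull P y) t - mean M (pull P y) t) <= e / 4) ->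
    y = x + z0 *: nu j ->
    cabs (mean N (pull P y) 0 - dyadic_mean (fun z => Q (x + z *: nu j)) n z0) <= e / 4.
  move=> hy yE; rewrite (mean_dyadic y j pP NE) /dyadic_mean -mulrBr -sumrB.
  rewrite cabsM cabsV cabs_nat.
  have p0 : 0 < (2 ^ n)%:R :> R by rewrite ltr0n expn_gt0.
  rewrite ler_pdivrMl //; apply: le_trans (ler_cabs_sum _ _ _) _.
  apply: le_trans (_ : \sum_(0 <= k < 2 ^ n) e / 4 <= _); last by rewrite sumr_const_nat subn0 mulr_natl.
  apply: ler_sum_nat => k _.
  have -> : Q (x + (z0 + k%:R / (2 ^ n)%:R) *: nu j) =
      mean M (pull P y) ((k%:R / (2 ^ n)%:R) *: delta_mx 0 j).
    rewrite mean_pullDt torus_pt_delta yE /Q scalerDl addrA.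
    by rewrite rmorphM fmorphV !rmorph_nat.
  exact: hy.
have d1 := dm x 0 (fun t => c1 N t MN); rewrite scale0r addr0 in d1.
have d2 := dm x' s (fun t => c2 N t MN) erefl.
have {}d1 := d1 erefl.
rewrite add0r in hn1.
have := h3 N N3N; have := h4 N N4N.
set a := mean N (pull P x) 0 in d1 *; set a' := mean N (pull P x') 0 in d2 *.
move: hn1 d1 d2; set b := dyadic_mean _ _ _; set b' := dyadic_mean _ _ _.
have := ler_cabs_trans l a l'; have := ler_cabs_trans a b l'.
have := ler_cabs_trans b b' l'; have := ler_cabs_trans b' a' l'.
rewrite (cabsB l a) (cabsB b' a'); move: a a' b b' => a a' b b'; clear -e0; lra.
Qed.

Hypothesis nu_span : forall v, exists z : 'I_g -> C, v = \sum_i z i *: nu i.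

(** Base point 0 and default value 0 are conventions; for holomorphic periodic [P] the limit exists
    and is the same at every base point. *)
Definition tmean P : C := xget 0 [set l : C | ccvg (fun N => mean N (pull P 0) 0) l].

(** The base point is moved from 0 by complex multiples of the periods, one direction at a time. *)
Lemma tmeanP P x : holomorphic P -> nu_periodic P ->
  ccvg (fun N => mean N (pull P x) 0) (tmean P).
Proof.
move=> hP pP.
have ex y : exists l, ccvg (fun N => mean N (pull P y) 0) l.
  by apply: mean_cvg; [exact: pull_tcont|exact: pull_periodic].
have t0 : ccvg (fun N => mean N (pull P 0) 0) (tmean P) := xgetPex 0 (ex 0).
have [z ->] := nu_span x.
suff gen : forall (r : seq 'I_g) y, ccvg (fun N => mean N (pull P y) 0) (tmean P) ->
    ccvg (fun N => mean N (pull P (y + \sum_(i <- r) z i *: nu i)) 0) (tmean P).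
  by rewrite -[\sum_i _]add0r; exact: gen.
elim => [|i r IH] y ty; first by rewrite big_nil addr0.
rewrite big_cons addrA; apply: IH.
have [l hl] := ex (y + z i *: nu i).
by rewrite (mean_limit_shift hP pP ty hl).
Qed.

Lemma tmean_unique P x l : holomorphic P -> nu_periodic P ->
  ccvg (fun N => mean N (pull P x) 0) l -> tmean P = l.
Proof. by move=> hP pP; apply: ccvg_unique; exact: tmeanP. Qed.

Lemma tmeanZ c P : holomorphic P -> nu_periodic P ->
  tmean (fun v => c * P v) = c * tmean P.
Proof.
move=> hP pP; apply: (@tmean_unique _ 0).
- exact: holomorphicZ.
- by move=> v i; rewrite pP.
apply: ccvg_ext (ccvgZ c (tmeanP 0 hP pP)) => N; by rewrite -meanZ.
Qed.

Lemma tmean_sum (I : Type) (r : seq I) (F : I -> V -> C) :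
  (forall i, holomorphic (F i)) -> (forall i, nu_periodic (F i)) ->
  tmean (fun v => \sum_(i <- r) F i v) = \sum_(i <- r) tmean (F i).
Proof.
move=> hF pF; apply: (@tmean_unique _ 0).
- exact: holomorphic_sum.
- by move=> v i; apply: eq_bigr => j _; rewrite pF.
apply: ccvg_ext (ccvg_sum r (fun i => tmeanP 0 (hF i) (pF i))) => N.
by rewrite -mean_sum.
Qed.

Lemma tmean_translate P x : holomorphic P -> nu_periodic P ->
  tmean (fun v => P (v + x)) = tmean P.
Proof.
move=> hP pP; apply: (@tmean_unique _ 0).
- exact: holomorphic_translate.
- by move=> v i; rewrite addrAC pP.
apply: ccvg_ext (tmeanP x hP pP) => N; congr mean; apply/funext => t.
by rewrite /pull add0r addrC.
Qed.

Lemma tmean_cst c : tmean (fun=> c) = c.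
Proof.
apply: (@tmean_unique _ 0) => [v||]; first exact: (@differentiable_cst C V C^o c v).
  by [].
apply: ccvg_ext (@ccvg_cst _ c) => N; by rewrite -[LHS](mean_const N c (0 : T)).
Qed.

(** Holomorphic extensions of the characters of the torus, to be instantiated by [chi]. *)
Variable X : {ffun 'I_g -> int} -> V -> C.
Hypothesis X_holo : forall n, holomorphic (X n).
Hypothesis X_torus : forall n x t, X n (x + torus_pt t) = X n x * echar n t.
Hypothesis X_neq0 : forall n x, X n x != 0.

(** Fourier uniqueness is applied on the real torus through each point [v]; division by the constant
    [X n v] turns the means into the coefficients of [pull P v]. *)
Lemma tmean_uniqueness P : holomorphic P -> nu_periodic P ->
  (forall n, tmean (fun v => X n v * P v) = 0) -> forall v, P v = 0.
Proof.
move=> hP pP h v.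
have := @fourier_uniqueness R g (pull P v) (pull_tcont v hP) (pull_periodic v pP).
rewrite {2}/pull torus_pt0 addr0; apply=> n.
have pX : nu_periodic (fun v => X n v * P v).
  move=> u i; rewrite pP; congr (_ * _).
  rewrite -[nu i]scale1r -(torus_pt_delta 1) X_torus.
  by rewrite -[1 *: _]add0r (echar_periodic n 0 i) /echar big1 ?mulr0 ?cexp0 ?mulr1 // => j _; rewrite mxE mulr0.
have := tmeanP v (holomorphicM (X_holo n) hP) pX; rewrite h => h0.
have := ccvgZ (X n v)^-1 h0; rewrite mulr0; apply: ccvg_ext => N.
rewrite -meanZ; congr mean; apply/funext => t.
by rewrite /pull X_torus !mulrA mulVf // mul1r.
Qed.

End TorusMean.

Lemma coord_le_norm (K : numFieldType) (g : nat) (v : 'rV[K]_g) j : `|v 0 j| <= `|v|.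
Proof.
apply/ler_addgt0Pr => e e0.
have : ball_ [eta Num.norm] (0 : 'rV[K]_g) (`|v| + e) v.
  by rewrite /ball_ /= sub0r normrN ltrDl.
rewrite -mx_norm_ball => -[_ /(_ 0 j)].
by rewrite -ball_normE /ball_ /= mxE sub0r normrN => /ltW.
Qed.

(** * Series of exponentials of linear forms and their torus means *)

Section ExponentialSums.
Variables (R : realType) (g : nat) (I : choiceType).
Local Notation C := R[i].
Local Notation V := 'rV[C]_g.

Definition tsum (a : I -> C) : C := xget 0 [set S : C | hassum a S].

Lemma tsumE a S : hassum a S -> tsum a = S.
Proof.
move=> h; apply: (hassum_unique (a := a)) => //.
exact: (@xgetPex _ 0 [set S : C | hassum a S] (ex_intro _ S h)).
Qed.

Lemma tsumP a b T : (forall i, cabs (a i) <= b i) -> sum_bounded b T -> hassum a (tsum a).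
Proof. by move=> h1 h2; have [S hS] := hassum_exists h1 h2; rewrite (tsumE hS). Qed.

Variables (p : I -> C) (m : I -> 'I_g -> C).
Definition l1norm (c : 'I_g -> C) : R := \sum_j cabs (c j).
(** Summability against every exponential weight: it controls the series on balls together with its
    termwise derivatives. *)
Hypothesis p_bound : forall M : R, 0 <= M ->
  exists T, sum_bounded (fun i => cabs (p i) * expR (M * l1norm (m i))) T.

Definition expsum (v : V) : C := tsum (fun i => p i * cexp (lin_form (m i) v)).

Lemma l1norm_ge0 c : 0 <= l1norm c.
Proof. by apply: sumr_ge0 => j _; exact: cabs_ge0. Qed.

Lemma lin_form_bound c (v : V) (r : R) : `|v| <= r%:C ->
  cabs (lin_form c v) <= l1norm c * r.
Proof.
move=> vr; apply: le_trans (ler_cabs_sum _ _ _) _; rewrite /l1norm mulr_suml.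
apply: ler_sum => j _; rewrite cabsM ler_wpM2l ?cabs_ge0 //.
by rewrite le_cabs; apply: le_trans vr; exact: coord_le_norm.
Qed.

Lemma lin_formD c (v w : V) : lin_form c (v + w) = lin_form c v + lin_form c w.
Proof. exact: (raddfD (lin_form c : {linear V -> C^o})). Qed.

Lemma expterm_bound i (v : V) (r : R) : `|v| <= r%:C ->
  cabs (p i * cexp (lin_form (m i) v)) <= cabs (p i) * expR (r * l1norm (m i)).
Proof.
move=> vr; rewrite cabsM ler_wpM2l ?cabs_ge0 // cabs_cexp ler_expR.
apply: le_trans (ler_norm _) _; apply: le_trans (ler_Re_cabs _) _.
by rewrite mulrC; exact: lin_form_bound.
Qed.

Lemma expsumP (v : V) : hassum (fun i => p i * cexp (lin_form (m i) v)) (expsum v).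
Proof.
have [T hT] := p_bound (cabs_ge0 `|v|).
apply: tsumP hT => i; apply: expterm_bound; by rewrite cabsE normr_id.
Qed.

Lemma expsum_holomorphic : holomorphic expsum.
Proof.
move=> x; pose rx := cabs `|x|.
have xr : `|x| <= rx%:C by rewrite cabsE normr_id.
have rx0 : 0 <= rx by exact: cabs_ge0.
(* Beyond [rx], one unit pays for the exponential in the Taylor bound and one for
   [t ^+ 2 <= 2 * expR t] at [t = l1norm (m i)]; the constants 4 and 2 give the 8 below. *)
have [|T hT] := @p_bound (rx + 2); first by rewrite addr_ge0.
have sq_exp (t : R) : 0 <= t -> t ^+ 2 <= 2 * expR t.
  by move=> t0; have := expR_ge1Dxn 1 t0; rewrite (_ : 2`! = 2)%N //; lra.
have t_exp (t : R) : t <= expR t by have := expR_ge1Dx t; lra.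
(* The candidate gradient, by termwise differentiation. *)
pose a j := tsum (fun i => p i * cexp (lin_form (m i) x) * m i j).
have ha j : hassum (fun i => p i * cexp (lin_form (m i) x) * m i j) (a j).
  apply: tsumP hT => i; rewrite cabsM.
  apply: le_trans (_ : cabs (p i) * expR (rx * l1norm (m i)) * expR (l1norm (m i)) <= _).
    apply: ler_pM; rewrite ?cabs_ge0 //; first exact: expterm_bound.
    apply: le_trans (t_exp _); rewrite /l1norm (bigD1 j) //= lerDl sumr_ge0 // => k _.
    exact: cabs_ge0.
  rewrite -mulrA -expRD ler_wpM2l ?cabs_ge0 // ler_expR.
  by have := l1norm_ge0 (m i); lra.
apply: (@differentiable_quadratic C g expsum x a (8 * T)%:C) => y y1.
pose ry := cabs `|y|; have ryE : ry%:C = `|y| by rewrite cabsE normr_id.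
have ry0 : 0 <= ry by exact: cabs_ge0.
have ry1 : ry < 1 by rewrite -ltcR ryE.
rewrite -ryE -rmorphXn -rmorphM -le_cabs.
have hy : hassum (fun i => p i * cexp (lin_form (m i) x) *
     (cexp (lin_form (m i) y) - 1 - lin_form (m i) y))
     (expsum (x + y) - expsum x - lin_form a y).
  have h1 := hassumD (hassumD (expsumP (x + y)) (hassumZ (-1) (expsumP x)))
     (hassumZ (-1) (hassum_sum (index_enum 'I_g) (fun j => hassumZ (y 0 j) (ha j)))).
  have -> : lin_form a y = \sum_j y 0 j * a j by apply: eq_bigr => j _; rewrite mulrC.
  rewrite !mulN1r in h1; apply: eq_hassum h1 => i.
  rewrite lin_formD cexpD /lin_form.
  have -> : \sum_j y 0 j * (p i * cexp (\sum_i0 m i i0 * x 0 i0) * m i j) =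
     p i * cexp (\sum_i0 m i i0 * x 0 i0) * \sum_j m i j * y 0 j.
    by rewrite mulr_sumr; apply: eq_bigr => j _; ring.
  ring.
apply: (hassum_bound hy).
rewrite mulrC mulrA -/(8 * T); apply: sum_bounded_le (sum_boundedZ _ hT) => [i|]; last first.
  by rewrite mulr_ge0 ?sqr_ge0.
rewrite cabsM.
set w := lin_form (m i) y; set n := l1norm (m i).
have n0 : 0 <= n by exact: l1norm_ge0.
have wn : cabs w <= n * ry by apply: lin_form_bound; rewrite ryE.
have w0 : 0 <= cabs w by exact: cabs_ge0.
have wn1 : cabs w <= n by apply: le_trans wn _; rewrite ler_piMr // ltW.
apply: le_trans (_ : cabs (p i) * expR (rx * n) * (4 * (n * ry) ^+ 2 * expR n) <= _).
  apply: ler_pM; rewrite ?cabs_ge0 //; first exact: expterm_bound.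
  apply: le_trans (cexp2_le _) _; apply: ler_pM; rewrite ?expR_ge0 //.
  - by rewrite mulr_ge0 // sqr_ge0.
  - by rewrite ler_wpM2l // lerXn2r // nnegrE mulr_ge0.
  - by rewrite ler_expR.
have -> : cabs (p i) * expR (rx * n) * (4 * (n * ry) ^+ 2 * expR n) =
  4 * ry ^+ 2 * cabs (p i) * (expR (rx * n) * expR n) * n ^+ 2 by ring.
have -> : (rx + 2) * n = rx * n + n + n by ring.
rewrite !expRD.
have -> : ry ^+ 2 * 8 * (cabs (p i) * (expR (rx * n) * expR n * expR n)) =
  4 * ry ^+ 2 * cabs (p i) * (expR (rx * n) * expR n) * (2 * expR n) by ring.
apply: ler_wpM2l; last exact: sq_exp.
by rewrite !mulr_ge0 ?sqr_ge0 ?cabs_ge0 ?expR_ge0.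
Qed.

End ExponentialSums.

(** One exponential is an exponential sum over a one-point index set. *)
Lemma expchar_holomorphic (R : realType) (g : nat) (c : 'I_g -> R[i]) :
  holomorphic (fun v : 'rV[R[i]]_g => cexp (lin_form c v)).
Proof.
have : holomorphic (expsum (fun _ : unit => 1) (fun=> c)).
  apply: expsum_holomorphic => M M0; exists (expR (M * l1norm c)).
  move=> [|[] [|[] s]] //= _; rewrite ?big_nil ?big_seq1 ?expR_ge0 //.
  by rewrite cabs1 mul1r.
congr holomorphic; apply/funext => v.
by apply: tsumE; rewrite -[X in hassum _ X]mul1r; apply: (@hassum_single _ _ _ tt) => -[].
Qed.

Section TorusMeanOfSum.
Variables (R : realType) (g : nat) (I : choiceType).
Local Notation C := R[i].
Local Notation V := 'rV[C]_g.
Variables (p : I -> C) (m : I -> 'I_g -> C).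
Hypothesis p_bound : forall M : R, 0 <= M ->
  exists T, sum_bounded (fun i => cabs (p i) * expR (M * l1norm (m i))) T.
Variables (nu : 'I_g -> V) (nu_span : forall v, exists z : 'I_g -> C, v = \sum_i z i *: nu i).
Hypothesis m_torus : forall i t, cabs (cexp (lin_form (m i) (torus_pt nu t))) = 1.
Hypothesis m_periodic : forall i j, cexp (lin_form (m i) (nu j)) = 1.

Lemma expsum_periodic : nu_periodic nu (expsum p m).
Proof.
move=> v j; rewrite /expsum; congr tsum; apply/funext => i.
by rewrite lin_formD cexpD m_periodic mulr1.
Qed.

(* Tannery's theorem lets the torus mean enter the sum. *)
Lemma tmean_expsum P : holomorphic P -> nu_periodic nu P ->
  hassum (fun i => p i * tmean nu (fun v => cexp (lin_form (m i) v) * P v))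
         (tmean nu (fun v => expsum p m v * P v)).
Proof.
move=> hP pP.
pose Q i v := cexp (lin_form (m i) v) * P v.
have hQ i : holomorphic (Q i) by apply: holomorphicM => //; exact: expchar_holomorphic.
have pQ i : nu_periodic nu (Q i).
  by move=> v j; rewrite /Q pP lin_formD cexpD m_periodic mulr1.
have [S S0 hS] := tcont_bounded (pull_tcont nu 0 hP) (pull_periodic 0 pP).
have [T hT] := p_bound (lexx (0 : R)).
have hT' : sum_bounded (fun i => S * (cabs (p i) * expR (0 * l1norm (m i)))) (S * T).
  by apply: sum_boundedZ => //; exact: ltW.
have Qb i t : cabs (pull nu (Q i) 0 t) <= S.
  by rewrite /pull add0r /Q cabsM m_torus mul1r; have := hS t; rewrite /pull add0r.
have mb i N : cabs (p i * mean N (pull nu (Q i) 0) 0) <= S * (cabs (p i) * expR (0 * l1norm (m i))).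
  rewrite mul0r expR0 mulr1 cabsM mulrC ler_wpM2r ?cabs_ge0 //.
  exact: mean_le_cst.
have tb i : cabs (p i * tmean nu (Q i)) <= S * (cabs (p i) * expR (0 * l1norm (m i))).
  have := ccvgZ (p i) (tmeanP nu_span 0 (hQ i) (pQ i)) => h.
  apply/ler_addgt0Pr => e /h [N /(_ N (leqnn _))]; have := mb i N.
  have := ler_cabs_trans (p i * tmean nu (Q i)) (p i * mean N (pull nu (Q i) 0) 0) 0.
  rewrite !subr0 (cabsB (p i * tmean _ _)); lra.
have hs0 := tsumP tb hT'.
rewrite (_ : tmean nu _ = tsum (fun i => p i * tmean nu (Q i))) //.
have hE := expsum_holomorphic p_bound; have pE := expsum_periodic.
apply: (tmean_unique nu_span (x := 0)).
- exact: holomorphicM.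
- by move=> v j; rewrite pE pP.
apply: (@tannery R I (fun N i => p i * mean N (pull nu (Q i) 0) 0) _ _ _ _ _ _ hT' _ _ hs0).
- by move=> N i; exact: mb.
- by move=> i; apply: ccvgZ; exact: tmeanP.
move=> N; rewrite /mean.
have := hassumZ (N.+1%:R ^+ g)^-1 (hassum_sum (index_enum {ffun 'I_g -> 'I_N.+1})
   (fun k => hassumZ (P (0 + torus_pt nu (0 + grid R k))) (expsumP p_bound (0 + torus_pt nu (0 + grid R k))))).
rewrite /pull (eq_bigr (fun k => expsum p m (0 + torus_pt nu (0 + grid R k)) * P (0 + torus_pt nu (0 + grid R k)))) => [|k _]; last by rewrite mulrC.
apply: eq_hassum => i.
rewrite mulrCA; congr (_ * _); rewrite mulr_sumr; apply: eq_bigr => k _.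
rewrite /Q; ring.
Qed.

End TorusMeanOfSum.

(** * The forms H and B in a symplectic basis *)

Section Forms.
Variables (R : realType) (g : nat).
Local Notation C := R[i].
Local Notation Ci := ('i%C : R[i]).
Local Notation V := 'rV[C]_g.
Variables (Lambda : set V) (H : {dot V for Num.conj}) (lam mu : 'I_g -> V) (B : {biscalar V}).
Hypothesis symp : symplectic_basis Lambda H lam mu.
Hypothesis Bext : bilinear_extension H mu B.
Implicit Types (x y v w : V) (t s : 'I_g -> R) (a z : C).

Definition realcomb (b : 'I_g -> V) t : V := \sum_i (t i)%:C *: b i.
Definition Sform v w : C := H v w - B v w.

Lemma HZl a v w : H (a *: v) w = a * H v w. Proof. exact: linearZl_LR. Qed.
Lemma HZr a v w : H v (a *: w) = conjc a * H v w. Proof. exact: linearZr_LR. Qed.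
Lemma HDl v v' w : H (v + v') w = H v w + H v' w. Proof. exact: linearDl. Qed.
Lemma HDr v w w' : H v (w + w') = H v w + H v w'. Proof. exact: linearDr. Qed.
Lemma BZl a v w : B (a *: v) w = a * B v w. Proof. exact: linearZl_LR. Qed.
Lemma BZr a v w : B v (a *: w) = a * B v w. Proof. exact: linearZr_LR. Qed.
Lemma BDl v v' w : B (v + v') w = B v w + B v' w. Proof. exact: linearDl. Qed.
Lemma BDr v w w' : B v (w + w') = B v w + B v w'. Proof. exact: linearDr. Qed.
Lemma H_suml (I : Type) (r : seq I) (F : I -> V) w :
  H (\sum_(i <- r) F i) w = \sum_(i <- r) H (F i) w. Proof. exact: linear_sumlz. Qed.
Lemma H_sumr (I : Type) (r : seq I) (F : I -> V) w :
  H w (\sum_(i <- r) F i) = \sum_(i <- r) H w (F i). Proof. exact: linear_sumr. Qed.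
Lemma B_suml (I : Type) (r : seq I) (F : I -> V) w :
  B (\sum_(i <- r) F i) w = \sum_(i <- r) B (F i) w. Proof. exact: linear_sumlz. Qed.
Lemma B_sumr (I : Type) (r : seq I) (F : I -> V) w :
  B w (\sum_(i <- r) F i) = \sum_(i <- r) B w (F i). Proof. exact: linear_sumr. Qed.

Lemma conjRC (r : R) : conjc (r%:C) = r%:C :> C.
Proof. exact: conjc_real. Qed.

Lemma H_herm v w : H v w = conjc (H w v).
Proof. by rewrite (hermC H v w) expr0 mul1r. Qed.

Lemma ImC_conj (z : C) : complex.Im (conjc z) = - complex.Im z. Proof. by case: z. Qed.
Lemma Im0_real (z : C) : complex.Im z = 0 -> z = (complex.Re z)%:C.
Proof. by case: z => a b /= ->. Qed.

Lemma imform_anti v w : imform H v w = - imform H w v.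
Proof. by rewrite /imform H_herm ImC_conj. Qed.

Lemma realcombD b t s : realcomb b (fun i => t i + s i) = realcomb b t + realcomb b s.
Proof.
by rewrite /realcomb -big_split; apply: eq_bigr => i _; rewrite rmorphD scalerDl.
Qed.

Lemma realcombZ b t (c : R) : realcomb b (fun i => c * t i) = c%:C *: realcomb b t.
Proof.
by rewrite /realcomb scaler_sumr; apply: eq_bigr => i _; rewrite rmorphM scalerA.
Qed.

Lemma Im_realM (r : R) z : complex.Im (r%:C * z) = r * complex.Im z.
Proof. by case: z => x y /=; rewrite mul0r addr0. Qed.

Lemma imform_combl b t w : imform H (realcomb b t) w = \sum_i t i * imform H (b i) w.
Proof.
rewrite /imform /realcomb H_suml (raddf_sum (@complex.Im R)); apply: eq_bigr => i _.
by rewrite HZl; exact: Im_realM.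
Qed.

Lemma imform_combr b t w : imform H w (realcomb b t) = \sum_i t i * imform H w (b i).
Proof.
rewrite imform_anti imform_combl -sumrN; apply: eq_bigr => i _.
by rewrite [in RHS]imform_anti mulrN.
Qed.

Lemma imform_mumu t s : imform H (realcomb mu t) (realcomb mu s) = 0.
Proof.
have [_ _ _ h] := symp; rewrite imform_combl big1 // => i _.
by rewrite imform_combr big1 ?mulr0 // => j _; rewrite h mulr0.
Qed.

Lemma imform_lamlam t s : imform H (realcomb lam t) (realcomb lam s) = 0.
Proof.
have [_ _ h _] := symp; rewrite imform_combl big1 // => i _.
by rewrite imform_combr big1 ?mulr0 // => j _; rewrite h mulr0.
Qed.

Lemma imform_lam_mu t j : imform H (realcomb lam t) (mu j) = t j.
Proof.
have [_ h _ _] := symp; rewrite imform_combl (bigD1 j) //= h eqxx mulr1 big1 ?addr0 // => i ij.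
by rewrite h (negbTE ij) mulr0.
Qed.

Lemma realcomb_delta b i : realcomb b (fun j => (j == i)%:R) = b i.
Proof.
rewrite /realcomb (bigD1 i) //= eqxx scale1r big1 ?addr0 // => j ji.
by rewrite (negbTE ji) scale0r.
Qed.

Lemma comb_mu_real t s : H (realcomb mu t) (realcomb mu s) =
  (complex.Re (H (realcomb mu t) (realcomb mu s)))%:C.
Proof. apply: Im0_real; exact: imform_mumu. Qed.

Lemma comb_mu_sym t s : H (realcomb mu t) (realcomb mu s) = H (realcomb mu s) (realcomb mu t).
Proof. by rewrite H_herm comb_mu_real conjRC -comb_mu_real. Qed.

Lemma B_mu t s : B (realcomb mu t) (realcomb mu s) = H (realcomb mu t) (realcomb mu s).
Proof. by apply: Bext; [exists t|exists s]. Qed.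

Lemma i_conj : conjc Ci = - Ci.
Proof. by apply/eqP; rewrite eq_complex /= oppr0 !eqxx. Qed.

Lemma H_ipair x y x' y' : H (x + Ci *: y) (x' + Ci *: y') =
  H x x' + H y y' + Ci * (H y x' - H x y').
Proof.
rewrite HDl !HDr !HZl !HZr i_conj.
have -> : Ci * (- Ci * H y y') = - (Ci * Ci) * H y y' by ring.
rewrite -expr2 sqr_i; ring.
Qed.

Lemma B_ipair x y x' y' : B (x + Ci *: y) (x' + Ci *: y') =
  B x x' - B y y' + Ci * (B y x' + B x y').
Proof.
rewrite BDl !BDr !BZl !BZr.
have -> : Ci * (Ci * B y y') = (Ci * Ci) * B y y' by ring.
rewrite -expr2 sqr_i; ring.
Qed.

Lemma dot_ge0 v : 0 <= complex.Re (H v v).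
Proof. by have := dnorm_ge0 H v; rewrite lecE /= => /andP[]. Qed.

Lemma dot_real v : H v v = (complex.Re (H v v))%:C.
Proof. by apply: Im0_real; have := dnorm_ge0 H v; rewrite lecE /= => /andP[/eqP]. Qed.

Lemma dot_eq0 v : complex.Re (H v v) = 0 -> v = 0.
Proof. by move=> h; apply/eqP; rewrite -(dnorm_eq0 H) dot_real h. Qed.

(** H is real and symmetric on V_2, so H(x + iy, x + iy) = H(x, x) + H(y, y) for x, y in V_2, and
    positivity separates V_2 from i V_2. *)
Lemma mu_free t s : realcomb mu t + Ci *: realcomb mu s = 0 -> realcomb mu t = 0 /\ realcomb mu s = 0.
Proof.
move=> h; have := H_ipair (realcomb mu t) (realcomb mu s) (realcomb mu t) (realcomb mu s).
rewrite h comb_mu_sym subrr mulr0 addr0 (linear0l H).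
rewrite [H (realcomb mu t) _]dot_real [H (realcomb mu s) _]dot_real -rmorphD => /esym [h1].
have := dot_ge0 (realcomb mu t); have := dot_ge0 (realcomb mu s) => h2 h3.
by split; apply: dot_eq0; lra.
Qed.

Lemma realcomb_mu_eq0 t : realcomb mu t = 0 -> forall i, t i = 0.
Proof.
move=> h i; have := imform_combr mu t (lam i); rewrite h /imform (linear0r H) /=.
have [_ hl _ _] := symp; move=> /esym; rewrite (bigD1 i) //= big1 => [|j ji].
  by rewrite -/(imform _ _ _) hl eqxx mulr1 addr0.
by rewrite -/(imform _ _ _) hl eq_sym (negbTE ji) mulr0.
Qed.

Lemma complex_comb b (z : 'I_g -> C) : \sum_i z i *: b i =
  realcomb b (fun i => complex.Re (z i)) + Ci *: realcomb b (fun i => complex.Im (z i)).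
Proof.
rewrite /realcomb scaler_sumr -big_split; apply: eq_bigr => i _ /=.
by rewrite scalerA -scalerDl -complexE.
Qed.

Lemma mu_span v : exists z : 'I_g -> C, v = \sum_i z i *: mu i.
Proof.
pose M : 'M[C]_g := \matrix_(i < g) mu i.
have Mu (u : 'rV_g) : u *m M = \sum_i u 0 i *: mu i.
  by rewrite mulmx_sum_row; apply: eq_bigr => i _; rewrite rowK.
have fM : row_free M.
  apply: inj_row_free => u; rewrite Mu complex_comb => /mu_free [h1 h2].
  apply/rowP => i; rewrite mxE; apply/eqP; rewrite eq_complex /=.
  by rewrite (realcomb_mu_eq0 h1) (realcomb_mu_eq0 h2) eqxx.
have uM : M \in unitmx by rewrite -row_free_unit.
exists (fun i => (v *m invmx M) 0 i).
by rewrite -Mu mulmxKV.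
Qed.

Lemma mu_split v : exists t s, v = realcomb mu t + Ci *: realcomb mu s.
Proof.
have [z ->] := mu_span v; rewrite complex_comb.
by exists (fun i => complex.Re (z i)), (fun i => complex.Im (z i)).
Qed.

Lemma B_sym v w : B v w = B w v.
Proof.
have [t [s ->]] := mu_split v; have [t' [s' ->]] := mu_split w.
rewrite !B_ipair !B_mu (comb_mu_sym t' t) (comb_mu_sym s' s) (comb_mu_sym s' t) (comb_mu_sym t' s).
by congr (_ + _ * _); rewrite addrC.
Qed.

Lemma SDl v v' w : Sform (v + v') w = Sform v w + Sform v' w.
Proof. by rewrite /Sform HDl BDl; ring. Qed.
Lemma SDr v w w' : Sform v (w + w') = Sform v w + Sform v w'.
Proof. by rewrite /Sform HDr BDr; ring. Qed.
Lemma SZl a v w : Sform (a *: v) w = a * Sform v w.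
Proof. by rewrite /Sform HZl BZl; ring. Qed.
Lemma SZr (r : R) v w : Sform v (r%:C *: w) = r%:C * Sform v w.
Proof. by rewrite /Sform HZr BZr conjRC; ring. Qed.
Lemma S0l w : Sform 0 w = 0. Proof. by rewrite -(scale0r 0) SZl mul0r. Qed.
Lemma S0r v : Sform v 0 = 0. Proof. by rewrite -(scale0r 0) SZr mul0r. Qed.
Lemma SNr v w : Sform v (- w) = - Sform v w.
Proof. by rewrite -scaleN1r -(rmorphN1 (real_complex R)) SZr rmorphN1 mulN1r. Qed.
Lemma SNl v w : Sform (- v) w = - Sform v w.
Proof. by rewrite -scaleN1r SZl mulN1r. Qed.
Lemma S_suml (I : Type) (r : seq I) (F : I -> V) w :
  Sform (\sum_(i <- r) F i) w = \sum_(i <- r) Sform (F i) w.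
Proof. by rewrite /Sform H_suml B_suml -sumrB. Qed.
Lemma S_combr b t v : Sform v (realcomb b t) = \sum_i (t i)%:C * Sform v (b i).
Proof.
rewrite /Sform /realcomb H_sumr B_sumr -sumrB; apply: eq_bigr => i _.
exact: SZr.
Qed.

(** H and B agree on V_2 x V_2, both are C-linear in the first variable, and V_2 spans C^g over
    C. *)
Lemma S_mur v s : Sform v (realcomb mu s) = 0.
Proof.
have [z ->] := mu_span v; rewrite S_suml big1 // => i _; rewrite SZl.
by rewrite -(realcomb_delta mu i) /Sform B_mu subrr mulr0.
Qed.

(** With first argument in V_2, H and B agree on V_2 and are opposite on i V_2; thus S retains only
    the i V_2 component of [v], and so does E. *)
Lemma S_mul s v : Sform (realcomb mu s) v = 2 * Ci * (imform H (realcomb mu s) v)%:C.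
Proof.
have [t [t' ->]] := mu_split v.
rewrite /Sform /imform HDr HZr i_conj BDr BZr !B_mu.
rewrite comb_mu_real (comb_mu_real s t').
set a := complex.Re _; set b := complex.Re _.
have -> : complex.Im (a%:C + - Ci * b%:C) = - b by rewrite /=; ring.
by rewrite rmorphN; ring.
Qed.

Lemma S_mu_lam j i : Sform (mu j) (lam i) = - (2 * Ci * (i == j)%:R).
Proof.
have [_ h _ _] := symp.
rewrite -(realcomb_delta mu j) S_mul realcomb_delta imform_anti h.
by rewrite rmorphN rmorph_nat; ring.
Qed.

Lemma S_lam_sym t s : Sform (realcomb lam t) (realcomb lam s) =
  Sform (realcomb lam s) (realcomb lam t).
Proof.
rewrite /Sform B_sym; congr (_ - _); rewrite H_herm.
have := imform_lamlam s t; rewrite /imform => /Im0_real ->.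
by rewrite conjRC.
Qed.

(** For x = a + iy in V_1 with a, y in V_2, Re S(x, x) = 2 H(y, y), and the coordinates of x are
    E(x, mu_i) = H(y, mu_i), which Cauchy-Schwarz bounds in terms of H(y, y). The convergence of all
    theta series rests on this. *)
Lemma S_lam_coercive : exists2 c : R, 0 < c & forall t,
  c * (\sum_i t i ^+ 2) <= complex.Re (Sform (realcomb lam t) (realcomb lam t)).
Proof.
pose K : R := \sum_i complex.Re (H (mu i) (mu i)) + 1.
have K0 : 0 < K by rewrite ltr_wpDl // sumr_ge0 // => i _; exact: dot_ge0.
exists (2 / K); first by rewrite divr_gt0.
move=> t; have [x [y E]] := mu_split (realcomb lam t).
have -> : complex.Re (Sform (realcomb lam t) (realcomb lam t)) =
   2 * complex.Re (H (realcomb mu y) (realcomb mu y)).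
  rewrite /Sform E H_ipair B_ipair !B_mu (comb_mu_sym y x) subrr mulr0 addr0.
  rewrite (dot_real (realcomb mu x)) (dot_real (realcomb mu y)) (comb_mu_real x y) /=; ring.
set q := complex.Re (H (realcomb mu y) _).
have q0 : 0 <= q by exact: dot_ge0.
have ti i : t i ^+ 2 <= q * complex.Re (H (mu i) (mu i)).
  have -> : t i = complex.Re (H (realcomb mu y) (mu i)).
    rewrite -(imform_lam_mu t i) E -{1}(realcomb_delta mu i) /imform HDl HZl.
    rewrite (comb_mu_real x) (comb_mu_real y) realcomb_delta /=; ring.
  have [h _] := CauchySchwarz H (realcomb mu y) (mu i).
  move: h; rewrite -(realcomb_delta mu i) (comb_mu_real y) realcomb_delta.
  rewrite (dot_real (realcomb mu y)) (dot_real (mu i)) -rmorphM.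
  rewrite -cabsE cabs_real -rmorphXn lecR real_normK ?num_real //.
have : \sum_i t i ^+ 2 <= q * K.
  apply: le_trans (ler_sum _ (fun i _ => ti i)) _.
  by rewrite -mulr_sumr ler_wpM2l // lerDl.
by rewrite mulrAC ler_pdivrMr // -mulrA ler_pM2l.
Qed.

End Forms.

(** * Classical theta functions and their Fourier coefficients *)

Section Theta.
Variables (R : realType) (g : nat).
Local Notation C := R[i].
Local Notation V := 'rV[C]_g.
Local Notation I := {ffun 'I_g -> int}.
Local Notation Ci := ('i%C : R[i]).
Variables (Lambda : set V) (H : {dot V for Num.conj}) (lam mu : 'I_g -> V) (B : {biscalar V}).
Variable d : 'I_g -> nat.
Hypothesis symp : symplectic_basis Lambda H lam mu.
Hypothesis Bext : bilinear_extension H mu B.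
Hypothesis d_gt0 : forall i, (0 < d i)%N.
Implicit Types (v w x : V) (n m u l : I) (F : V -> C).
Local Notation S := (Sform H B).

(* An integer vector [n] stands for the point [Kt n] of the preimage of K_1;
   [lat l] is the vector of the lattice point [Lam l]. *)
Definition Kt n : V := realcomb lam (fun i => (n i)%:~R / (d i)%:R).
Definition Lam l : V := realcomb lam (fun i => (l i)%:~R).
Definition lat l : I := [ffun i => (d i)%:Z * l i].
Definition nu i : V := (d i)%:R *: mu i.
Definition coef n j : C := - (piC R * S (delta_mx 0 j) (Kt n)).
(** The holomorphic extension of [echar n] to C^g, written with a linear form so that theta series
    are instances of [expsum]. *)
Definition chi n v : C := cexp (lin_form (coef n) v).
(** The dependence on [n], within a class modulo k Lambda_1, that quasi-periodicity of order k
    forces on Fourier coefficients. *)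
Definition gauss k n : C := cexp (- (piC R / (2 * k)%:R * S (Kt n) (Kt n))).
Definition theta k u : V -> C :=
  expsum (fun l => gauss k (u + lat l *+ k)) (fun l => coef (u + lat l *+ k)).
(** The inverse character replaces the complex conjugate, so the averaged function stays
    holomorphic. *)
Definition fc F n : C := tmean nu (fun v => chi (- n) v * F v).
(* The functions exp(- k pi B(v, v) / 2) f(v) for the sections f of L^k. *)
Definition quasi k F := [/\ holomorphic F, nu_periodic nu F &
  forall l v, F (v + Lam l) = cexp (piC R * S v (Lam l) + piC R / 2 * S (Lam l) (Lam l)) ^+ k * F v].

Lemma dR_neq0 i : (d i)%:R != 0 :> R.
Proof. by rewrite pnatr_eq0 -lt0n. Qed.
Lemma dC_neq0 i : (d i)%:R != 0 :> C.
Proof. by rewrite pnatr_eq0 -lt0n. Qed.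

Lemma KtD n m : Kt (n + m) = Kt n + Kt m.
Proof.
rewrite /Kt -realcombD; congr realcomb; apply/funext => i.
by rewrite ffunE rmorphD mulrDl.
Qed.

Lemma Kt0 : Kt 0 = 0.
Proof.
by rewrite /Kt /realcomb big1 // => i _; rewrite ffunE mul0r scale0r.
Qed.

Lemma KtN n : Kt (- n) = - Kt n.
Proof. by apply/eqP; rewrite -addr_eq0 -KtD addNr Kt0. Qed.

Lemma KtMn n k : Kt (n *+ k) = k%:R *: Kt n.
Proof.
elim: k => [|k IH]; first by rewrite mulr0n Kt0 scale0r.
by rewrite mulrSr KtD IH -natr1 scalerDl scale1r.
Qed.

Lemma Kt_lat l : Kt (lat l) = Lam l.
Proof.
rewrite /Kt /Lam; congr realcomb; apply/funext => i.
by rewrite ffunE intrM -pmulrn mulrAC divff ?mul1r // dR_neq0.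
Qed.

Lemma latD l l' : lat (l + l') = lat l + lat l'.
Proof. by apply/ffunP => i; rewrite !ffunE mulrDr. Qed.
Lemma latN l : lat (- l) = - lat l.
Proof. by apply/ffunP => i; rewrite !ffunE mulrN. Qed.
Lemma lat_inj : injective lat.
Proof.
move=> l l' /ffunP e; apply/ffunP => i; have := e i; rewrite !ffunE.
by apply: mulfI; have := d_gt0 i; case: (d i).
Qed.

Lemma lin_coef n v : lin_form (coef n) v = - (piC R * S v (Kt n)).
Proof.
rewrite {2}(row_sum_delta v) S_suml /lin_form mulr_sumr -sumrN.
by apply: eq_bigr => j _; rewrite /coef SZl; ring.
Qed.

Lemma chiE n v : chi n v = cexp (- (piC R * S v (Kt n))).
Proof. by rewrite /chi lin_coef. Qed.

Lemma chiD n m v : chi (n + m) v = chi n v * chi m v.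
Proof. by rewrite !chiE -cexpD KtD SDr; congr cexp; ring. Qed.

Lemma chiDv n v w : chi n (v + w) = chi n v * chi n w.
Proof. by rewrite !chiE -cexpD SDl; congr cexp; ring. Qed.

Lemma chi0 v : chi 0 v = 1.
Proof. by rewrite chiE Kt0 S0r mulr0 oppr0 cexp0. Qed.

Lemma chi0v n : chi n 0 = 1.
Proof. by rewrite chiE S0l mulr0 oppr0 cexp0. Qed.

Lemma chiN n v : chi (- n) v = (chi n v)^-1.
Proof.
have h : chi n v != 0 by exact: cexp_neq0.
by apply: (mulIf h); rewrite mulVf // -chiD addNr chi0.
Qed.

Lemma chi_neq0 n v : chi n v != 0. Proof. exact: cexp_neq0. Qed.

(** The factor d_j of [nu j] cancels the denominator in [Kt n]: this is why K_1 provides the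
    characters that are periodic for the d_j mu_j. *)
Lemma S_nu_Kt n j : S (nu j) (Kt n) = - (2 * Ci * (n j)%:~R).
Proof.
rewrite /nu SZl /Kt S_combr (bigD1 j) //= big1 => [|i ij]; last first.
  by rewrite (S_mu_lam symp Bext) (negbTE ij) mulr0 oppr0 mulr0.
rewrite (S_mu_lam symp Bext) eqxx addr0 mulr1 fmorph_div rmorph_int rmorph_nat.
by have := dC_neq0 j => h; field.
Qed.

Lemma chi_torus_pt n t : chi n (torus_pt nu t) = echar n t.
Proof.
rewrite chiE /torus_pt S_suml /echar mulr_sumr -sumrN rmorph_sum mulr_sumr.
congr cexp; apply: eq_bigr => i _.
rewrite SZl S_nu_Kt rmorphM rmorph_int -complexiE; ring.
Qed.

Lemma chi_torus n x t : chi n (x + torus_pt nu t) = chi n x * echar n t.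
Proof. by rewrite chiDv chi_torus_pt. Qed.

Lemma chi_nu n j : chi n (nu j) = 1.
Proof.
rewrite chiE S_nu_Kt (_ : - _ = 2 * piC R * 'i * (n j)%:~R) ?cexp_2piMint //.
by rewrite -complexiE; ring.
Qed.

Lemma cabs_chi_torus n t : cabs (chi n (torus_pt nu t)) = 1.
Proof. by rewrite chi_torus_pt cabs_echar. Qed.

Lemma chi_holomorphic n : holomorphic (chi n).
Proof. exact: expchar_holomorphic. Qed.

Lemma chi_periodic n : nu_periodic nu (chi n).
Proof. by move=> v j; rewrite chiDv chi_nu mulr1. Qed.

Lemma nu_span v : exists z : 'I_g -> C, v = \sum_i z i *: nu i.
Proof.
have [z ->] := mu_span symp v; exists (fun i => z i / (d i)%:R).
by apply: eq_bigr => i _; rewrite scalerA divfK // dC_neq0.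
Qed.

(** If n_j is nonzero, translation by 1 / (2 n_j) along [nu j] multiplies [chi n] by -1 and yet
    preserves its mean. *)
Lemma tmean_chi n : tmean nu (chi n) = (n == 0)%:R.
Proof.
case: eqP => [->|/eqP n0].
  by rewrite -(tmean_cst nu_span 1); congr tmean; apply/funext => v; rewrite chi0.
have [j nj] : exists j, n j != 0.
  apply: contrapT => h; move/eqP: n0; apply; apply/ffunP => j; rewrite ffunE.
  by apply/eqP/negPn/negP => nj; apply: h; exists j.
have nR : (n j)%:~R != 0 :> R by rewrite intr_eq0.
pose t : 'rV[R]_g := (2 * (n j)%:~R)^-1 *: delta_mx 0 j.
have e : chi n (torus_pt nu t) = -1.
  rewrite chi_torus_pt /echar (bigD1 j) //= big1 => [|i ij]; last first.
    by rewrite !mxE (negbTE ij) andbF !mulr0.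
  rewrite !mxE !eqxx mulr1 addr0 invfM mulrCA mulfV // mulr1 /piC /cexp.
  have -> : 2 * (pi : R)%:C * 'i%R * (2^-1 : R)%:C = 0 +i* pi.
    by rewrite -complexiE -(rmorph_nat (real_complex R)); simpc; congr (_ +i* _); field.
  by rewrite /= expR0 cospi sinpi !mulr0 !mul1r; apply/eqP; rewrite eq_complex /= oppr0 !eqxx.
have := tmean_translate nu_span (torus_pt nu t) (@chi_holomorphic n) (@chi_periodic n).
rewrite (_ : (fun v => _) = fun v => -1 * chi n v); last first.
  by apply/funext => v; rewrite chiDv e mulrC.
rewrite (tmeanZ nu_span _ (@chi_holomorphic n) (@chi_periodic n)) mulN1r => h.
by apply/eqP; rewrite -eqNr; apply/eqP.
Qed.

Lemma piC_real : piC R = (pi : R)%:C. Proof. by []. Qed.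

Lemma S_Kt_sym n m : S (Kt n) (Kt m) = S (Kt m) (Kt n).
Proof. exact: (S_lam_sym symp Bext). Qed.

Lemma gauss_neq0 k n : gauss k n != 0. Proof. exact: cexp_neq0. Qed.

(** Expansion of the quadratic form at Kt n + k Lam l, with S symmetric on V_1. *)
Lemma gauss_shift k n l : (0 < k)%N -> gauss k (n + lat l *+ k) =
  gauss k n * chi n (Lam l) * cexp (- (piC R / 2 * S (Lam l) (Lam l))) ^+ k.
Proof.
move=> k0; have kC : k%:R != 0 :> C by rewrite pnatr_eq0 -lt0n.
rewrite chiE -cexpMn -!cexpD /gauss KtD KtMn -Kt_lat.
have Sk w w' : S (k%:R *: w) w' = k%:R * S w w' by rewrite SZl.
have Sk' w w' : S w (k%:R *: w') = k%:R * S w w'.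
  by rewrite -(rmorph_nat (real_complex R)) SZr.
rewrite !SDl !SDr !Sk !Sk' (S_Kt_sym n (lat l)) natrM -mulr_natr.
by congr cexp; field.
Qed.

(** Coercivity gives Gaussian decay in the coordinates of the index, while the exponent of the
    weight is linear in them. Completing the square leaves e^(-|l_i|) in each coordinate, which is
    summable over Z^g. *)
Lemma theta_bound k u : (0 < k)%N -> forall M : R, 0 <= M -> exists T,
  sum_bounded (fun l => cabs (gauss k (u + lat l *+ k)) *
                        expR (M * l1norm (coef (u + lat l *+ k)))) T.
Proof.
move=> k0 M M0.
have [c c0 hc] := S_lam_coercive symp Bext.
have kR : 0 < k%:R :> R by rewrite ltr0n.
pose t n i : R := (n i)%:~R / (d i)%:R.
pose c' : R := pi / (2 * k)%:R * c.
have c'0 : 0 < c' by rewrite mulr_gt0 // divr_gt0 ?pi_gt0 // ltr0n muln_gt0.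
have gb n : cabs (gauss k n) <= expR (- c' * \sum_i t n i ^+ 2).
  have ReN (z : C) : complex.Re (- z) = - complex.Re z by case: z.
  have piE : piC R / (2 * k)%:R = (pi / (2 * k)%:R)%:C by rewrite fmorph_div rmorph_nat.
  rewrite /gauss cabs_cexp ler_expR piE ReN mulNr lerN2.
  have -> : complex.Re ((pi / (2 * k)%:R : R)%:C * S (Kt n) (Kt n)) =
     pi / (2 * k)%:R * complex.Re (S (Kt n) (Kt n)).
    by case: (S (Kt n) (Kt n)) => a b /=; rewrite mul0r subr0.
  rewrite /c' -[leLHS]mulrA ler_wpM2l ?hc //.
  by rewrite divr_ge0 ?pi_ge0.
pose A : R := \sum_(j < g) \sum_(i < g) pi * cabs (S (delta_mx 0 j) (lam i)).
have A0 : 0 <= A.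
  by apply: sumr_ge0 => j _; apply: sumr_ge0 => i _; rewrite mulr_ge0 ?pi_ge0 ?cabs_ge0.
have lb n : l1norm (coef n) <= A * \sum_i `|t n i|.
  rewrite /l1norm /A mulr_suml; apply: ler_sum => j _.
  rewrite /coef cabsN cabsM piC_real cabs_real ger0_norm ?pi_ge0 // /Kt S_combr.
  apply: le_trans (ler_wpM2l (pi_ge0 R) (ler_cabs_sum _ _ _)) _.
  rewrite mulr_sumr mulr_suml; apply: ler_sum => i _.
  rewrite cabsM cabs_real -/(t n i) mulrCA [leRHS]mulrC ler_wpM2r ?mulr_ge0 ?pi_ge0 ?cabs_ge0 //.
  by rewrite (bigD1 i) //= lerDl sumr_ge0.
(* The maximum of -c' y^2 + (M A + 1) y; the added 1 leaves a factor e^(-y) to spare. *)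
pose E : R := (M * A + 1) ^+ 2 / (4 * c').
have quad (x : R) : - c' * x ^+ 2 + M * A * `|x| <= E - `|x|.
  rewrite -(real_normK (num_real x)); set y := `|x|.
  rewrite /E -subr_ge0.
  have -> : (M * A + 1) ^+ 2 / (4 * c') - y - (- c' * y ^+ 2 + M * A * y) =
    c' * (y - (M * A + 1) / (2 * c')) ^+ 2 by field; rewrite gt_eqF.
  by rewrite mulr_ge0 ?sqr_ge0 // ltW.
pose D i : R := E + `|t u i|.
(* The i-th coordinate of [u + lat l *+ k] is that of [u] plus k l_i, and k >= 1. *)
have hl l i : `|l i|%:R <= `|t (u + lat l *+ k) i| + `|t u i| :> R.
  have -> : t (u + lat l *+ k) i = t u i + k%:R * (l i)%:~R.
    rewrite /t ffunE ffunMnE ffunE rmorphD rmorphMn rmorphM /= -[_ *+ k]mulr_natl.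
    by field; exact: dR_neq0.
  set x := t u i; set y := (l i)%:~R : R.
  have yE : `|l i|%:R = `|y| :> R by rewrite /y -intr_norm pmulrn.
  have : `|y| <= `|k%:R * y|.
    by rewrite normrM (ger0_norm (ltW kR)) ler_peMl // ler1n.
  have := ler_normB (x + k%:R * y) x; rewrite addrAC subrr add0r yE; lra.
exists ((\prod_i expR (D i)) * (2 * (1 - expR (-1 : R))^-1) ^+ g).
have q1 : expR (-1) < 1 :> R by rewrite -[ltRHS]expR0 ltr_expR; lra.
apply: sum_bounded_le (sum_boundedZ _ (sum_bounded_prod (expR_ge0 _) q1)); last first.
  by apply: prodr_ge0 => i _; exact: expR_ge0.
move=> l; set n := u + lat l *+ k.
apply: le_trans (_ : expR (\sum_i (- c' * t n i ^+ 2 + M * A * `|t n i|)) <= _).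
  rewrite big_split /= -!mulr_sumr expRD; apply: ler_pM; rewrite ?cabs_ge0 ?expR_ge0 ?gb //.
  by rewrite ler_expR -mulrA ler_wpM2l // lb.
rewrite -big_split /= expR_sum; apply: ler_prod => i _; rewrite expR_ge0 /=.
rewrite -expRM_natl -expRD ler_expR.
apply: le_trans (quad _) _; rewrite /D; have := hl l i; rewrite -/n; lra.
Qed.

Lemma theta_holomorphic k u : (0 < k)%N -> holomorphic (theta k u).
Proof. by move=> k0; apply: expsum_holomorphic; exact: theta_bound. Qed.

Lemma theta_periodic k u : nu_periodic nu (theta k u).
Proof. by apply: expsum_periodic => l j; exact: chi_nu. Qed.

Lemma theta_hassum k u v : (0 < k)%N ->
  hassum (fun l => gauss k (u + lat l *+ k) * chi (u + lat l *+ k) v) (theta k u v).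
Proof. by move=> k0; exact: (expsumP (theta_bound u k0)). Qed.

(** Translation by [Lam l0] becomes the reindexing l -> l + l0 of the series. *)
Lemma theta_quasi k u : (0 < k)%N -> quasi k (theta k u).
Proof.
move=> k0; split; [exact: theta_holomorphic|exact: theta_periodic|].
move=> l0 v; set K := cexp _ ^+ k.
apply: (hassum_unique (theta_hassum u (v + Lam l0) k0)).
have := hassum_reindex (f := fun l => l + l0) (f' := fun l => l - l0) _ _
   (hassumZ K (theta_hassum u v k0)).
move=> /(_ (fun l => addrK l0 l) (fun l => subrK l0 l)); apply: eq_hassum => l /=.
rewrite latD mulrnDl addrA; set n := u + lat l *+ k.
rewrite gauss_shift // (chiD n) chiDv /K.
have -> : chi (lat l0 *+ k) v = cexp (- (piC R * S v (Lam l0))) ^+ k.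
  rewrite chiE KtMn -cexpMn -Kt_lat -(rmorph_nat (real_complex R)) SZr rmorph_nat.
  by congr cexp; rewrite -mulr_natr; ring.
have e : cexp (piC R * S v (Lam l0) + piC R / 2 * S (Lam l0) (Lam l0)) ^+ k *
   cexp (- (piC R * S v (Lam l0))) ^+ k * cexp (- (piC R / 2 * S (Lam l0) (Lam l0))) ^+ k = 1.
  rewrite -!exprMn -!cexpD (_ : _ - _ - _ = 0) ?cexp0 ?expr1n //; ring.
rewrite -[RHS]mul1r -[X in _ = X * _]e; move: (cexp _ ^+ k) (cexp _ ^+ k) (cexp _ ^+ k) => a b c.
ring.
Qed.

(** A convolution of coefficients. With F = 1 it yields the coefficients of a theta series, with F a
    theta series those of a product. *)
Lemma fc_theta_mul k u F n : (0 < k)%N -> holomorphic F -> nu_periodic nu F ->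
  hassum (fun l => gauss k (u + lat l *+ k) * fc F (n - (u + lat l *+ k)))
         (fc (fun v => theta k u v * F v) n).
Proof.
move=> k0 hF pF.
have h1 : holomorphic (fun v => chi (- n) v * F v).
  by apply: holomorphicM => //; exact: chi_holomorphic.
have h2 : nu_periodic nu (fun v => chi (- n) v * F v).
  by move=> v j; rewrite pF chi_periodic.
have := tmean_expsum (theta_bound u k0) nu_span (fun l t => cabs_chi_torus _ t)
  (fun l j => chi_nu _ j) h1 h2.
rewrite (_ : tmean nu _ = fc (fun v => theta k u v * F v) n); last first.
  by congr tmean; apply/funext => v; rewrite /theta; ring.
apply: eq_hassum => l; congr (_ * tmean nu _); apply/funext => v.
by rewrite -/(chi _ v) mulrA -chiD opprB.
Qed.

Definition lat_eq k n m := exists l, n = m + lat l *+ k.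

Lemma fc_chi m n : fc (chi m) n = (n == m)%:R.
Proof.
rewrite /fc (_ : (fun v => _) = chi (m - n)); last first.
  by apply/funext => v; rewrite -chiD addrC.
by rewrite tmean_chi subr_eq0 eq_sym.
Qed.

Lemma fc_theta k u n : (0 < k)%N -> fc (theta k u) n = if `[< lat_eq k n u >] then gauss k n else 0.
Proof.
move=> k0.
have := fc_theta_mul u n k0 (@chi_holomorphic 0) (@chi_periodic 0).
rewrite (_ : (fun v => _) = theta k u); last first.
  by apply/funext => v; rewrite chi0 mulr1.
move=> h; apply: (hassum_unique h).
case: asboolP => [[l nE]|hn].
  have := @hassum_single R _ (fun l => gauss k (u + lat l *+ k) * fc (chi 0) (n - (u + lat l *+ k))) l.
  rewrite -nE subrr fc_chi eqxx mulr1; apply=> l' ll'.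
  rewrite fc_chi subr_eq0 nE; case: eqP; rewrite ?mulr0 // => /addrI e.
  case/eqP: ll'; apply: lat_inj; apply/ffunP => i.
  have /ffunP /(_ i) := e; rewrite !ffunMnE -[lat l i *+ k]mulr_natr -[lat l' i *+ k]mulr_natr.
  have k1 : k%:R != 0 :> int by rewrite pnatr_eq0 -lt0n.
  by move=> /(mulIf k1) ->.
apply: eq_hassum (@hassum0 R _) => l; rewrite fc_chi subr_eq0.
by case: eqP => [e|]; rewrite ?mulr0 //; case: hn; exists l.
Qed.

(** Translation by [Lam l] leaves the mean unchanged, and the automorphy factor trades [chi (- n)]
    for [chi (- (n + lat l *+ k))]. This is where independence of the base point is used. *)
Lemma fc_shift k F n l : (0 < k)%N -> quasi k F ->
  fc F (n + lat l *+ k) / gauss k (n + lat l *+ k) = fc F n / gauss k n.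
Proof.
move=> k0 [hF pF qF].
have h1 m : holomorphic (fun v => chi (- m) v * F v).
  by apply: holomorphicM => //; exact: chi_holomorphic.
have h2 m : nu_periodic nu (fun v => chi (- m) v * F v).
  by move=> v j; rewrite pF chi_periodic.
have := tmean_translate nu_span (Lam l) (h1 n) (h2 n); rewrite -/(fc F n).
set L := Lam l.
rewrite (_ : (fun v => _) = fun v => chi (- n) L * cexp (piC R / 2 * S L L) ^+ k *
   (chi (- (n + lat l *+ k)) v * F v)); last first.
  apply/funext => v; rewrite chiDv qF opprD chiD.
  have -> : chi (- (lat l *+ k)) v = cexp (piC R * S v L) ^+ k.
    rewrite chiN -cexpN lin_coef opprK KtMn Kt_lat -cexpMn -(rmorph_nat (real_complex R)) SZr rmorph_nat.
    by congr cexp; rewrite -mulr_natr -/L; ring.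
  rewrite cexpD exprMn; ring.
rewrite (tmeanZ nu_span _ (h1 _) (h2 _)) -/(fc F (n + lat l *+ k)) => <-.
rewrite gauss_shift // -/L chiN; set x := fc F _.
have e : cexp (piC R / 2 * S L L) ^+ k * cexp (- (piC R / 2 * S L L)) ^+ k = 1.
  by rewrite -exprMn -cexpD subrr cexp0 expr1n.
have := gauss_neq0 k n; have := chi_neq0 n L.
move: e; set E1 := _ ^+ k; set E2 := _ ^+ k => e.
have e2 : E2 != 0 by apply: contra_eq_neq e => ->; rewrite mulr0 eq_sym oner_eq0.
have -> : E1 = E2^-1 by apply: (mulIf e2); rewrite e mulVf.
by move=> c0 g0; field; rewrite c0 g0 e2.
Qed.

Lemma quasi_uniqueness k F : quasi k F -> (forall n, fc F n = 0) -> forall v, F v = 0.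
Proof.
move=> [hF pF _] h.
apply: (tmean_uniqueness nu_span chi_holomorphic chi_torus chi_neq0 hF pF).
by move=> n; have := h (- n); rewrite /fc opprK.
Qed.

(** This is [theta 2 c] at 0, where all characters are 1. *)
Definition Nval c : C := tsum (fun l => gauss 2 (c + lat l *+ 2)).

Lemma Nval_hassum c : hassum (fun l => gauss 2 (c + lat l *+ 2)) (Nval c).
Proof.
have := theta_hassum c 0 (isT : (0 < 2)%N) => h.
have {}h : hassum (fun l => gauss 2 (c + lat l *+ 2)) (theta 2 c 0).
  by apply: eq_hassum h => l; rewrite chi0v mulr1.
by rewrite /Nval (tsumE h).
Qed.

Lemma Nval_shift c l : Nval (c + lat l *+ 2) = Nval c.
Proof.
apply: tsumE; have := hassum_reindex (f := fun l' => l' + l) (f' := fun l' => l' - l) _ _ (Nval_hassum c).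
move=> /(_ (fun l' => addrK l l') (fun l' => subrK l l')); apply: eq_hassum => l' /=.
by rewrite latD mulrnDl (addrC (lat l' *+ 2)) addrA.
Qed.

(* The parallelogram law q(m) + q(n - m) = (q(n) + q(2m - n))/2. *)
Lemma gauss_parallelogram m n : gauss 1 m * gauss 1 (n - m) = gauss 2 n * gauss 2 (m *+ 2 - n).
Proof.
rewrite /gauss -!cexpD; congr cexp.
have Sk w w' : S (2%:R *: w) w' = 2%:R * S w w' by rewrite SZl.
have Sk' w w' : S w (2%:R *: w') = 2%:R * S w w'.
  by rewrite -(rmorph_nat (real_complex R)) SZr.
rewrite !(KtD, KtN, KtMn) !(SDl, SDr, SNl, SNr, Sk, Sk') (S_Kt_sym m n) !natrM.
by field.
Qed.

Lemma fc_theta_prod u u' n : fc (fun v => theta 1 u v * theta 1 u' v) n =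
  if `[< lat_eq 1 n (u + u') >] then gauss 2 n * Nval (u *+ 2 - n) else 0.
Proof.
have h := fc_theta_mul (k := 1) u n isT (theta_holomorphic (k := 1) u' isT) (@theta_periodic 1 u').
apply: (hassum_unique h); case: asboolP => [[l0 nE]|hn].
  apply: eq_hassum (hassumZ (gauss 2 n) (Nval_hassum (u *+ 2 - n))) => l.
  rewrite mulr1n fc_theta // asboolT.
    rewrite gauss_parallelogram mulrnDl; congr (_ * gauss 2 _).
    by rewrite addrAC.
  (* The second factor of the convolution has index n - (u + lat l) = u' + lat (l0 - l). *)
  exists (l0 - l); rewrite nE latD latN !mulr1n.
  by apply/ffunP => i; rewrite !ffunE; ring.
apply: eq_hassum (@hassum0 R _) => l; rewrite fc_theta // asboolF ?mulr0 //.
move=> [l' e]; apply: hn; exists (l + l'); rewrite latD mulrnDl.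
move/eqP: e; rewrite subr_eq => /eqP ->; rewrite !mulr1n.
by apply/ffunP => i; rewrite !ffunE; ring.
Qed.

End Theta.

(** * Sections of powers of the line bundle *)

Section Sections.
Variables (R : realType) (g : nat).
Local Notation C := R[i].
Local Notation V := 'rV[C]_g.
Local Notation I := {ffun 'I_g -> int}.
Local Notation Ci := ('i%C : R[i]).
Variables (Lambda : set V) (H : {dot V for Num.conj}) (chi0 : V -> C).
Variables (lam mu : 'I_g -> V) (B : {biscalar V}) (d : 'I_g -> nat).
Hypothesis symp : symplectic_basis Lambda H lam mu.
Hypothesis Bext : bilinear_extension H mu B.
Hypothesis d_gt0 : forall i, (0 < d i)%N.
Hypothesis char0 : characteristic0 (LineBundle Lambda H chi0) lam mu.
Implicit Types (v w x : V) (n m u l : I) (F f : V -> C).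
Local Notation S := (Sform H B).
Local Notation nu := (nu mu d).
Local Notation Kt := (Kt lam d).
Local Notation Lam := (Lam lam).
Local Notation quasi := (quasi H lam mu B d).
Local Notation theta := (theta H lam B d).
Local Notation gauss := (gauss H lam B d).
Local Notation fc := (fc H lam mu B d).
Local Notation Nval := (Nval H lam B d).
Local Notation Lambda' := (sumset (zspan lam) (zspan nu)).
Local Notation L := (pullback Lambda' (LineBundle Lambda H chi0)).

Definition Gq v : C := cexp (piC R / 2 * B v v).

(** By symmetry of B the linear part of c B(x + y, x + y) at x is 2 c B(x, y), and the rest is a
    quadratic remainder. The free constant [c] covers [Gq] and its inverse. *)
Lemma Bq_holomorphic (c : C) : holomorphic (fun v => cexp (c * B v v)).
Proof.
move=> x.
pose K : R := \sum_i \sum_j cabs (B (delta_mx 0 i) (delta_mx 0 j)).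
pose a i : C := 2 * c * B x (delta_mx 0 i).
have aE y : lin_form a y = c * (2 * B x y).
  rewrite {2}(row_sum_delta y) B_sumr /lin_form !mulr_sumr; apply: eq_bigr => i _.
  by rewrite BZr /a; ring.
have By y (r : R) : `|y| <= r%:C -> cabs (B y y) <= K * r ^+ 2.
  move=> yr; have r0 : 0 <= r by rewrite -ler0c; apply: le_trans yr.
  have yi i : cabs (y 0 i) <= r by rewrite le_cabs; apply: le_trans yr; exact: coord_le_norm.
  rewrite {1}(row_sum_delta y) B_suml; apply: le_trans (ler_cabs_sum _ _ _) _.
  rewrite /K mulr_suml; apply: ler_sum => i _.
  rewrite BZl cabsM.
  have -> : B (delta_mx 0 i) y = \sum_j y 0 j * B (delta_mx 0 i) (delta_mx 0 j).
    by rewrite {1}(row_sum_delta y) B_sumr; apply: eq_bigr => j _; rewrite BZr.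
  apply: le_trans (_ : r * (\sum_j r * cabs (B (delta_mx 0 i) (delta_mx 0 j))) <= _).
    apply: ler_pM; rewrite ?cabs_ge0 //; apply: le_trans (ler_cabs_sum _ _ _) _.
    by apply: ler_sum => j _; rewrite cabsM ler_wpM2r ?cabs_ge0.
  rewrite -mulr_sumr mulrA mulrC; exact: lexx.
have K0 : 0 <= K by apply: sumr_ge0 => i _; apply: sumr_ge0 => j _; exact: cabs_ge0.
pose A := l1norm a + cabs c * K.
have A0 : 0 <= A by rewrite addr_ge0 ?l1norm_ge0 // mulr_ge0 // cabs_ge0.
pose E := cexp (c * B x x).
apply: (@differentiable_quadratic C g _ x (fun i => E * a i)
  (cabs E * (4 * A ^+ 2 * expR A + cabs c * K))%:C) => y y1.
pose r := cabs `|y|; have rE : r%:C = `|y| by rewrite cabsE normr_id.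
have r0 : 0 <= r by exact: cabs_ge0.
have r1 : r < 1 by rewrite -ltcR rE.
rewrite -rE -rmorphXn -rmorphM -le_cabs.
pose w := c * (2 * B x y + B y y).
have -> : lin_form (fun i => E * a i) y = E * (w - c * B y y).
  have -> : w - c * B y y = lin_form a y by rewrite aE /w; ring.
  by rewrite /lin_form mulr_sumr; apply: eq_bigr => i _ /=; ring.
have -> : cexp (c * B (x + y) (x + y)) = E * cexp w.
  rewrite /E -cexpD BDl !BDr (B_sym symp Bext y x); congr cexp; rewrite /w; ring.
have -> : E * cexp w - E - E * (w - c * B y y) = E * ((cexp w - 1 - w) + c * B y y) by ring.
rewrite cabsM -[leRHS]mulrA ler_wpM2l ?cabs_ge0 //.
have byr : cabs (c * B y y) <= cabs c * K * r ^+ 2.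
  by rewrite cabsM -mulrA ler_wpM2l ?cabs_ge0 // By // rE.
have wr : cabs w <= A * r.
  rewrite /w mulrDr -aE; apply: le_trans (ler_cabsD _ _) _; rewrite /A mulrDl.
  apply: lerD; first by apply: lin_form_bound; rewrite rE.
  apply: le_trans byr _; rewrite expr2 mulrA ler_piMr ?(ltW r1) //.
  by rewrite !mulr_ge0 ?cabs_ge0.
have wA : cabs w <= A by apply: le_trans wr _; rewrite ler_piMr // ltW.
apply: le_trans (ler_cabsD _ _) _; rewrite mulrDl; apply: lerD => //.
apply: le_trans (cexp2_le _) _.
have -> : 4 * A ^+ 2 * expR A * r ^+ 2 = 4 * (A * r) ^+ 2 * expR A by ring.
apply: ler_pM; rewrite ?expR_ge0 ?ler_expR //; first by rewrite mulr_ge0 // sqr_ge0.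
by rewrite ler_wpM2l // lerXn2r // nnegrE ?cabs_ge0 // mulr_ge0.
Qed.

Lemma holomorphic_exp F k : holomorphic F -> holomorphic (fun v => F v ^+ k).
Proof.
move=> hF; elim: k => [|k IH].
  by move=> v; exact: (@differentiable_cst C V C^o 1 v).
by under [fun _ => _]funext => v do rewrite exprS; exact: holomorphicM.
Qed.

Lemma zspan_lamP x : zspan lam x <-> exists l, x = Lam l.
Proof.
split=> [[n _ <-]|[l ->]].
  exists [ffun i => n i]; rewrite /Lam /realcomb; apply: eq_bigr => i _.
  by rewrite ffunE rmorph_int.
by exists l => //; apply: eq_bigr => i _; rewrite rmorph_int.
Qed.

Lemma lattice'P x : Lambda' x -> exists l s, x = Lam l + realcomb mu s /\
  exists m : 'I_g -> int, realcomb mu s = \sum_i (m i)%:~R *: nu i.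
Proof.
move=> [x1 /zspan_lamP [l ->] [_ [m _ <-] <-]].
exists l, (fun i => (m i)%:~R * (d i)%:R); split=> //; last first.
  exists m; apply: eq_bigr => i _; by rewrite /nu scalerA rmorphM rmorph_int rmorph_nat.
congr (_ + _); apply: eq_bigr => i _; by rewrite /nu scalerA rmorphM rmorph_int rmorph_nat.
Qed.

(** H(v, x) = B(v, x) + S(v, Lam l), and (pi/2) H(x, x) contains -pi i E(x_1, x_2), which the
    semicharacter of characteristic 0 cancels. What remains besides [Gq] depends only on the
    V_1-part of x. *)
Lemma automorphyE x l s v : x = Lam l + realcomb mu s -> Lambda' x ->
  Gq (v + x) * cexp (piC R * S v (Lam l) + piC R / 2 * S (Lam l) (Lam l)) =
  automorphy L x v * Gq v.
Proof.
move=> xE Lx.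
have Lx' : Lambda x.
  have [-> _ _ _] := symp; move: Lx => [y1 hy1 [_ [m _ <-] <-]].
  exists y1 => //; exists (\sum_i (m i)%:~R *: nu i) => //.
  exists (fun i => m i * (d i)%:Z) => //; apply: eq_bigr => i _.
  by rewrite /nu scalerA intrM.
rewrite /automorphy /=.
have -> : chi0 x = cexp (piC R * 'i%C * (imform H (Lam l) (realcomb mu s))%:C).
  rewrite xE; have := @char0 (Lam l) (realcomb mu s); rewrite /= complexiE; apply.
  - by exists (fun i => (l i)%:~R).
  - by exists s.
  - by rewrite -xE.
rewrite /Gq -!cexpD; congr cexp.
have e1 : H v x = B v x + S v (Lam l).
  have : S v x = S v (Lam l) by rewrite xE SDr (S_mur symp Bext) addr0.
  by rewrite {1}/Sform => <-; rewrite addrC subrK.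
have e2 : H x x = B x x + S (Lam l) (Lam l) - 2 * Ci * (imform H (Lam l) (realcomb mu s))%:C.
  have : S x x = S (Lam l) (Lam l) - 2 * Ci * (imform H (Lam l) (realcomb mu s))%:C.
    rewrite {2}xE SDr (S_mur symp Bext) addr0 xE SDl (S_mul symp Bext).
    by rewrite (imform_anti H (realcomb mu s)) rmorphN; ring.
  have -> : H x x = S x x + B x x by rewrite /Sform subrK.
  by move=> ->; ring.
rewrite e1 e2 BDl !BDr (B_sym symp Bext x v).
move: (B v v) (B v x) (B x x) (S v _) (S (Lam l) _) (_%:C) => b1 b2 b3 s1 s2 z; by field.
Qed.

Definition H0k k f := holomorphic f /\
  forall y v, Lambda' y -> f (v + y) = automorphy L y v ^+ k * f v.

Lemma H0_1 f : H0 L f <-> H0k 1 f.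
Proof. by []. Qed.

Lemma H0_2 f : H0 (tensor_square L) f <-> H0k 2 f.
Proof.
have e y v : automorphy (tensor_square L) y v = automorphy L y v ^+ 2.
  rewrite /automorphy /= exprMn -cexpMn; congr (_ * cexp _).
  by rewrite -mulr_natr; ring.
by split=> -[hf qf]; split=> // l v /qf ->; rewrite e.
Qed.

Lemma Gq_neq0 v : Gq v != 0. Proof. exact: cexp_neq0. Qed.

Lemma H0k_quasi k f : H0k k f -> quasi k (fun v => f v * (Gq v)^-1 ^+ k).
Proof.
move=> [hf qf]; split.
- apply: holomorphicM => //; apply: holomorphic_exp.
  rewrite (_ : (fun v => _) = fun v => cexp (- (piC R / 2) * B v v)); first exact: Bq_holomorphic.
  by apply/funext => v; rewrite /Gq mulNr cexpN.
- move=> v i.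
  have Li : Lambda' (nu i).
    exists 0; first by apply/zspan_lamP; exists 0; rewrite /Lam /realcomb big1 // => j _; rewrite ffunE scale0r.
    exists (nu i); last by rewrite add0r.
    exists (fun j => (j == i)%:R) => //; rewrite (bigD1 i) //= eqxx scale1r big1 ?addr0 // => j ji.
    by rewrite (negbTE ji) scale0r.
  have nE : nu i = Lam 0 + realcomb mu (fun j => (d i)%:R * (j == i)%:R).
    rewrite /Lam {1}/realcomb big1 ?add0r => [|j _]; last by rewrite ffunE scale0r.
    by rewrite realcombZ realcomb_delta rmorph_nat.
  have L0 : Lam 0 = 0 by rewrite /Lam /realcomb big1 // => j _; rewrite ffunE scale0r.
  have := automorphyE v nE Li; rewrite L0 S0r S0l !mulr0 addr0 cexp0 mulr1 => e.
  rewrite (qf _ _ Li); have := Gq_neq0 (v + nu i); move: e; move: (automorphy _ _ _) => a ->.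
  rewrite mulf_eq0 negb_or => /andP[a0 g0].
  have := expf_neq0 k a0; have := expf_neq0 k g0 => g1 a1.
  rewrite !exprVn exprMn; move: (a ^+ k) (Gq v ^+ k) (f v) a1 g1 => A G y A0 G0.
  by field; rewrite A0 G0.
move=> l v.
have Ll : Lambda' (Lam l).
  exists (Lam l); first by apply/zspan_lamP; exists l.
  exists 0; last by rewrite addr0.
  by exists (fun=> 0) => //; rewrite big1 // => i _; rewrite scale0r.
have lE : Lam l = Lam l + realcomb mu (fun=> 0).
  by rewrite /realcomb big1 ?addr0 // => i _; rewrite scale0r.
have e := automorphyE v lE Ll.
rewrite (qf _ _ Ll); move: e; move: (cexp _) (automorphy _ _ _) => K a e.
have -> : K = a * Gq v / Gq (v + Lam l).
  by rewrite -e mulrAC mulfV ?mul1r // Gq_neq0.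
rewrite !exprMn !exprVn; have h1 := expf_neq0 k (Gq_neq0 v); have h2 := expf_neq0 k (Gq_neq0 (v + Lam l)).
move: (a ^+ k) (Gq v ^+ k) (Gq _ ^+ k) (f v) h1 h2 => A G G' y h1 h2.
by field; rewrite h1 h2.
Qed.

Lemma quasi_H0k k F : quasi k F -> H0k k (fun v => F v * Gq v ^+ k).
Proof.
move=> [hF pF qF]; split.
  by apply: holomorphicM => //; apply: holomorphic_exp; exact: Bq_holomorphic.
move=> x v Lx; have [l [s [xE [m mE]]]] := lattice'P Lx.
have -> : F (v + x) = F (v + Lam l).
  rewrite xE mE addrA; move: (v + Lam l) => y.
  have step (c : int) i y' : F (y' + c%:~R *: nu i) = F y'.
    case: c => c.
      elim: c y' => [|c IH] y'; first by rewrite scale0r addr0.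
      by rewrite intS rmorphD /= scalerDl scale1r addrA IH pF.
    have nat_step e y2 : F (y2 + e%:R *: nu i) = F y2.
      elim: e y2 => [|e IH] y2; first by rewrite scale0r addr0.
      by rewrite -natr1 scalerDl scale1r addrA pF IH.
    have -> : (Negz c)%:~R = - (c.+1%:R) :> C by rewrite NegzE rmorphN.
    by rewrite scaleNr -[LHS](nat_step c.+1) subrK.
  elim: (index_enum _) y => [|i r IH] y; first by rewrite big_nil addr0.
  by rewrite big_cons addrA IH step.
have e := automorphyE v xE Lx; rewrite qF.
by rewrite mulrAC -exprMn [X in X ^+ k]mulrC e exprMn; ring.
Qed.

(** Division by the k-th power of [Gq] is multiplicative in k, so it carries the multiplication map
    of sections to products of quasi-periodic functions. *)
Lemma two_normal_quasi : two_normal L <-> (forall F, quasi 2 F ->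
  exists (n : nat) (s t : 'I_n -> V -> C), (forall k, quasi 1 (s k) /\ quasi 1 (t k)) /\
    forall v, F v = \sum_k s k v * t k v).
Proof.
split=> h.
  move=> F /quasi_H0k /H0_2 /h [n [s [t [st FE]]]].
  exists n, (fun k v => s k v * (Gq v)^-1 ^+ 1), (fun k v => t k v * (Gq v)^-1 ^+ 1); split.
    by move=> k; have [/H0_1 h1 /H0_1 h2] := st k; split; exact: H0k_quasi.
  move=> v; have g2 : Gq v ^+ 2 != 0 by rewrite expf_neq0 // Gq_neq0.
  apply: (mulIf g2); rewrite FE mulr_suml; apply: eq_bigr => k _.
  by have := Gq_neq0 v => g0; field.
move=> f /H0_2 fH; have [n [s [t [st FE]]]] := h _ (H0k_quasi fH).
exists n, (fun k v => s k v * Gq v ^+ 1), (fun k v => t k v * Gq v ^+ 1); split.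
  by move=> k; have [h1 h2] := st k; split; apply/H0_1; exact: quasi_H0k.
move=> v; have g2 : (Gq v)^-1 ^+ 2 != 0 by rewrite expf_neq0 // invr_neq0 // Gq_neq0.
apply: (mulIf g2); rewrite FE mulr_suml; apply: eq_bigr => k _.
by have := Gq_neq0 v => g0; field.
Qed.

(** With c = Kt m / 2, completing the square in the series, reindexed by l -> -l, gives exp(pi S(c,
    c)) [Nval m]; the prefactors in H(c, c), B(c, c) and S(c, c) then cancel. *)
Lemma theta0c_Nval m : theta0c H B lam (2^-1 *: Kt m) 0 = Nval m.
Proof.
rewrite /theta0c /theta0 add0r; set c := 2^-1 *: Kt m.
rewrite (linear0l H) mulr0 oppr0 add0r.
have -> : summability.sum (fun n : I =>
     let l := \sum_i (n i)%:~R *: lam i in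
     cexp (2 * piC R * (H c l - B c l) - piC R * (H l l - B l l)) : C^o) =
   cexp (piC R * S c c) * Nval m :> C.
  apply: summability_sumE.
  have := hassum_reindex (f := fun l => - l) (f' := fun l => - l) (@opprK _) (@opprK _)
     (hassumZ (cexp (piC R * S c c)) (Nval_hassum symp Bext d_gt0 m)).
  apply: eq_hassum => n /=.
  have -> : \sum_i (n i)%:~R *: lam i = Lam n.
    by rewrite /Lam /realcomb; apply: eq_bigr => i _; rewrite rmorph_int.
  rewrite -!/(Sform _ _ _ _) /gauss -cexpD; congr cexp.
  have mE : Kt m = 2 *: c by rewrite /c scalerA divff ?scale1r.
  have -> : Kt (m + lat d (- n) *+ 2) = 2 *: (c - Lam n).
    by rewrite KtD KtMn latN KtN (Kt_lat _ d_gt0) mE scalerBr scalerN.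
  have Sk w w' : S (2%:R *: w) w' = 2%:R * S w w' by rewrite SZl.
  have Sk' w w' : S w (2%:R *: w') = 2%:R * S w w'.
    by rewrite -(rmorph_nat (real_complex R)) SZr.
  have sym : S (Lam n) c = S c (Lam n).
    rewrite /c -(Kt_lat lam d_gt0).
    have -> : 2^-1 *: Kt m = (2^-1 : R)%:C *: Kt m by rewrite fmorphV rmorph_nat.
    by rewrite SZl SZr (S_Kt_sym d symp Bext).
  rewrite Sk Sk' SDl !SDr !SNl !SNr sym natrM.
  move: (S c c) (S c _) (S (Lam n) _) => s1 s2 s3; by field.
by rewrite !mulrA -!cexpD (_ : _ + _ + _ = 0) ?cexp0 ?mul1r // /Sform; ring.
Qed.

End Sections.

(** * The rank criterion *)

Section MainTheorem.
Variables (R : realType) (g : nat).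
Local Notation C := R[i].
Local Notation V := 'rV[C]_g.
Local Notation I := {ffun 'I_g -> int}.
Variables (Lambda : set V) (H : {dot V for Num.conj}).
Variables (lam mu : 'I_g -> V) (B : {biscalar V}) (d : 'I_g -> nat).
Hypothesis symp : symplectic_basis Lambda H lam mu.
Hypothesis Bext : bilinear_extension H mu B.
Hypothesis d_gt0 : forall i, (0 < d i)%N.
Implicit Types (v w x : V) (n m u l : I) (F f s t : V -> C).
Local Notation nu := (nu mu d).
Local Notation Kt := (Kt lam d).
Local Notation Lam := (Lam lam).
Local Notation lat := (lat d).
Local Notation lat_eq := (lat_eq d).
Local Notation quasi := (quasi H lam mu B d).
Local Notation theta := (theta H lam B d).
Local Notation gauss := (gauss H lam B d).
Local Notation fc := (fc H lam mu B d).
Local Notation Nval := (Nval H lam B d).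
Let nu_span' := nu_span symp d_gt0.

Lemma quasi_sum k (J : Type) (r : seq J) (F : J -> V -> C) :
  (forall j, quasi k (F j)) -> quasi k (fun v => \sum_(j <- r) F j v).
Proof.
move=> h; split.
- by apply: holomorphic_sum => j; have [] := h j.
- by move=> v i; apply: eq_bigr => j _; have [_ p _] := h j; rewrite p.
by move=> l v; rewrite mulr_sumr; apply: eq_bigr => j _; have [_ _ q] := h j; rewrite q.
Qed.

Lemma quasiZ k c F : quasi k F -> quasi k (fun v => c * F v).
Proof.
move=> [hF pF qF]; split; first exact: holomorphicZ.
  by move=> v i; rewrite pF.
by move=> l v; rewrite qF mulrCA.
Qed.

Lemma quasiM s t : quasi 1 s -> quasi 1 t -> quasi 2 (fun v => s v * t v).
Proof.
move=> [hF pF qF] [hG pG qG]; split; first exact: holomorphicM.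
  by move=> v i; rewrite pF pG.
by move=> l v; rewrite qF qG; ring.
Qed.

Lemma fc_sum k (J : Type) (r : seq J) (F : J -> V -> C) n :
  (forall j, quasi k (F j)) -> fc (fun v => \sum_(j <- r) F j v) n = \sum_(j <- r) fc (F j) n.
Proof.
move=> h; rewrite /fc -(tmean_sum nu_span') => [|j|j].
- by congr tmean; apply/funext => v; rewrite mulr_sumr.
- by apply: holomorphicM; [exact: chi_holomorphic|have [] := h j].
- by move=> v i; rewrite (chi_periodic symp Bext d_gt0); have [_ p _] := h j; rewrite p.
Qed.

Lemma fcZ k c F n : quasi k F -> fc (fun v => c * F v) n = c * fc F n.
Proof.
move=> [hF pF _]; rewrite /fc -(tmeanZ nu_span').
- by congr tmean; apply/funext => v; rewrite mulrCA.
- by apply: holomorphicM => //; exact: chi_holomorphic.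
- by move=> v i; rewrite (chi_periodic symp Bext d_gt0) pF.
Qed.

Lemma quasi_eq k F F' : quasi k F -> quasi k F' -> (forall n, fc F n = fc F' n) -> F =1 F'.
Proof.
move=> qF qF' h v.
pose G (b : bool) := if b then F else fun v => -1 * F' v.
have qG b : quasi k (G b) by case: b; [exact: qF|exact: quasiZ].
have := quasi_uniqueness symp Bext d_gt0 (quasi_sum [:: true; false] qG) _ v.
rewrite !big_cons big_nil /= addr0 mulN1r => e; apply/eqP; rewrite -subr_eq0; apply/eqP; apply: e => n.
rewrite (fc_sum [:: true; false] n qG) !big_cons big_nil /= addr0.
by rewrite (fcZ _ _ qF') h mulN1r subrr.
Qed.

Definition bcoef k F n := fc F n / gauss k n.

Lemma lat_eq_bcoef k F n m : (0 < k)%N -> quasi k F -> lat_eq k n m -> bcoef k F n = bcoef k F m.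
Proof. by move=> k0 qF [l ->]; exact: (fc_shift symp Bext d_gt0). Qed.

Lemma lat_eq_sym k n m : lat_eq k n m -> lat_eq k m n.
Proof.
by move=> [l ->]; exists (- l); rewrite latN mulNrn addrK.
Qed.

Lemma lat_eq_trans k n m u : lat_eq k n m -> lat_eq k m u -> lat_eq k n u.
Proof. by move=> [l ->] [l' ->]; exists (l' + l); rewrite latD mulrnDl addrA. Qed.

Lemma lat_eq_refl k n : lat_eq k n n.
Proof. by exists 0; apply/ffunP => i; rewrite !(ffunE, ffunMnE) mulr0 mul0rn addr0. Qed.

Lemma bcoef_theta k u n : (0 < k)%N -> bcoef k (theta k u) n = (`[< lat_eq k n u >])%:R.
Proof.
move=> k0; rewrite /bcoef (fc_theta symp Bext d_gt0) //; case: asboolP => _; last by rewrite mul0r.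
by rewrite divff // gauss_neq0.
Qed.

Lemma bcoef_theta_prod u u' n : bcoef 2 (fun v => theta 1 u v * theta 1 u' v) n =
  (`[< lat_eq 1 n (u + u') >])%:R * Nval (u *+ 2 - n).
Proof.
rewrite /bcoef (fc_theta_prod symp Bext d_gt0); case: asboolP => _; last by rewrite !mul0r.
by rewrite mul1r mulrAC divff ?mul1r // gauss_neq0.
Qed.

Lemma bcoef_sum k (J : Type) (r : seq J) (F : J -> V -> C) n : (forall j, quasi k (F j)) ->
  bcoef k (fun v => \sum_(j <- r) F j v) n = \sum_(j <- r) bcoef k (F j) n.
Proof. by move=> h; rewrite /bcoef (fc_sum _ _ h) mulr_suml. Qed.

Lemma bcoefZ k c F n : quasi k F -> bcoef k (fun v => c * F v) n = c * bcoef k F n.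
Proof. by move=> h; rewrite /bcoef (fcZ _ _ h) mulrA. Qed.

Lemma bcoef_inj k F F' : quasi k F -> quasi k F' -> (forall n, bcoef k F n = bcoef k F' n) -> F =1 F'.
Proof.
move=> qF qF' h; apply: (quasi_eq qF qF') => n.
by apply: (mulIf (invr_neq0 (gauss_neq0 H lam B d k n))); exact: h.
Qed.

Lemma Kt_inj : injective Kt.
Proof.
move=> n m e; apply/ffunP => i.
have h u : imform H (Kt u) (mu i) = (u i)%:~R / (d i)%:R by rewrite /Kt (imform_lam_mu symp).
have := h n; rewrite e h => /(mulIf (invr_neq0 (dR_neq0 R d_gt0 i))) /eqP.
by rewrite eqr_int => /eqP.
Qed.

Lemma K1P x : K1 lam d x <-> exists n, x = Kt n.
Proof.
have e (a : int) i : (a%:~R / (d i)%:R : C) = (a%:~R / (d i)%:R : R)%:C.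
  by rewrite fmorph_div rmorph_int rmorph_nat.
split=> [[n _ <-]|[n ->]].
  by exists [ffun i => n i]; apply: eq_bigr => i _; rewrite ffunE e.
by exists n => //; apply: eq_bigr => i _; rewrite e.
Qed.

Lemma twiceK1P x : twiceK1 lam d x <-> exists n l, x = Kt (n *+ 2 + lat l).
Proof.
split=> [[y [z /K1P [n ->] <-] [y' /zspan_lamP [l ->] <-]]|[n [l ->]]].
  by exists n, l; rewrite KtD KtMn (Kt_lat _ d_gt0).
exists (2 *: Kt n); first by exists (Kt n) => //; apply/K1P; exists n.
exists (Lam l); first by apply/zspan_lamP; exists l.
by rewrite KtD KtMn (Kt_lat _ d_gt0).
Qed.

Variables (U Z W : seq V).
Hypothesis hU : representatives (K1 lam d) (zspan lam) U.
Hypothesis hZ : representatives (Z2 lam) (zspan lam) Z.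
Hypothesis hW : representatives (K1 lam d) (twiceK1 lam d) W.

(** Integer coordinates of a point; the default 0 concerns only points outside the preimage of
    K_1. *)
Definition Kt_inv x : I := xget 0 [set n | x = Kt n].
(** For z in [Z], [lat (half_inv z)] is the integer vector of 2 z. *)
Definition half_inv x : I := xget 0 [set l | x = 2^-1 *: Lam l].

Lemma Kt_invK x : K1 lam d x -> Kt (Kt_inv x) = x.
Proof.
move=> /K1P ex; have := @xgetPex _ 0 [set n | x = Kt n] ex; by rewrite /= => <-.
Qed.

Lemma half_invK x : x \in Z -> 2^-1 *: Lam (half_inv x) = x.
Proof.
move=> xZ; have [_ h _ _] := hZ; have [y /zspan_lamP [l yE] e] := h _ xZ.
have ex : exists l, x = 2^-1 *: Lam l by exists l; rewrite -yE e.
have := @xgetPex _ 0 [set l | x = 2^-1 *: Lam l] ex; by rewrite /= => <-.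
Qed.

Lemma U_K x : x \in U -> Kt (Kt_inv x) = x.
Proof. by move=> xU; apply: Kt_invK; have [_ h _ _] := hU; exact: h. Qed.
Lemma W_K x : x \in W -> Kt (Kt_inv x) = x.
Proof. by move=> xU; apply: Kt_invK; have [_ h _ _] := hW; exact: h. Qed.

Lemma U_cover n : exists2 x, x \in U & lat_eq 1 n (Kt_inv x).
Proof.
have [_ _ h _] := hU; have [|x xU /zspan_lamP [l e]] := h (Kt n); first by apply/K1P; exists n.
exists x => //; exists l; apply: Kt_inj; rewrite mulr1n KtD U_K // (Kt_lat _ d_gt0) -e.
by rewrite addrC subrK.
Qed.

Lemma U_unique x y : x \in U -> y \in U -> lat_eq 1 (Kt_inv x) (Kt_inv y) -> x = y.
Proof.
have [_ _ _ h] := hU; move=> xU yU [l e]; apply: h => //; apply/zspan_lamP; exists l.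
by rewrite -(U_K xU) -(U_K yU) e mulr1n KtD (Kt_lat _ d_gt0) addrC addKr.
Qed.

Lemma Kt_lat_half l : Kt (lat l) = 2 *: (2^-1 *: Lam l).
Proof. by rewrite scalerA divff ?pnatr_eq0 // scale1r (Kt_lat _ d_gt0). Qed.

Lemma Z_cover l : exists2 x, x \in Z & lat_eq 2 (lat l) (lat (half_inv x)).
Proof.
have [_ _ h _] := hZ; have [|x xZ /zspan_lamP [l' e]] := h (2^-1 *: Lam l).
  by exists (Lam l) => //; apply/zspan_lamP; exists l.
exists x => //; exists l'; apply: Kt_inj; rewrite KtD KtMn (Kt_lat _ d_gt0 l').
by rewrite !Kt_lat_half half_invK // -e -scalerDr addrC subrK.
Qed.

Lemma Z_unique x y : x \in Z -> y \in Z -> lat_eq 2 (lat (half_inv x)) (lat (half_inv y)) -> x = y.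
Proof.
have [_ _ _ h] := hZ; move=> xZ yZ [l e]; apply: h => //; apply/zspan_lamP; exists l.
have := congr1 Kt e; rewrite KtD KtMn (Kt_lat _ d_gt0 l) !Kt_lat_half !half_invK //.
rewrite -scalerDr => /scalerI -> //; first by rewrite addrC addKr.
Qed.

(** A class of half-periods is determined by the parities of the coordinates of twice a
    representative, and all parities occur. *)
Lemma size_Z : size Z = (2 ^ g)%N.
Proof.
pose par x : {ffun 'I_g -> bool} := [ffun i => odd `|half_inv x i|%N].
have inj : {in Z &, injective par}.
  move=> x y xZ yZ /ffunP e; apply: Z_unique => //.
  pose l : I := [ffun i => (half_inv x i - half_inv y i) %/ 2]%Z.
  exists l; apply/ffunP => i; have := e i; rewrite mulr2n !ffunE.
  move: (half_inv x i) (half_inv y i) => a b ab.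
  have dv : (2 %| a - b)%Z by lia.
  have := divzK dv; set q := (_ %/ 2)%Z => h.
  by rewrite (_ : a = b + q * 2); [ring|rewrite h; ring].
have [uZ _ _ _] := hZ.
rewrite -(size_map par).
have -> : size (map par Z) = #|{ffun 'I_g -> bool}|.
  rewrite cardE; apply: perm_size; apply: uniq_perm; rewrite ?enum_uniq //.
    by rewrite map_inj_in_uniq.
  move=> b; rewrite mem_enum inE; apply/mapP.
  have [x xZ [l e]] := Z_cover [ffun i => (b i : nat) : int].
  exists x => //; apply/ffunP => i; rewrite ffunE.
  have /ffunP/(_ i) := e; rewrite mulr2n !ffunE -!mulrDr.
  have di : (d i)%:Z != 0 by have := d_gt0 i; lia.
  move/(mulfI di); move: (half_inv x i) (l i) (b i) => a c [] /=; lia.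
by rewrite card_ffun card_bool card_ord.
Qed.

(** u + z - w/2 is half of the point with integer vector 2u - (w - 2z). *)
Lemma theta_matrixE w (i : 'I_(size U)) (j : 'I_(size Z)) : w \in W ->
  theta_matrix H B lam U Z w i j =
  Nval (Kt_inv U`_i *+ 2 - (Kt_inv w - lat (half_inv Z`_j))).
Proof.
move=> wW; set m := _ - _.
have E : U`_i + Z`_j - 2^-1 *: w = 2^-1 *: Kt m.
  rewrite /m !(KtD, KtN, KtMn) U_K ?mem_nth // W_K // Kt_lat_half half_invK ?mem_nth //.
  rewrite opprB addrA scalerBr scalerDr !scalerA.
  have -> : 2^-1 * 2%:R = 1 :> C by rewrite mulVf // pnatr_eq0.
  by rewrite !scale1r.
rewrite mxE E; exact: (theta0c_Nval symp Bext d_gt0).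
Qed.

(** Both sides have the same normalized coefficients, since each index is congruent to exactly one
    representative in [U]. *)
Lemma theta_expansion s : quasi 1 s ->
  s =1 fun v => \sum_(x <- U) bcoef 1 s (Kt_inv x) * theta 1 (Kt_inv x) v.
Proof.
move=> qs.
have qt x : quasi 1 (fun v => bcoef 1 s (Kt_inv x) * theta 1 (Kt_inv x) v).
  by apply: quasiZ; exact: (theta_quasi symp Bext d_gt0).
apply: (@bcoef_inj 1) => //; first exact: quasi_sum.
move=> n; rewrite bcoef_sum //.
have [x0 x0U nx0] := U_cover n; have [uU _ _ _] := hU.
rewrite (bigD1_seq x0) //= big_seq_cond big1 => [|x /andP[xU xx0]].
  rewrite addr0 bcoefZ; last exact: (theta_quasi symp Bext d_gt0).
  by rewrite bcoef_theta // asboolT // mulr1; exact: lat_eq_bcoef.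
rewrite bcoefZ; last exact: (theta_quasi symp Bext d_gt0).
rewrite bcoef_theta // asboolF ?mulr0 // => nx.
case/eqP: xx0; apply: U_unique => //; exact: lat_eq_trans (lat_eq_sym nx) nx0.
Qed.

(** A relation [x] between the columns defines the functional [phi]. It vanishes on products of
    sections, hence on all of [quasi 2] by hypothesis, but its value on the theta series of order 2
    with index w - 2 z_j is x_j. *)
Lemma rank_of_decomposition : (forall F, quasi 2 F ->
  exists (n : nat) (s t : 'I_n -> V -> C), (forall k, quasi 1 (s k) /\ quasi 1 (t k)) /\
    forall v, F v = \sum_k s k v * t k v) ->
  forall w, w \in W -> \rank (theta_matrix H B lam U Z w) = (2 ^ g)%N.
Proof.
move=> dec w wW; set A := theta_matrix _ _ _ _ _ _.
rewrite -mxrank_tr -size_Z; apply/eqP; rewrite -/(row_free A^T).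
apply: inj_row_free => x xA.
have xA0 (i : 'I_(size U)) : \sum_j x 0 j * A i j = 0.
  have E := congr1 (fun M : 'rV_(size U) => M 0 i) xA; rewrite mxE [RHS]mxE in E.
  by rewrite -[RHS]E; apply: eq_bigr => j _; rewrite [A^T _ _]mxE.
pose e (j : 'I_(size Z)) : I := Kt_inv w - lat (half_inv Z`_j).
pose phi F := \sum_j x 0 j * bcoef 2 F (e j).
have phi_sum (J : Type) (r : seq J) (F : J -> V -> C) : (forall j, quasi 2 (F j)) ->
    phi (fun v => \sum_(j <- r) F j v) = \sum_(j <- r) phi (F j).
  move=> h; rewrite /phi exchange_big; apply: eq_bigr => j _.
  by rewrite bcoef_sum // mulr_sumr.
have phiZ c F : quasi 2 F -> phi (fun v => c * F v) = c * phi F.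
  by move=> h; rewrite /phi mulr_sumr; apply: eq_bigr => j _; rewrite bcoefZ // mulrCA.
have qth u : quasi 1 (theta 1 u) by exact: (theta_quasi symp Bext d_gt0).
(* All [e j] lie in one class modulo Lambda_1, so the congruence condition does not depend on [j];
   what remains is a multiple of the relation in row [a]. *)
have phi_theta a b : a \in U -> phi (fun v => theta 1 (Kt_inv a) v * theta 1 (Kt_inv b) v) = 0.
  move=> aU; rewrite /phi.
  have ai : (index a U < size U)%N by rewrite index_mem.
  have {xA}xa := xA0 (Ordinal ai); rewrite -[RHS](mulr0 (`[< lat_eq 1 (Kt_inv w) (Kt_inv a + Kt_inv b) >])%:R).
  rewrite -[in RHS]xa mulr_sumr.
  apply: eq_bigr => j _; rewrite bcoef_theta_prod /A (theta_matrixE _ _ wW) /= nth_index //.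
  rewrite mulrCA.
  suff -> : `[< lat_eq 1 (e j) (Kt_inv a + Kt_inv b) >] = `[< lat_eq 1 (Kt_inv w) (Kt_inv a + Kt_inv b) >] by [].
  apply: asbool_equiv_eq.
  have ej : lat_eq 1 (e j) (Kt_inv w) by exists (- half_inv Z`_j); rewrite latN mulr1n.
  split; [exact: lat_eq_trans (lat_eq_sym ej)|exact: lat_eq_trans].
have phi_prod s t : quasi 1 s -> quasi 1 t -> phi (fun v => s v * t v) = 0.
  move=> qs qt.
  rewrite (_ : (fun v => _) = fun v => \sum_(a <- U) bcoef 1 s (Kt_inv a) *
     \sum_(b <- U) bcoef 1 t (Kt_inv b) * (theta 1 (Kt_inv a) v * theta 1 (Kt_inv b) v)); last first.
    apply/funext => v; rewrite (theta_expansion qs) (theta_expansion qt) mulr_suml.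
    apply: eq_bigr => a _; rewrite -mulrA; congr (_ * _); rewrite mulr_sumr.
    by apply: eq_bigr => b _; rewrite mulrCA.
  have q1 a b : quasi 2 (fun v => bcoef 1 t (Kt_inv b) * (theta 1 (Kt_inv a) v * theta 1 (Kt_inv b) v)).
    by apply: quasiZ; exact: quasiM.
  rewrite phi_sum => [|a]; last by apply: quasiZ; exact: quasi_sum.
  rewrite big_seq big1 // => a aU; rewrite phiZ; last exact: quasi_sum.
  rewrite phi_sum // big1 ?mulr0 // => b _; rewrite phiZ; last exact: quasiM.
  by rewrite phi_theta // mulr0.
apply/rowP => j0; rewrite mxE.
have qF : quasi 2 (theta 2 (e j0)) by exact: (theta_quasi symp Bext d_gt0).
have [n [s [t [st FE]]]] := dec _ qF.
have : phi (theta 2 (e j0)) = 0.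
  rewrite (_ : theta 2 (e j0) = fun v => \sum_k s k v * t k v); last by apply/funext.
  have qst k : quasi 2 (fun v => s k v * t k v) by have [] := st k; exact: quasiM.
  by rewrite phi_sum // big1 // => k _; have [] := st k; exact: phi_prod.
rewrite /phi (bigD1 j0) //= big1 ?addr0 => [|j jj0].
  by rewrite bcoef_theta // asboolT ?mulr1 //; exact: lat_eq_refl.
(* Distinct representatives in [Z] give indices that are not congruent modulo 2 Lambda_1. *)
rewrite bcoef_theta // asboolF ?mulr0 // => -[l E].
have [uZ _ _ _] := hZ.
case/eqP: jj0; apply: val_inj; apply/eqP; rewrite -(nth_uniq 0 (ltn_ord j) (ltn_ord j0) uZ); apply/eqP.
have inZ (i : 'I_(size Z)) : Z`_i \in Z by apply: mem_nth; exact: ltn_ord.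
apply: Z_unique => //; exists (- l).
move: E; rewrite /e latN; move: (lat _) (lat _) (lat _) => p q r /eqP.
rewrite -addrA (inj_eq (addrI _)) => /eqP E.
by apply: oppr_inj; rewrite E opprD mulNrn opprK.
Qed.

(** A class of K_1 is written w + 2k with w in [W]. Full rank solves the system prescribing the
    coefficients of F on this class, and the products of theta series with indices x + k and w + k -
    x realize the solution: the indices add up to w + 2k, and k drops out of 2(x + k) - (w + 2k -
    2z). *)
Lemma decomposition_of_rank :
  (forall w, w \in W -> \rank (theta_matrix H B lam U Z w) = (2 ^ g)%N) ->
  forall F, quasi 2 F ->
  exists (n : nat) (s t : 'I_n -> V -> C), (forall k, quasi 1 (s k) /\ quasi 1 (t k)) /\
    forall v, F v = \sum_k s k v * t k v.
Proof.
move=> hr F qF.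
have qth u : quasi 1 (theta 1 u) by exact: (theta_quasi symp Bext d_gt0).
have cover n : exists wk : V * I, wk.1 \in W /\ lat_eq 1 n (Kt_inv wk.1 + wk.2 *+ 2).
  have [_ _ h _] := hW; have [|w wW /twiceK1P [k [l E]]] := h (Kt n); first by apply/K1P; exists n.
  exists (w, k); split=> //=; exists l; apply: Kt_inj.
  by rewrite mulr1n -addrA KtD W_K // -E addrC subrK.
have sol n : exists p : V * I * (V -> C),
    [/\ p.1.1 \in W, lat_eq 1 n (Kt_inv p.1.1 + p.1.2 *+ 2) &
     forall z, z \in Z ->
      \sum_(x <- U) p.2 x * Nval (Kt_inv x *+ 2 - (Kt_inv p.1.1 - lat (half_inv z))) =
      bcoef 2 F (Kt_inv p.1.1 + p.1.2 *+ 2 - lat (half_inv z))].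
  have [[w k] /= [wW nwk]] := cover n.
  set A := theta_matrix H B lam U Z w.
  have fA : row_full A by rewrite /row_full hr // size_Z.
  pose b : 'rV_(size Z) := \row_j bcoef 2 F (Kt_inv w + k *+ 2 - lat (half_inv Z`_j)).
  have /submxP [y yE] : (b <= A)%MS by exact: submx_full.
  (* The solution row becomes a function on vectors, with value 0 outside [U]. *)
  exists (w, k, fun x => if insub (index x U) is Some i then y 0 i else 0); split=> // z zZ /=.
  have zi : (index z Z < size Z)%N by rewrite index_mem.
  have /rowP/(_ (Ordinal zi)) := yE; rewrite !mxE /= nth_index // => ->.
  rewrite (big_nth 0) big_mkord; apply: eq_bigr => i _.
  have [uU _ _ _] := hU.
  rewrite index_uniq // insubT //= => iU; rewrite (theta_matrixE _ _ wW) /= nth_index //.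
  by congr (y 0 _ * _); apply: val_inj.
have [p hp] := choice sol.
(* In a pair [q], the first entry selects a class of K_1 and the second a row of the matrix. *)
pose th1 (q : V * V) := theta 1 (Kt_inv q.2 + (p (Kt_inv q.1)).1.2).
pose th2 (q : V * V) := theta 1 (Kt_inv (p (Kt_inv q.1)).1.1 + (p (Kt_inv q.1)).1.2 - Kt_inv q.2).
pose y (q : V * V) := (p (Kt_inv q.1)).2 q.2.
pose r := [seq (x', x) | x' <- U, x <- U].
pose s q v := y q * th1 q v.
have qs q : quasi 1 (s q) by apply: quasiZ; exact: qth.
suff FE : F =1 fun v => \sum_(q <- r) s q v * th2 q v.
  exists (size r), (fun k => s (nth (0, 0) r k)), (fun k => th2 (nth (0, 0) r k)).
  split=> [k|v]; first by split; [exact: qs|exact: qth].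
  by rewrite FE (big_nth (0, 0)) big_mkord.
have qst q : quasi 2 (fun v => s q v * th2 q v) by apply: quasiM => //; exact: qth.
apply: (bcoef_inj qF); first exact: quasi_sum.
move=> n; rewrite bcoef_sum // big_allpairs.
have [x0 x0U nx0] := U_cover n; have [uU _ _ _] := hU.
have term x' x : bcoef 2 (fun v => s (x', x) v * th2 (x', x) v) n =
    y (x', x) * ((`[< lat_eq 1 n (Kt_inv (p (Kt_inv x')).1.1 + (p (Kt_inv x')).1.2 *+ 2) >])%:R *
    Nval ((Kt_inv x + (p (Kt_inv x')).1.2) *+ 2 - n)).
  have -> : (fun v => s (x', x) v * th2 (x', x) v) =
      fun v => y (x', x) * (th1 (x', x) v * th2 (x', x) v).
    by apply/funext => v; rewrite /s mulrA.
  rewrite bcoefZ; last by apply: quasiM; exact: qth.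
  rewrite /th1 /th2 bcoef_theta_prod; congr (_ * ((`[< lat_eq 1 n _ >])%:R * _)) => /=.
  by rewrite addrC addrA subrK mulr2n addrA.
(* Only the class of [n], represented by [x0], contributes. *)
rewrite (bigD1_seq x0) //= [X in _ + X]big_seq_cond [X in _ + X]big1 => [|x' /andP[x'U x'x0]]; last first.
  rewrite big1 // => x _; rewrite term asboolF ?mul0r ?mulr0 // => nx'.
  have [_ h _] := hp (Kt_inv x').
  by case/eqP: x'x0; apply: U_unique => //; apply: lat_eq_trans h (lat_eq_trans (lat_eq_sym nx') nx0).
rewrite addr0; have [wW wk hy] := hp (Kt_inv x0).
have nwk := lat_eq_trans nx0 wk; have [l nE] := nwk.
(* The sign comes from indexing the class by w - 2z. *)
have [z zZ [m lE]] := Z_cover (- l).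
have nE' : n = Kt_inv (p (Kt_inv x0)).1.1 + (p (Kt_inv x0)).1.2 *+ 2 - lat (half_inv z) + lat (- m) *+ 2.
  have lE' : lat l = - lat (- l) by rewrite latN opprK.
  by rewrite {1}nE mulr1n lE' lE opprD addrA [in RHS]latN mulNrn.
have nz : lat_eq 2 n (Kt_inv (p (Kt_inv x0)).1.1 + (p (Kt_inv x0)).1.2 *+ 2 - lat (half_inv z)).
  by exists (- m).
rewrite (lat_eq_bcoef (ltn0Sn 1) qF nz) -(hy _ zZ); apply: eq_bigr => x _; rewrite term (asboolT nwk) mul1r /y /=; congr (_ * _).
rewrite -(Nval_shift symp Bext d_gt0 _ m); congr Nval; rewrite nE' latN.
rewrite mulrnDl; move: (Kt_inv _) (p _).1.2 (lat _) (lat _) (Kt_inv _) => a b c e f.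
by apply/ffunP => i; rewrite !(ffunE, ffunMnE); ring.
Qed.

End MainTheorem.

Theorem theorem2p2 (R : realType) (g : nat)
    (Lambda : set 'rV[R[i]]_g)
    (H : {dot 'rV[R[i]]_g for Num.conj})
    (chi0 : 'rV[R[i]]_g -> R[i])
    (lam mu : 'I_g -> 'rV[R[i]]_g)
    (B : {biscalar 'rV[R[i]]_g})
    (d : 'I_g -> nat)
    (U Z W : seq 'rV[R[i]]_g) :
  let M0 := LineBundle Lambda H chi0 in
  let Lambda' := sumset (zspan lam) (zspan (fun i => (d i)%:R *: mu i)) in
  let L := pullback Lambda' M0 in
  is_lattice Lambda ->
  integral_on Lambda H ->
  unimodular_on Lambda H ->
  symplectic_basis Lambda H lam mu ->
  characteristic0 M0 lam mu ->
  is_type d ->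
  bilinear_extension H mu B ->
  representatives (K1 lam d) (zspan lam) U ->
  representatives (Z2 lam) (zspan lam) Z ->
  representatives (K1 lam d) (twiceK1 lam d) W ->
  two_normal L <->
  (forall w, w \in W -> \rank (theta_matrix H B lam U Z w) = (2 ^ g)%N).
Proof.
move=> M0 Lambda' L _ _ _ symp char0 [d_gt0 _] Bext hU hZ hW.
have [norm_dec dec_norm] := two_normal_quasi d symp Bext char0.
split=> [/norm_dec|] h.
  exact: (rank_of_decomposition symp Bext d_gt0 hU hZ hW).
apply: dec_norm; exact: (decomposition_of_rank symp Bext d_gt0 hU hZ hW).
Qed.
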